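(* Let $f$ be an entire function. Suppose there exist $\delta>0$ and $R>0$ such that, with $$\mathcal{R}=\left\{\zeta\in\mathbb{C} : \tfrac{\pi}{2}-\delta<\arg\zeta<\tfrac{\pi}{2}+\delta \text{ and } |\zeta|>R\right\},$$ (i) $f$ has no finite asymptotic value in $\mathcal{R}$; and (ii) $f'(z)\neq0$ for all $z\in f^{-1}(\mathcal{R})$. Suppose $h$ is an orientation preserving harmonic diffeomorphism from $\mathbb{C}$ into $\mathbb{H}^2$ with Hopf differential $(f')^2dz^2$. Then $h$ is not surjective.
   Context: A point $a$ of the extended complex plane is an asymptotic value of an entire function $f$ if there is a path $z(t)$, $0\le t<1$, such that $\lim_{t\to1}z(t)=\infty$ and $\lim_{t\to1}f(z(t))=a$; it is a finite asymptotic value if $a$ is finite. $\mathbb{H}^2$ is the hyperbolic plane with its conformal metric $\sigma^2(u)|du|^2$ of constant curvature $-1$. A smooth map $h$ from a domain in $\mathbb{C}$ into $\mathbb{H}^2$ is harmonic if $h_{z\bar z}+2(\log\sigma)_u(h)\,h_zh_{\bar z}=0$. Its Hopf differential is $\phi\,dz^2$ with $\phi=\sigma^2(h)\,h_z\,(\bar h)_z$, which is holomorphic. A harmonic diffeomorphism from $\mathbb{C}$ into $\mathbb{H}^2$ is a harmonic map which is a diffeomorphism onto its image (the image need not be all of $\mathbb{H}^2$); it is orientation preserving if its Jacobian is positive. *)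

(* Defs.v *)
From Stdlib Require Export Reals.
From Coquelicot Require Export Coquelicot.
Open Scope R_scope.

(** * Entire functions and asymptotic values *)

Definition entire (f : C -> C) : Prop :=
  forall z : C, @ex_derive C_AbsRing C_NormedModule f z.

(** A path is a continuous map on [0, 1); its values for other real [t] are
    irrelevant. *)
Definition finite_asymptotic_value (f : C -> C) (a : C) : Prop :=
  exists z : R -> C,
    continuous_on (fun t : R => 0 <= t < 1) z /\
    filterlim (fun t : R => Cmod (z t)) (at_left 1) (Rbar_locally p_infty) /\
    filterlim (fun t : R => f (z t)) (at_left 1) (locally a).

(** [arg] is multivalued: some argument of [zeta] must lie in the interval. *)
Definition sector (delta r : R) (zeta : C) : Prop :=
  r < Cmod zeta /\
  exists theta : R,
    PI / 2 - delta < theta < PI / 2 + delta /\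
    zeta = (Cmod zeta * cos theta, Cmod zeta * sin theta).

(** * Smooth maps between plane domains *)

Definition image (h : C -> C) (u : C) : Prop := exists z : C, h z = u.

(** [U] is meant to be open, so that having [ex_diff_n] at every point of [U]
    says that all partial derivatives of order at most [n] exist and are
    continuous on [U]. *)
Definition smooth_on (U : C -> Prop) (h : C -> C) : Prop :=
  forall (n : nat) (x y : R), U (x, y) ->
    ex_diff_n (fun s t => Re (h (s, t))) n x y /\
    ex_diff_n (fun s t => Im (h (s, t))) n x y.

Definition dx (h : C -> C) (z : C) : C :=
  (Derive (fun t => Re (h (t, Im z))) (Re z),
   Derive (fun t => Im (h (t, Im z))) (Re z)).

Definition dy (h : C -> C) (z : C) : C :=
  (Derive (fun t => Re (h (Re z, t))) (Im z),
   Derive (fun t => Im (h (Re z, t))) (Im z)).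

Definition wirtinger (h : C -> C) (z : C) : C :=
  ((dx h z - Ci * dy h z) / 2)%C.

Definition wirtinger_bar (h : C -> C) (z : C) : C :=
  ((dx h z + Ci * dy h z) / 2)%C.

Definition jacobian (h : C -> C) (z : C) : R :=
  Re (dx h z) * Im (dy h z) - Re (dy h z) * Im (dx h z).

(** Openness of the image makes [smooth_on (image h) g] meaningful (it is
    automatic for a diffeomorphism between surfaces). *)
Definition diffeo_onto_image (h : C -> C) : Prop :=
  smooth_on (fun _ => True) h /\
  open (image h) /\
  exists g : C -> C, (forall z : C, g (h z) = z) /\ smooth_on (image h) g.

(** * The hyperbolic plane, in the Poincare disk model *)

Definition hyp_plane (u : C) : Prop := Cmod u < 1.

(** The metric [sigma^2 |du|^2] has constant curvature -1. *)
Definition sigma (u : C) : R := 2 / (1 - Cmod u ^ 2).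

Definition log_sigma (u : C) : C := RtoC (ln (sigma u)).

Definition harmonic_map (h : C -> C) : Prop :=
  (forall z : C, hyp_plane (h z)) /\
  smooth_on (fun _ => True) h /\
  forall z : C,
    (wirtinger_bar (wirtinger h) z
     + 2 * wirtinger log_sigma (h z) * wirtinger h z * wirtinger_bar h z
     = 0)%C.

(** The coefficient of [dz^2] in the Hopf differential. *)
Definition hopf (h : C -> C) (z : C) : C :=
  (RtoC (sigma (h z) ^ 2)
   * wirtinger h z * wirtinger (fun w => Cconj (h w)) z)%C.

Definition harmonic_diffeo (h : C -> C) : Prop :=
  harmonic_map h /\ diffeo_onto_image h.

Definition orientation_preserving (h : C -> C) : Prop :=
  forall z : C, 0 < jacobian h z.

Definition onto_hyp_plane (h : C -> C) : Prop :=
  forall u : C, hyp_plane u -> exists z : C, h z = u.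

(* Main.v *)
Require Import Defs.
From Stdlib Require Import Reals Lra Psatz ClassicalEpsilon FunctionalExtensionality.
From Coquelicot Require Import Coquelicot.
Open Scope R_scope.

(** Why the theorem holds. Write [p = h_z], [q = h_zbar]. Since the Jacobian
    [|p|^2 - |q|^2] is positive and the Hopf differential is [f'^2], the function
    [Y = |p|^2 / |q|^2 - 1] is positive wherever [f' <> 0], and the harmonic map
    equation gives the Bochner inequality [Y_{z zbar} >= |f'|^2 Y^(3/2)]
    ([excess_subsolution]). If [f] has an inverse branch on a disc of radius
    [rho], comparison with the function [(rho^2 - |f - c|^2)^(-4)], which blows
    up on the boundary, yields [Y <= 400 / rho^4] at the point over the centre
    ([keller_osserman]).

    The sector contains a translated convex cone around the positive imaginary
    axis ([cone_sector]). If [f] omits this cone, Liouville's theorem makes [f]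
    constant, so [q] vanishes, and [h] is a bounded entire function, which is
    impossible for a positive Jacobian. Otherwise, as there are neither critical
    nor asymptotic values in the cone, a local inverse of [f] continues to an
    inverse branch [g] on the whole cone ([inverse_branch]). On the curve
    [gamma t = g (a + i t)] the discs have radius proportional to [t], so
    [Y = O(t^(-4))]. The hyperbolic speed of [h o gamma] is at most [Y]
    ([hyperbolic_speed]), because the pulled-back metric in the coordinate
    [zeta = f z] is nearly degenerate in the imaginary direction. Hence
    [h o gamma] has finite hyperbolic length and accumulates, as [t] tends to
    infinity, at a point of the open disc ([hyperbolic_curve_bounded]). If [h]
    were onto, that point would be [h z] for some [z], and by continuity of the
    inverse of [h] the curve [gamma] would accumulate at [z]; but
    [f (gamma t) = a + i t] is unbounded.

    Derivatives are handled through Wirtinger coefficients ([wirt]), which makes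
    all computations with [h] algebraic. No Cauchy theory of [f] is presupposed:
    [f'] is continuous because its square, the Hopf differential, is, and a
    derivative cannot jump between the two square roots
    ([derivative_continuous_of_square]). *)

(* [ring] and [field] recognise [C] only under its plain name. *)
Ltac Cnorm := change (UniformSpace.sort C_UniformSpace) with C in *;
  lazymatch goal with |- @eq _ ?a ?b => change (@eq C a b) end.
Ltac Cring := Cnorm; ring.
Ltac Cfield := Cnorm; field.

Lemma Cconj_RtoC (x : R) : Cconj (RtoC x) = RtoC x.
Proof. unfold Cconj, RtoC; simpl. now rewrite Ropp_0. Qed.

(** * Continuity of complex-valued functions *)

Lemma locally_Cmod (z : C) (P : C -> Prop) :
  locally z P <->
  exists d : R, 0 < d /\ forall w : C, Cmod (w - z) < d -> P w.
Proof.
split.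
- intros [d Hd]. exists d. split. apply cond_pos.
  intros w Hw. apply Hd. apply C_NormedModule_mixin_compat1. exact Hw.
- intros [d [Hd H]].
  assert (Hs : 0 < sqrt 2) by (apply sqrt_lt_R0; lra).
  assert (H0 : 0 < d / sqrt 2) by (apply Rdiv_lt_0_compat; lra).
  exists (mkposreal _ H0). intros w Hw. apply H.
  apply (C_NormedModule_mixin_compat2 z w (mkposreal _ H0)) in Hw.
  simpl in Hw. replace (sqrt 2 * (d / sqrt 2)) with d in Hw by (field; lra).
  exact Hw.
Qed.

Lemma continuous_Cmod_iff {T : UniformSpace} (F : T -> C) (x : T) :
  continuous F x <->
  forall e : R, 0 < e -> locally x (fun y => Cmod (F y - F x) < e).
Proof.
split.
- intros H e He. apply (H (fun w => Cmod (w - F x) < e)).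
  apply locally_Cmod. exists e. split; auto.
- intros H P HP. apply locally_Cmod in HP. destruct HP as [d [Hd HP]].
  unfold filtermap. generalize (H d Hd). apply filter_imp. intros y Hy. apply HP, Hy.
Qed.

Lemma continuous_C_parts {T : UniformSpace} (F : T -> C) (x : T) :
  continuous F x <->
  continuous (fun y => Re (F y)) x /\ continuous (fun y => Im (F y)) x.
Proof.
split.
- intros H. split.
  + apply (continuous_comp F Re). exact H. apply continuous_fst.
  + apply (continuous_comp F Im). exact H. apply continuous_snd.
- intros [H1 H2].
  apply (continuous_ext (fun y => (Re (F y), Im (F y)))).
  + intros y. symmetry. apply surjective_pairing.
  + apply (continuous_comp_2 (fun y => Re (F y)) (fun y => Im (F y))
      (fun a b => (a, b)) x H1 H2).
    apply (continuous_ext (fun u : R * R => u)).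
    intros [a b]; reflexivity. apply continuous_id.
Qed.

Lemma continuous_Cplus {T : UniformSpace} (F G : T -> C) (x : T) :
  continuous F x -> continuous G x -> continuous (fun y => F y + G y)%C x.
Proof.
rewrite !continuous_C_parts. intros [H1 H2] [H3 H4]. split; simpl.
- now apply (continuous_plus (V := R_NormedModule) (fun y => Re (F y))).
- now apply (continuous_plus (V := R_NormedModule) (fun y => Im (F y))).
Qed.

Lemma continuous_Cmult {T : UniformSpace} (F G : T -> C) (x : T) :
  continuous F x -> continuous G x -> continuous (fun y => F y * G y)%C x.
Proof.
rewrite !continuous_C_parts. intros [H1 H2] [H3 H4]. split; simpl.
- apply (continuous_minus (V := R_NormedModule)
    (fun y => fst (F y) * fst (G y)) (fun y => snd (F y) * snd (G y))).
  now apply (continuous_mult (K := R_AbsRing)).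
  now apply (continuous_mult (K := R_AbsRing)).
- apply (continuous_plus (V := R_NormedModule)
    (fun y => fst (F y) * snd (G y)) (fun y => snd (F y) * fst (G y))).
  now apply (continuous_mult (K := R_AbsRing)).
  now apply (continuous_mult (K := R_AbsRing)).
Qed.

Lemma continuous_Copp {T : UniformSpace} (F : T -> C) (x : T) :
  continuous F x -> continuous (fun y => - F y)%C x.
Proof.
rewrite !continuous_C_parts. intros [H1 H2]. split; simpl.
- now apply (continuous_opp (V := R_NormedModule) (fun y => Re (F y))).
- now apply (continuous_opp (V := R_NormedModule) (fun y => Im (F y))).
Qed.

Lemma continuous_Cminus {T : UniformSpace} (F G : T -> C) (x : T) :
  continuous F x -> continuous G x -> continuous (fun y => F y - G y)%C x.
Proof.
intros H1 H2. apply continuous_Cplus; [exact H1 | now apply continuous_Copp].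
Qed.

Lemma continuous_Cconj {T : UniformSpace} (F : T -> C) (x : T) :
  continuous F x -> continuous (fun y => Cconj (F y)) x.
Proof.
rewrite !continuous_C_parts. intros [H1 H2]. split; simpl.
- exact H1.
- now apply (continuous_opp (V := R_NormedModule) (fun y => Im (F y))).
Qed.

Lemma continuous_RtoC {T : UniformSpace} (u : T -> R) (x : T) :
  continuous u x -> continuous (fun y => RtoC (u y)) x.
Proof.
intros H. apply continuous_C_parts. split; simpl.
exact H. apply continuous_const.
Qed.

Lemma continuous_Cmod {T : UniformSpace} (F : T -> C) (x : T) :
  continuous F x -> continuous (fun y => Cmod (F y)) x.
Proof.
intros H P [d Hd].
unfold filtermap. generalize (proj1 (continuous_Cmod_iff F x) H d (cond_pos d)).
apply filter_imp. intros y Hy. apply Hd.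
unfold ball; simpl; unfold AbsRing_ball, abs, minus, plus, opp; simpl.
apply Rle_lt_trans with (2 := Hy).
assert (H1 := Cmod_triangle (F y - F x) (F x)).
assert (H2 := Cmod_triangle (F x - F y) (F y)).
replace (F y - F x + F x)%C with (F y) in H1 by ring.
replace (F x - F y + F y)%C with (F x) in H2 by ring.
replace (F x - F y)%C with (- (F y - F x))%C in H2 by ring.
rewrite Cmod_opp in H2. apply Rabs_le. lra.
Qed.

Lemma continuous_Cinv {T : UniformSpace} (F : T -> C) (x : T) :
  continuous F x -> F x <> 0%C -> continuous (fun y => / F y)%C x.
Proof.
intros H H0.
assert (Hn : Cmod (F x) ^ 2 <> 0)
  by (apply pow_nonzero; intros E; apply H0, Cmod_eq_0, E).
(* [/ z = conj z / |z|^2] *)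
apply (continuous_ext (fun y => Cconj (F y) * RtoC (/ (Cmod (F y) ^ 2)))%C).
- intros y. unfold Cinv, Cconj, Cmult, RtoC.
  rewrite Cmod2_alt. unfold Re, Im.
  apply injective_projections; simpl; unfold Rdiv; ring.
- apply continuous_Cmult. now apply continuous_Cconj.
  apply continuous_RtoC.
  apply (continuous_comp (fun y => Cmod (F y) ^ 2) Rinv).
  + apply (continuous_comp (fun y => Cmod (F y)) (fun t => t ^ 2)).
    now apply continuous_Cmod.
    apply (ex_derive_continuous (V := R_NormedModule)). now auto_derive.
  + apply continuous_Rinv, Hn.
Qed.

Lemma continuous_Cdiv {T : UniformSpace} (F G : T -> C) (x : T) :
  continuous F x -> continuous G x -> G x <> 0%C ->
  continuous (fun y => F y / G y)%C x.
Proof.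
intros H1 H2 H3. apply continuous_Cmult; auto. now apply continuous_Cinv.
Qed.

Lemma continuous_Cneq {T : UniformSpace} (F : T -> C) (x : T) (c : C) :
  continuous F x -> F x <> c -> locally x (fun y => F y <> c).
Proof.
intros H Hx.
assert (Hp : 0 < Cmod (F x - c)).
{ apply Cmod_gt_0. intros E. apply Hx. replace (F x) with (F x - c + c)%C by ring.
  rewrite E. ring. }
generalize (proj1 (continuous_Cmod_iff F x) H _ Hp). apply filter_imp.
intros y Hy E. rewrite E in Hy.
replace (c - F x)%C with (- (F x - c))%C in Hy by ring.
rewrite Cmod_opp in Hy. lra.
Qed.

(** * Wirtinger calculus *)

(** [F] is real-differentiable at [z] with [dF = p dz + q d(conj z)]. The
    Caratheodory form (coefficients continuous at [z]) turns the rules of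
    calculus into algebraic identities. *)
Definition wirt (F : C -> C) (z p q : C) : Prop :=
  exists P Q : C -> C,
    continuous P z /\ continuous Q z /\ P z = p /\ Q z = q /\
    locally z (fun w => F w = F z + P w * (w - z) + Q w * Cconj (w - z))%C.

Lemma wirt_continuous (F : C -> C) (z p q : C) :
  wirt F z p q -> continuous F z.
Proof.
intros [P [Q [HP [HQ [_ [_ H]]]]]].
apply continuous_ext_loc with
  (fun w => F z + P w * (w - z) + Q w * Cconj (w - z))%C.
- generalize H. apply filter_imp. intros w Hw. now symmetry.
- assert (Hid : continuous (fun w : C => w - z)%C z)
    by (apply continuous_Cminus; [apply continuous_id | apply continuous_const]).
  repeat apply continuous_Cplus; try apply continuous_const;
    apply continuous_Cmult; auto; now apply continuous_Cconj.
Qed.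

Lemma wirt_ext_loc (F G : C -> C) (z p q : C) :
  locally z (fun w => F w = G w) -> wirt F z p q -> wirt G z p q.
Proof.
intros E [P [Q [HP [HQ [Hp [Hq H]]]]]]. exists P, Q. repeat split; auto.
assert (E0 := locally_singleton _ _ E).
generalize (filter_and _ _ E H). apply filter_imp. intros w [H1 H2].
now rewrite <- H1, <- E0.
Qed.

Lemma wirt_eq (F : C -> C) (z p q p' q' : C) :
  wirt F z p q -> p = p' -> q = q' -> wirt F z p' q'.
Proof. now intros H <- <-. Qed.

Lemma wirt_const (c z : C) : wirt (fun _ => c) z 0 0.
Proof.
exists (fun _ => 0%C), (fun _ => 0%C).
repeat split; try apply continuous_const.
apply filter_forall. intros w. Cring.
Qed.

Lemma wirt_id (z : C) : wirt (fun w => w) z 1 0.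
Proof.
exists (fun _ => 1%C), (fun _ => 0%C).
repeat split; try apply continuous_const.
apply filter_forall. intros w. Cring.
Qed.

Lemma wirt_plus (F G : C -> C) (z p q p' q' : C) :
  wirt F z p q -> wirt G z p' q' ->
  wirt (fun w => F w + G w)%C z (p + p') (q + q').
Proof.
intros [P [Q [HP [HQ [<- [<- H]]]]]] [P' [Q' [HP' [HQ' [<- [<- H']]]]]].
exists (fun w => P w + P' w)%C, (fun w => Q w + Q' w)%C.
repeat split; try now apply continuous_Cplus.
generalize (filter_and _ _ H H'). apply filter_imp. intros w [E E'].
rewrite E, E'. Cring.
Qed.

Lemma wirt_mult (F G : C -> C) (z p q p' q' : C) :
  wirt F z p q -> wirt G z p' q' ->
  wirt (fun w => F w * G w)%C z (p * G z + F z * p') (q * G z + F z * q').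
Proof.
intros HF HG. assert (CG := wirt_continuous _ _ _ _ HG).
destruct HF as [P [Q [HP [HQ [<- [<- H]]]]]].
destruct HG as [P' [Q' [HP' [HQ' [<- [<- H']]]]]].
exists (fun w => P w * G w + F z * P' w)%C, (fun w => Q w * G w + F z * Q' w)%C.
repeat split;
  try (apply continuous_Cplus; apply continuous_Cmult; auto; apply continuous_const).
generalize (filter_and _ _ H H'). apply filter_imp. intros w [E E'].
rewrite E.
transitivity (F z * G w + P w * G w * (w - z) + Q w * G w * Cconj (w - z))%C.
Cring. rewrite E' at 1. Cring.
Qed.

Lemma wirt_scal (c : C) (F : C -> C) (z p q : C) :
  wirt F z p q -> wirt (fun w => c * F w)%C z (c * p) (c * q).
Proof.
intros H. eapply wirt_eq. apply wirt_mult. apply (wirt_const c). exact H.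
simpl; Cring. simpl; Cring.
Qed.

Lemma wirt_opp (F : C -> C) (z p q : C) :
  wirt F z p q -> wirt (fun w => - F w)%C z (- p) (- q).
Proof.
intros H. eapply wirt_eq.
eapply wirt_ext_loc; [| apply (wirt_scal (- (1))), H].
apply filter_forall; intros w; simpl; Cring. Cring. Cring.
Qed.

Lemma wirt_minus (F G : C -> C) (z p q p' q' : C) :
  wirt F z p q -> wirt G z p' q' ->
  wirt (fun w => F w - G w)%C z (p - p') (q - q').
Proof. intros HF HG. apply wirt_plus; auto. now apply wirt_opp. Qed.

Lemma wirt_conj (F : C -> C) (z p q : C) :
  wirt F z p q -> wirt (fun w => Cconj (F w)) z (Cconj q) (Cconj p).
Proof.
intros [P [Q [HP [HQ [<- [<- H]]]]]].
exists (fun w => Cconj (Q w)), (fun w => Cconj (P w)).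
repeat split; try now apply continuous_Cconj.
generalize H. apply filter_imp. intros w E. rewrite E.
rewrite !Cplus_conj, !Cmult_conj, Cconj_conj. Cring.
Qed.

Lemma wirt_inv (F : C -> C) (z p q : C) :
  wirt F z p q -> F z <> 0%C ->
  wirt (fun w => / F w)%C z (- p / (F z * F z)) (- q / (F z * F z)).
Proof.
intros HF Hz. assert (CF := wirt_continuous _ _ _ _ HF).
destruct HF as [P [Q [HP [HQ [<- [<- H]]]]]].
exists (fun w => - P w / (F w * F z))%C, (fun w => - Q w / (F w * F z))%C.
assert (N : (F z * F z <> 0)%C) by now apply Cmult_neq_0.
repeat split;
  try (apply continuous_Cdiv; [now apply continuous_Copp |
    apply continuous_Cmult; auto; apply continuous_const | exact N]).
generalize (filter_and _ _ H (continuous_Cneq _ _ 0%C CF Hz)).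
apply filter_imp. intros w [E Nw].
transitivity (/ F z - (F w - F z) / (F w * F z))%C. now Cfield.
rewrite E at 1. now Cfield.
Qed.

Lemma wirt_div (F G : C -> C) (z p q p' q' : C) :
  wirt F z p q -> wirt G z p' q' -> G z <> 0%C ->
  wirt (fun w => F w / G w)%C z ((p * G z - F z * p') / (G z * G z))
    ((q * G z - F z * q') / (G z * G z)).
Proof.
intros HF HG N. eapply wirt_eq.
apply wirt_mult. exact HF. apply wirt_inv. exact HG. exact N.
simpl; now Cfield. simpl; now Cfield.
Qed.

(** The usual little-o form of real differentiability suffices. *)
Lemma wirt_of_little_o (F : C -> C) (z p q : C) :
  (forall e : R, 0 < e -> locally z (fun w =>
     Cmod (F w - F z - (p * (w - z) + q * Cconj (w - z))) <= e * Cmod (w - z))) ->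
  wirt F z p q.
Proof.
intros H.
set (E := fun w => (F w - F z - (p * (w - z) + q * Cconj (w - z)))%C).
(* the remainder is put into the first coefficient; at [w = z] the quotient is
   the junk value [0 * / 0 = 0] *)
exists (fun w => p + E w / (w - z))%C, (fun _ => q).
assert (E0 : (E z / (z - z) = 0)%C).
{ unfold E. replace (z - z)%C with (0 : C) by Cring.
  replace (F z - F z - (p * 0 + q * Cconj 0))%C with (0 : C). unfold Cdiv; Cring.
  unfold Cconj; simpl. replace (0, -0)%R with (0 : C). Cring.
  unfold RtoC; f_equal; ring. }
split; [|split; [|split; [|split]]].
- apply continuous_Cplus. apply continuous_const.
  apply continuous_Cmod_iff. intros e He. rewrite E0.
  assert (He2 : 0 < e / 2) by lra.
  generalize (H _ He2). apply filter_imp. intros w Hw. fold (E w) in Hw.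
  replace (E w / (w - z) - 0)%C with (E w / (w - z))%C by Cring.
  destruct (Ceq_dec w z) as [->|N].
  + rewrite E0, Cmod_0. lra.
  + assert (N' : (w - z <> 0)%C).
    { intros Z. apply N. replace w with (w - z + z)%C by Cring. rewrite Z. Cring. }
    rewrite Cmod_div; auto. apply Cmod_gt_0 in N'.
    apply Rle_lt_trans with (e / 2); [|lra].
    apply Rle_div_l; auto.
- apply continuous_const.
- rewrite E0. Cring.
- reflexivity.
- apply filter_forall. intros w.
  destruct (Ceq_dec w z) as [->|N].
  + replace (z - z)%C with (0 : C) by Cring.
    replace (Cconj 0) with (0 : C). Cring.
    now rewrite Cconj_RtoC.
  + assert (N' : (w - z <> 0)%C).
    { intros Z. apply N. replace w with (w - z + z)%C by Cring. rewrite Z. Cring. }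
    unfold E. Cfield. exact N'.
Qed.

Lemma wirt_of_is_derive (F : C -> C) (z l : C) :
  is_derive (K := C_AbsRing) (V := C_NormedModule) F z l -> wirt F z l 0.
Proof.
intros [_ H]. apply wirt_of_little_o. intros e He.
specialize (H z (fun P HP => HP) (mkposreal e He)).
apply locally_C. revert H. apply filter_imp. intros w Hw.
unfold norm, minus, scal, plus, opp in Hw; simpl in Hw.
eapply Rle_trans; [|exact Hw]. right. f_equal.
unfold mult; simpl. Cring.
Qed.

Lemma wirt_of_real_parts (F : C -> C) (x y a b c d : R) :
  differentiable_pt_lim (fun s t => Re (F (s, t))) x y a b ->
  differentiable_pt_lim (fun s t => Im (F (s, t))) x y c d ->
  wirt F (x, y) ((a + d) / 2, (c - b) / 2) ((a - d) / 2, (c + b) / 2).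
Proof.
intros H1 H2. apply wirt_of_little_o. intros e He.
assert (He2 : 0 < e / 2) by lra.
destruct (H1 (mkposreal _ He2)) as [d1 K1].
destruct (H2 (mkposreal _ He2)) as [d2 K2].
apply locally_Cmod. exists (Rmin d1 d2). split.
apply Rmin_stable_in_posreal.
intros [u v] Hw.
assert (Hu := Rmax_Cmod ((u, v) - (x, y))%C).
simpl in Hu.
assert (L1 := Rmin_l d1 d2). assert (L2 := Rmin_r d1 d2).
assert (M1 := Rmax_l (Rabs (u + - x)) (Rabs (v + - y))).
assert (M2 := Rmax_r (Rabs (u + - x)) (Rabs (v + - y))).
specialize (K1 u v). specialize (K2 u v). simpl in K1, K2.
unfold Rminus in K1, K2.
assert (K1' := K1 ltac:(lra) ltac:(lra)).
assert (K2' := K2 ltac:(lra) ltac:(lra)). clear K1 K2.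
set (m := Rmax (Rabs (u + - x)) (Rabs (v + - y))) in *.
set (M := Cmod ((u, v) - (x, y))) in *.
match goal with |- Cmod ?X <= _ =>
  assert (HX : Cmod X <= Rabs (Re X) + Rabs (Im X)) end.
{ match goal with |- Cmod ?X <= _ => generalize X; intros Z end.
  replace Z with (RtoC (Re Z) + Ci * RtoC (Im Z))%C at 1.
  eapply Rle_trans. apply Cmod_triangle.
  rewrite Cmod_mult, Cmod_Ci, !Cmod_R. lra.
  destruct Z; unfold RtoC, Ci, Cmult, Cplus; simpl; f_equal; ring. }
eapply Rle_trans. apply HX. clear HX.
assert (B : e / 2 * m <= e / 2 * M) by (apply Rmult_le_compat_l; lra).
apply Rle_trans with (e / 2 * m + e / 2 * m); [|lra].
apply Rplus_le_compat.
- eapply Rle_trans; [|exact K1']. right. f_equal. simpl. unfold Re. field.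
- eapply Rle_trans; [|exact K2']. right. f_equal. simpl. unfold Im. field.
Qed.

(** ** Derivatives along curves *)

(** [v] is the velocity of the curve [g] at time [t]. *)
Definition curve_deriv (g : R -> C) (t : R) (v : C) : Prop :=
  is_derive (fun s => Re (g s)) t (Re v) /\ is_derive (fun s => Im (g s)) t (Im v).

Lemma is_derive_caratheodory (u : R -> R) (t l : R) :
  is_derive u t l <->
  exists U : R -> R, continuous U t /\ U t = l /\
    forall s, u s = u t + U s * (s - t).
Proof.
split.
- intros H. exists (fun s => if Req_EM_T s t then l else (u s - u t) / (s - t)).
  assert (E : (if Req_EM_T t t then l else (u t - u t) / (t - t)) = l)
    by (destruct (Req_EM_T t t); congruence).
  split; [|split].
  + apply continuity_pt_filterlim. intros e He.
    destruct (proj1 (is_derive_Reals u t l) H e He) as [d Hd].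
    exists d. split. apply cond_pos. intros s [[_ Hs] Hst].
    unfold Rlimit.dist in *; simpl in *; unfold Rdist in *. rewrite E.
    destruct (Req_EM_T s t) as [->|N]. now elim Hs.
    specialize (Hd (s - t) ltac:(lra) Hst).
    replace (t + (s - t)) with s in Hd by ring. exact Hd.
  + exact E.
  + intros s. destruct (Req_EM_T s t) as [->|N]. ring. field. lra.
- intros [U [HU [<- H]]]. apply is_derive_Reals. intros e He.
  apply continuity_pt_filterlim in HU. destruct (HU e He) as [d [Hd K]].
  exists (mkposreal d Hd). intros k Hk Hkd. simpl in Hkd.
  rewrite (H (t + k)).
  replace ((u t + U (t + k) * (t + k - t) - u t) / k - U t) with (U (t + k) - U t)
    by (field; auto).
  apply (K (t + k)). split. split. exact I. lra.
  unfold Rlimit.dist; simpl; unfold Rdist.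
  now replace (t + k - t) with k by ring.
Qed.

Lemma curve_deriv_continuous (g : R -> C) (t : R) (v : C) :
  curve_deriv g t v -> continuous g t.
Proof.
intros [H1 H2]. apply continuous_C_parts. split;
  (apply (ex_derive_continuous (V := R_NormedModule)); eexists; eassumption).
Qed.

Lemma curve_deriv_caratheodory (g : R -> C) (t : R) (v : C) :
  curve_deriv g t v <->
  exists V : R -> C, continuous V t /\ V t = v /\
    forall s, (g s = g t + V s * RtoC (s - t))%C.
Proof.
unfold curve_deriv. rewrite !is_derive_caratheodory. split.
- intros [[U1 [C1 [E1 H1]]] [U2 [C2 [E2 H2]]]].
  exists (fun s => (U1 s, U2 s)). split; [|split].
  + apply continuous_C_parts. now split.
  + rewrite E1, E2. now rewrite <- surjective_pairing.
  + intros s. apply injective_projections; simpl.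
    unfold Re in H1. rewrite H1. ring. unfold Im in H2. rewrite H2. ring.
- intros [V [CV [<- H]]]. apply continuous_C_parts in CV. destruct CV as [C1 C2].
  split.
  + exists (fun s => Re (V s)). repeat split; auto.
    intros s. rewrite H at 1. simpl. unfold Re. ring.
  + exists (fun s => Im (V s)). repeat split; auto.
    intros s. rewrite H at 1. simpl. unfold Im, Re. ring.
Qed.

Lemma wirt_curve (F : C -> C) (g : R -> C) (t : R) (p q v : C) :
  wirt F (g t) p q -> curve_deriv g t v ->
  curve_deriv (fun s => F (g s)) t (p * v + q * Cconj v).
Proof.
intros HF Hg. assert (Cg := curve_deriv_continuous _ _ _ Hg).
apply curve_deriv_caratheodory in Hg. destruct Hg as [V [CV [<- H]]].
destruct HF as [P [Q [HP [HQ [<- [<- K]]]]]].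
apply Cg in K. unfold filtermap in K.
(* only the germ of the difference quotient is controlled *)
set (W := fun s => (P (g s) * V s + Q (g s) * Cconj (V s))%C).
assert (CW : continuous W t).
{ unfold W. apply continuous_Cplus; apply continuous_Cmult; auto.
  now apply (continuous_comp g P). now apply (continuous_comp g Q).
  now apply continuous_Cconj. }
assert (KW : locally t (fun s => F (g s) = F (g t) + W s * RtoC (s - t))%C).
{ revert K. apply filter_imp. intros s ->. unfold W.
  replace (g s - g t)%C with (V s * RtoC (s - t))%C by (rewrite (H s); ring).
  rewrite Cmult_conj.
  replace (Cconj (RtoC (s - t))) with (RtoC (s - t)). ring.
  now rewrite Cconj_RtoC. }
fold (W t).
assert (D : curve_deriv (fun s => F (g t) + W s * RtoC (s - t))%C t (W t)).
{ apply curve_deriv_caratheodory. exists W. repeat split; auto.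
  intros s. replace (t - t) with 0 by ring. ring. }
destruct D as [D1 D2]. split.
- eapply is_derive_ext_loc; [|exact D1].
  revert KW. apply filter_imp. intros s E. now rewrite <- E.
- eapply is_derive_ext_loc; [|exact D2].
  revert KW. apply filter_imp. intros s E. now rewrite <- E.
Qed.

Lemma curve_deriv_line (a v : C) (t : R) :
  curve_deriv (fun s => a + RtoC s * v)%C t v.
Proof. destruct a, v. split; unfold Re, Im; simpl; auto_derive; auto; ring. Qed.

(** * Smooth functions and their Wirtinger derivatives *)

(** First partial derivatives of a function of two real variables. *)
Definition D1 (u : R -> R -> R) (x y : R) : R := Derive (fun z => u z y) x.
Definition D2 (u : R -> R -> R) (x y : R) : R := Derive (fun z => u x z) y.

(** All partial derivatives exist and are continuous on the plane. *)
Definition smooth2 (u : R -> R -> R) : Prop := forall n x y, ex_diff_n u n x y.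

Lemma smooth2_D1 (u : R -> R -> R) : smooth2 u -> smooth2 (D1 u).
Proof. intros H n x y. exact (proj1 (proj2 (proj2 (proj2 (H (S n) x y))))). Qed.

Lemma smooth2_D2 (u : R -> R -> R) : smooth2 u -> smooth2 (D2 u).
Proof. intros H n x y. exact (proj2 (proj2 (proj2 (proj2 (H (S n) x y))))). Qed.

Lemma smooth2_continuity (u : R -> R -> R) (x y : R) :
  smooth2 u -> continuity_2d_pt u x y.
Proof. intros H. exact (proj1 (H 0%nat x y)). Qed.

Lemma smooth2_ex_D1 (u : R -> R -> R) (x y : R) :
  smooth2 u -> ex_derive (fun z => u z y) x.
Proof. intros H. exact (proj1 (proj2 (H 1%nat x y))). Qed.

Lemma smooth2_ex_D2 (u : R -> R -> R) (x y : R) :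
  smooth2 u -> ex_derive (fun z => u x z) y.
Proof. intros H. exact (proj1 (proj2 (proj2 (H 1%nat x y)))). Qed.

Lemma smooth2_lin (a b : R) (u v : R -> R -> R) :
  smooth2 u -> smooth2 v -> smooth2 (fun x y => a * u x y + b * v x y).
Proof.
intros Hu Hv n. revert u v Hu Hv. induction n; intros u v Hu Hv x y.
- split; auto. apply continuity_2d_pt_plus; apply continuity_2d_pt_mult;
    try apply continuity_2d_pt_const; now apply smooth2_continuity.
- assert (E1 : (fun x0 y0 => Derive (fun z => a * u z y0 + b * v z y0) x0)
             = (fun x0 y0 => a * D1 u x0 y0 + b * D1 v x0 y0)).
  { apply functional_extensionality; intros x0;
    apply functional_extensionality; intros y0. unfold D1.
    rewrite Derive_plus, !Derive_scal; auto;
      apply ex_derive_scal; now apply smooth2_ex_D1. }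
  assert (E2 : (fun x0 y0 => Derive (fun z => a * u x0 z + b * v x0 z) y0)
             = (fun x0 y0 => a * D2 u x0 y0 + b * D2 v x0 y0)).
  { apply functional_extensionality; intros x0;
    apply functional_extensionality; intros y0. unfold D2.
    rewrite Derive_plus, !Derive_scal; auto;
      apply ex_derive_scal; now apply smooth2_ex_D2. }
  split; [|split; [|split; [|split]]].
  + apply continuity_2d_pt_plus; apply continuity_2d_pt_mult;
    try apply continuity_2d_pt_const; now apply smooth2_continuity.
  + apply (ex_derive_plus (V := R_NormedModule) (fun z => a * u z y));
      apply ex_derive_scal; now apply smooth2_ex_D1.
  + apply (ex_derive_plus (V := R_NormedModule) (fun z => a * u x z));
      apply ex_derive_scal; now apply smooth2_ex_D2.
  + rewrite E1. apply IHn; now apply smooth2_D1.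
  + rewrite E2. apply IHn; now apply smooth2_D2.
Qed.

Lemma smooth2_differentiable (u : R -> R -> R) (x y : R) :
  smooth2 u -> differentiable_pt_lim u x y (D1 u x y) (D2 u x y).
Proof.
intros H. apply filterdiff_differentiable_pt_lim.
apply (is_derive_filterdiff u x y (D1 u) (D2 u x y)).
- apply filter_forall. intros [a b]. apply Derive_correct, smooth2_ex_D1, H.
- apply Derive_correct, smooth2_ex_D2, H.
- apply continuity_2d_pt_filterlim. now apply smooth2_continuity, smooth2_D1.
Qed.

Lemma smooth2_schwarz (u : R -> R -> R) (x y : R) :
  smooth2 u -> D1 (D2 u) x y = D2 (D1 u) x y.
Proof.
intros H.
assert (H1 := smooth2_D1 _ H). assert (H2 := smooth2_D2 _ H).
apply (Schwarz u x y).
- exists (mkposreal 1 Rlt_0_1). intros s t _ _.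
  split; [|split; [|split]].
  now apply smooth2_ex_D1. now apply smooth2_ex_D2.
  now apply (smooth2_ex_D1 (D2 u)). now apply (smooth2_ex_D2 (D1 u)).
- now apply (smooth2_continuity (D1 (D2 u))), smooth2_D1.
- now apply (smooth2_continuity (D2 (D1 u))), smooth2_D2.
Qed.

(** Smoothness on the whole plane. *)
Definition smooth (F : C -> C) : Prop :=
  smooth2 (fun s t => Re (F (s, t))) /\ smooth2 (fun s t => Im (F (s, t))).

Lemma smooth_on_smooth (F : C -> C) : smooth_on (fun _ => True) F -> smooth F.
Proof. intros H. split; intros n x y; now apply H. Qed.

Section Smooth.

Variable F : C -> C.
Hypothesis HF : smooth F.

Let u s t := Re (F (s, t)).
Let v s t := Im (F (s, t)).

Lemma wirtinger_parts (x y : R) :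
  wirtinger F (x, y) = ((D1 u x y + D2 v x y) / 2, (D1 v x y - D2 u x y) / 2).
Proof.
unfold wirtinger, dx, dy. apply injective_projections; simpl;
unfold D1, D2, u, v; simpl; field.
Qed.

Lemma wirtinger_bar_parts (x y : R) :
  wirtinger_bar F (x, y) = ((D1 u x y - D2 v x y) / 2, (D1 v x y + D2 u x y) / 2).
Proof.
unfold wirtinger_bar, dx, dy. apply injective_projections; simpl;
unfold D1, D2, u, v; simpl; field.
Qed.

Lemma smooth_wirt (z : C) : wirt F z (wirtinger F z) (wirtinger_bar F z).
Proof.
destruct z as [x y]. rewrite wirtinger_parts, wirtinger_bar_parts.
apply wirt_of_real_parts; now apply smooth2_differentiable, HF.
Qed.

Lemma smooth_wirtinger : smooth (wirtinger F).
Proof.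
destruct HF as [Hu Hv]. fold u in Hu; fold v in Hv. split.
- replace (fun s t => Re (wirtinger F (s, t)))
    with (fun s t => / 2 * D1 u s t + / 2 * D2 v s t).
  apply smooth2_lin. now apply smooth2_D1. now apply smooth2_D2.
  apply functional_extensionality; intros s;
    apply functional_extensionality; intros t.
  rewrite wirtinger_parts; simpl. field.
- replace (fun s t => Im (wirtinger F (s, t)))
    with (fun s t => / 2 * D1 v s t + - / 2 * D2 u s t).
  apply smooth2_lin. now apply smooth2_D1. now apply smooth2_D2.
  apply functional_extensionality; intros s;
    apply functional_extensionality; intros t.
  rewrite wirtinger_parts; simpl. field.
Qed.

Lemma smooth_wirtinger_bar : smooth (wirtinger_bar F).
Proof.
destruct HF as [Hu Hv]. fold u in Hu; fold v in Hv. split.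
- replace (fun s t => Re (wirtinger_bar F (s, t)))
    with (fun s t => / 2 * D1 u s t + - / 2 * D2 v s t).
  apply smooth2_lin. now apply smooth2_D1. now apply smooth2_D2.
  apply functional_extensionality; intros s;
    apply functional_extensionality; intros t.
  rewrite wirtinger_bar_parts; simpl. field.
- replace (fun s t => Im (wirtinger_bar F (s, t)))
    with (fun s t => / 2 * D1 v s t + / 2 * D2 u s t).
  apply smooth2_lin. now apply smooth2_D1. now apply smooth2_D2.
  apply functional_extensionality; intros s;
    apply functional_extensionality; intros t.
  rewrite wirtinger_bar_parts; simpl. field.
Qed.

End Smooth.

Lemma D1_lin (a b : R) (u v : R -> R -> R) (x y : R) : smooth2 u -> smooth2 v ->
  D1 (fun s t => a * u s t + b * v s t) x y = a * D1 u x y + b * D1 v x y.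
Proof.
intros Hu Hv. unfold D1. rewrite Derive_plus, !Derive_scal; auto;
  apply ex_derive_scal; now apply smooth2_ex_D1.
Qed.

Lemma D2_lin (a b : R) (u v : R -> R -> R) (x y : R) : smooth2 u -> smooth2 v ->
  D2 (fun s t => a * u s t + b * v s t) x y = a * D2 u x y + b * D2 v x y.
Proof.
intros Hu Hv. unfold D2. rewrite Derive_plus, !Derive_scal; auto;
  apply ex_derive_scal; now apply smooth2_ex_D2.
Qed.

(** Both sides are a quarter of the Laplacian. *)
Lemma wirtinger_comm (F : C -> C) (z : C) : smooth F ->
  wirtinger (wirtinger_bar F) z = wirtinger_bar (wirtinger F) z.
Proof.
intros HF. destruct z as [x y]. destruct HF as [Hu Hv].
rewrite wirtinger_parts, wirtinger_bar_parts.
set (u := fun s t => Re (F (s, t))) in *.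
set (v := fun s t => Im (F (s, t))) in *.
assert (E1 : (fun s t => Re (wirtinger_bar F (s, t)))
           = (fun s t => / 2 * D1 u s t + - / 2 * D2 v s t)).
{ do 2 (apply functional_extensionality; intros ?).
  rewrite wirtinger_bar_parts; simpl. fold u v. field. }
assert (E2 : (fun s t => Im (wirtinger_bar F (s, t)))
           = (fun s t => / 2 * D1 v s t + / 2 * D2 u s t)).
{ do 2 (apply functional_extensionality; intros ?).
  rewrite wirtinger_bar_parts; simpl. fold u v. field. }
assert (E3 : (fun s t => Re (wirtinger F (s, t)))
           = (fun s t => / 2 * D1 u s t + / 2 * D2 v s t)).
{ do 2 (apply functional_extensionality; intros ?).
  rewrite wirtinger_parts; simpl. fold u v. field. }
assert (E4 : (fun s t => Im (wirtinger F (s, t)))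
           = (fun s t => / 2 * D1 v s t + - / 2 * D2 u s t)).
{ do 2 (apply functional_extensionality; intros ?).
  rewrite wirtinger_parts; simpl. fold u v. field. }
rewrite E1, E2, E3, E4.
assert (S1 := smooth2_D1 _ Hu). assert (S2 := smooth2_D2 _ Hu).
assert (S3 := smooth2_D1 _ Hv). assert (S4 := smooth2_D2 _ Hv).
rewrite !D1_lin, !D2_lin; auto.
rewrite (smooth2_schwarz u), (smooth2_schwarz v); auto.
f_equal; field.
Qed.

(** * Compactness of boxes and induction along [0, 1] *)

(** The closed rectangle [a, b] x [a', b']. *)
Definition box (a b a' b' : R) (z : C) : Prop :=
  a <= Re z <= b /\ a' <= Im z <= b'.

Lemma Cmod_le_parts (z : C) : Cmod z <= Rabs (Re z) + Rabs (Im z).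
Proof.
replace z with (RtoC (Re z) + Ci * RtoC (Im z))%C at 1.
- eapply Rle_trans. apply Cmod_triangle.
  rewrite Cmod_mult, Cmod_Ci, !Cmod_R. lra.
- destruct z; unfold RtoC, Ci, Cmult, Cplus; simpl; f_equal; ring.
Qed.

Lemma im_le_Cmod (z : C) : Rabs (Im z) <= Cmod z.
Proof.
eapply Rle_trans; [|apply Rmax_Cmod]. apply Rmax_r.
Qed.

(** A scale [d] that works locally can be chosen uniformly on a box. *)
Lemma box_uniform (a b a' b' : R) (Q : R -> C -> Prop) :
  (forall d d' w, 0 < d' -> d' <= d -> Q d w -> Q d' w) ->
  (forall z, box a b a' b' z ->
     exists d, 0 < d /\ forall w, Cmod (w - z) < d -> Q d w) ->
  exists d, 0 < d /\ forall w, box a b a' b' w -> Q d w.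
Proof.
intros mono H.
assert (S : forall z : C, {d : posreal | box a b a' b' z ->
   forall w, Cmod (w - z) < d -> Q d w}).
{ intros z. apply constructive_indefinite_description.
  destruct (classic (box a b a' b' z)) as [Hz|Hz].
  - destruct (H z Hz) as [d [Hd K]]. exists (mkposreal d Hd). intros _. exact K.
  - exists (mkposreal 1 Rlt_0_1). intros Hz'. contradiction. }
set (delta := fun x y : R => pos_div_2 (proj1_sig (S (x, y)))).
destruct (compactness_value_2d a b a' b' delta) as [d Hd].
exists d. split. apply cond_pos. intros [x y] [Hx Hy]. simpl in Hx, Hy.
destruct (NNPP _ (Hd x y Hx Hy)) as [u [v [Hu [Hv [K1 [K2 K3]]]]]].
unfold delta in *. destruct (S (u, v)) as [e He]. simpl in *.
assert (He0 := cond_pos e).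
apply mono with (d := e). apply cond_pos. lra.
apply He. now split.
eapply Rle_lt_trans. apply Cmod_le_parts. unfold Re, Im; simpl.
unfold Rminus in *. lra.
Qed.

Lemma box_max (F : C -> R) (a b a' b' : R) : a <= b -> a' <= b' ->
  (forall z, box a b a' b' z -> continuous F z) ->
  exists z0, box a b a' b' z0 /\ forall z, box a b a' b' z -> F z <= F z0.
Proof.
intros Hab Hab' HF.
assert (Loc : forall z e, box a b a' b' z -> 0 < e ->
   exists d, 0 < d /\ forall w, Cmod (w - z) < d -> F w < F z + e).
{ intros z e Hz He.
  apply (locally_Cmod z (fun w => F w < F z + e)).
  apply (HF z Hz (fun t => t < F z + e)).
  apply open_lt. lra. }
assert (Bnd : exists d, 0 < d /\ forall w, box a b a' b' w -> F w <= / d).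
{ apply (box_uniform a b a' b' (fun d w => F w <= / d)).
  - intros d d' w Hd' Hle Hw. eapply Rle_trans. exact Hw.
    now apply Rinv_le_contravar.
  - intros z Hz. destruct (Loc z 1 Hz Rlt_0_1) as [d [Hd K]].
    assert (P : 0 < Rmax 1 (F z + 1)).
    { eapply Rlt_le_trans. apply Rlt_0_1. apply Rmax_l. }
    exists (Rmin d (/ Rmax 1 (F z + 1))). split.
    apply Rmin_glb_lt; auto. now apply Rinv_0_lt_compat.
    intros w Hw.
    apply Rle_trans with (/ / Rmax 1 (F z + 1)).
    + rewrite Rinv_inv. apply Rle_trans with (F z + 1); [|apply Rmax_r].
      apply Rlt_le, K. eapply Rlt_le_trans. exact Hw. apply Rmin_l.
    + apply Rinv_le_contravar. 2: apply Rmin_r.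
      apply Rmin_glb_lt; auto. now apply Rinv_0_lt_compat. }
destruct Bnd as [d0 [Hd0 Bnd]].
destruct (completeness (fun t => exists z, box a b a' b' z /\ t = F z)) as [m [M1 M2]].
- exists (/ d0). intros t [z [Hz ->]]. auto.
- exists (F (a, a')). exists (a, a'). repeat split; simpl; lra.
- apply NNPP. intros N.
  assert (Lt : forall z, box a b a' b' z -> F z < m).
  { intros z Hz. destruct (M1 (F z)). exists z; auto. auto.
    elim N. exists z. split; auto. intros w Hw. rewrite H. apply M1. exists w; auto. }
  destruct (box_uniform a b a' b' (fun d w => F w <= m - d)) as [d [Hd K]].
  + intros; lra.
  + intros z Hz. assert (Hz' := Lt z Hz).
    destruct (Loc z ((m - F z) / 2) Hz ltac:(lra)) as [d [Hd K]].
    exists (Rmin d ((m - F z) / 2)). split. apply Rmin_glb_lt; lra.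
    intros w Hw. assert (L1 := Rmin_l d ((m - F z) / 2)).
    assert (L2 := Rmin_r d ((m - F z) / 2)). specialize (K w ltac:(lra)). lra.
  + assert (m <= m - d); [|lra]. apply M2. intros t [z [Hz ->]]. auto.
Qed.

(** A property holds on [0, 1] if it passes from [0, T) to a right neighbourhood
    of [T], for every [T] including [0]. *)
Lemma real_induction (P : R -> Prop) :
  (forall T, 0 <= T <= 1 -> (forall t, 0 <= t < T -> P t) ->
     exists e, 0 < e /\ forall t, T <= t < T + e -> t <= 1 -> P t) ->
  forall t, 0 <= t <= 1 -> P t.
Proof.
intros H.
set (E := fun T => 0 <= T <= 1 /\ forall t, 0 <= t < T -> P t).
destruct (completeness E) as [m [M1 M2]].
- exists 1. intros T [HT _]. lra.
- exists 0. split. lra. intros; lra.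
- assert (m0 : 0 <= m) by (apply M1; split; [lra | intros; lra]).
  assert (m1 : m <= 1) by (apply M2; intros T [HT _]; lra).
  assert (Pm : forall t, 0 <= t < m -> P t).
  { intros t Ht. apply NNPP. intros N. assert (m <= t); [|lra].
    apply M2. intros T [HT K]. apply Rnot_lt_le. intros L. apply N, K. lra. }
  destruct (H m (conj m0 m1) Pm) as [e [He K]].
  assert (A : forall t, 0 <= t < m + e -> t <= 1 -> P t).
  { intros t Ht Ht1. destruct (Rlt_le_dec t m). apply Pm; lra. apply K; lra. }
  intros t Ht. apply A; [|lra]. split; [lra|].
  destruct (Rle_lt_dec (m + e / 2) 1) as [L|L]; [|lra].
  assert (m + e / 2 <= m); [|lra]. apply M1. split. lra.
  intros s Hs. apply A; lra.
Qed.

(** A curve that does not tend to infinity as [t] increases to [T] has a cluster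
    point there. *)
Lemma cluster_point (lam : R -> C) (T M : R) :
  (forall d, 0 < d -> exists t, T - d < t < T /\ Cmod (lam t) <= M) ->
  exists w, forall d, 0 < d -> exists t, T - d < t < T /\ Cmod (lam t - w) < d.
Proof.
intros H. apply NNPP. intros N.
destruct (box_uniform (- M) M (- M) M
  (fun d w => forall t, T - d < t < T -> lam t <> w)) as [d [Hd K]].
- intros d d' w _ Hle Hw t Ht. apply Hw. lra.
- intros z _. apply NNPP. intros N1. apply N. exists z. intros d Hd.
  apply NNPP. intros N2. apply N1. exists d. split; auto.
  intros w Hw t Ht E. apply N2. exists t. split; auto. now rewrite E.
- destruct (H d Hd) as [t [Ht B]]. apply (K (lam t)) with t; auto.
  assert (B1 := re_le_Cmod (lam t)). assert (B2 := im_le_Cmod (lam t)).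
  apply Rabs_le_between in B1. apply Rabs_le_between in B2. split; lra.
Qed.

(** * First- and second-order conditions in one variable *)

Lemma right_increase (u : R -> R) (t l : R) : is_derive u t l -> 0 < l ->
  exists d, 0 < d /\ forall s, t < s < t + d -> u t < u s.
Proof.
intros H Hl. apply is_derive_caratheodory in H.
destruct H as [U [CU [EU HU]]].
assert (L : locally t (fun s => 0 < U s)).
{ apply (CU (fun r => 0 < r)). apply open_gt. rewrite EU. exact Hl. }
destruct L as [d Hd]. exists d. split. apply cond_pos.
intros s Hs. rewrite (HU s).
assert (0 < U s).
{ apply Hd. unfold ball; simpl. unfold AbsRing_ball, abs, minus, plus, opp; simpl.
  rewrite Rabs_right; lra. }
assert (0 < U s * (s - t)) by (apply Rmult_lt_0_compat; lra). lra.
Qed.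

Lemma left_decrease (u : R -> R) (t l : R) : is_derive u t l -> l < 0 ->
  exists d, 0 < d /\ forall s, t - d < s < t -> u t < u s.
Proof.
intros H Hl. apply is_derive_caratheodory in H.
destruct H as [U [CU [EU HU]]].
assert (L : locally t (fun s => U s < 0)).
{ apply (CU (fun r => r < 0)). apply open_lt. rewrite EU. exact Hl. }
destruct L as [d Hd]. exists d. split. apply cond_pos.
intros s Hs. rewrite (HU s).
assert (U s < 0).
{ apply Hd. unfold ball; simpl. unfold AbsRing_ball, abs, minus, plus, opp; simpl.
  rewrite Rabs_left; lra. }
assert (0 < (- U s) * (t - s)) by (apply Rmult_lt_0_compat; lra). lra.
Qed.

Lemma local_max_derive (u : R -> R) (t l d : R) : is_derive u t l -> 0 < d ->
  (forall s, t - d < s < t + d -> u s <= u t) -> l = 0.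
Proof.
intros H Hd K. destruct (Rtotal_order l 0) as [L|[L|L]]; auto; exfalso.
- destruct (left_decrease u t l H L) as [e [He A]].
  assert (m1 := Rmin_l d e). assert (m2 := Rmin_r d e).
  assert (m3 : 0 < Rmin d e) by now apply Rmin_glb_lt.
  specialize (A (t - Rmin d e / 2) ltac:(lra)).
  specialize (K (t - Rmin d e / 2) ltac:(lra)). lra.
- destruct (right_increase u t l H L) as [e [He A]].
  assert (m1 := Rmin_l d e). assert (m2 := Rmin_r d e).
  assert (m3 : 0 < Rmin d e) by now apply Rmin_glb_lt.
  specialize (A (t + Rmin d e / 2) ltac:(lra)).
  specialize (K (t + Rmin d e / 2) ltac:(lra)). lra.
Qed.

Lemma local_max_second_derive (u v : R -> R) (t l d : R) : 0 < d ->
  (forall s, t - d < s < t + d -> is_derive u s (v s)) -> is_derive v t l ->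
  (forall s, t - d < s < t + d -> u s <= u t) -> l <= 0.
Proof.
intros Hd Hu Hv K. apply Rnot_lt_le. intros L.
assert (v0 : v t = 0) by (apply (local_max_derive u t (v t) d); auto; apply Hu; lra).
destruct (right_increase v t l Hv L) as [e [He A]].
assert (m1 := Rmin_l d e). assert (m2 := Rmin_r d e).
assert (m3 : 0 < Rmin d e) by now apply Rmin_glb_lt.
set (s := t + Rmin d e / 2).
(* the interval is split at [m] because [v t = 0]: [v] is known to be positive
   only to the right of [t] *)
set (m := t + Rmin d e / 4).
assert (Hm : u t <= u m).
{ destruct (MVT_gen u t m v) as [c [Hc E]].
  - intros x Hx. rewrite Rmin_left, Rmax_right in Hx by (unfold m; lra).
    apply Hu. unfold m in *; lra.
  - intros x Hx. rewrite Rmin_left, Rmax_right in Hx by (unfold m; lra).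
    apply continuity_pt_filterlim. apply (ex_derive_continuous (V := R_NormedModule)).
    exists (v x). apply Hu. unfold m in *; lra.
  - rewrite Rmin_left, Rmax_right in Hc by (unfold m; lra).
    assert (0 <= v c).
    { destruct (Req_dec c t) as [->|N]. lra. apply Rlt_le. rewrite <- v0.
      apply A. unfold m in *; lra. }
    assert (0 <= v c * (m - t)) by (apply Rmult_le_pos; unfold m; lra). lra. }
assert (Hs : u m < u s).
{ destruct (MVT_gen u m s v) as [c [Hc E]].
  - intros x Hx. rewrite Rmin_left, Rmax_right in Hx by (unfold m, s; lra).
    apply Hu. unfold m, s in *; lra.
  - intros x Hx. rewrite Rmin_left, Rmax_right in Hx by (unfold m, s; lra).
    apply continuity_pt_filterlim. apply (ex_derive_continuous (V := R_NormedModule)).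
    exists (v x). apply Hu. unfold m, s in *; lra.
  - rewrite Rmin_left, Rmax_right in Hc by (unfold m, s; lra).
    assert (0 < v c) by (rewrite <- v0; apply A; unfold m, s in *; lra).
    assert (0 < v c * (s - m)) by (apply Rmult_lt_0_compat; unfold m, s; lra). lra. }
specialize (K s ltac:(unfold s; lra)). lra.
Qed.

(** Darboux: a derivative without zeros keeps its sign. *)
Lemma darboux_sign (u v : R -> R) :
  (forall s, 0 <= s <= 1 -> is_derive u s (v s)) ->
  (forall s, 0 <= s <= 1 -> v s <> 0) -> 0 < v 0 -> 0 < v 1.
Proof.
intros Hu Hv H0. destruct (Rtotal_order (v 1) 0) as [L|[L|L]]; auto.
2: elim (Hv 1); auto; lra. exfalso.
destruct (continuity_ab_maj u 0 1) as [c [Hc Ic]]. lra.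
- intros c Hc. apply continuity_pt_filterlim.
  apply (ex_derive_continuous (V := R_NormedModule)). exists (v c); auto.
- destruct (Req_dec c 0) as [->|N0].
  { destruct (right_increase u 0 (v 0) ltac:(apply Hu; lra) H0) as [d [Hd A]].
    assert (m1 := Rmin_l d 1). assert (m2 := Rmin_r d 1).
    assert (m3 : 0 < Rmin d 1) by (apply Rmin_glb_lt; lra).
    specialize (A (0 + Rmin d 1 / 2) ltac:(lra)).
    specialize (Hc (0 + Rmin d 1 / 2) ltac:(lra)). lra. }
  destruct (Req_dec c 1) as [->|N1].
  { destruct (left_decrease u 1 (v 1) ltac:(apply Hu; lra) L) as [d [Hd A]].
    assert (m1 := Rmin_l d 1). assert (m2 := Rmin_r d 1).
    assert (m3 : 0 < Rmin d 1) by (apply Rmin_glb_lt; lra).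
    specialize (A (1 - Rmin d 1 / 2) ltac:(lra)).
    specialize (Hc (1 - Rmin d 1 / 2) ltac:(lra)). lra. }
  apply (Hv c Ic). apply (local_max_derive u c (v c) (Rmin c (1 - c))); auto.
  apply Rmin_glb_lt; lra.
  intros s Hs. assert (m1 := Rmin_l c (1 - c)). assert (m2 := Rmin_r c (1 - c)).
  apply Hc. lra.
Qed.

(** * Mean value inequality and local inverses *)

Lemma curve_deriv_scal (c : C) (g : R -> C) (t : R) (v : C) :
  curve_deriv g t v -> curve_deriv (fun s => c * g s)%C t (c * v).
Proof.
intros H.
replace (c * v)%C with (c * 1 * v + c * 0 * Cconj v)%C by ring.
apply (wirt_curve (fun w => c * w)%C g t); auto.
apply wirt_scal, wirt_id.
Qed.

Lemma curve_mean_value (g v : R -> C) (a b M : R) : a <= b ->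
  (forall t, a <= t <= b -> curve_deriv g t (v t)) ->
  (forall t, a <= t <= b -> Cmod (v t) <= M) ->
  Cmod (g b - g a) <= M * (b - a).
Proof.
intros Hab Hg HM.
set (D := (g b - g a)%C).
assert (HM0 : 0 <= M) by (eapply Rle_trans; [apply Cmod_ge_0 | apply (HM a); lra]).
destruct (Req_dec (Cmod D) 0) as [->|N].
{ apply Rmult_le_pos; lra. }
assert (Dp : 0 < Cmod D) by (assert (Q := Cmod_ge_0 D); lra).
assert (Hd : forall t, a <= t <= b ->
  is_derive (fun s => Re (Cconj D * g s)) t (Re (Cconj D * v t))).
{ intros t Ht. apply (curve_deriv_scal (Cconj D)), Hg, Ht. }
destruct (MVT_gen (fun s => Re (Cconj D * g s)) a b (fun s => Re (Cconj D * v s)))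
  as [c [Hc E]].
- intros x Hx. rewrite Rmin_left, Rmax_right in Hx by lra. apply Hd; lra.
- intros x Hx. rewrite Rmin_left, Rmax_right in Hx by lra.
  apply continuity_pt_filterlim. apply (ex_derive_continuous (V := R_NormedModule)).
  eexists; apply Hd; lra.
- rewrite Rmin_left, Rmax_right in Hc by lra.
  assert (E2 : Re (Cconj D * g b) - Re (Cconj D * g a) = Cmod D * Cmod D).
  { replace (Cmod D * Cmod D) with (Cmod D ^ 2) by ring.
    rewrite Cmod2_alt. unfold D, Re, Im; simpl. ring. }
  rewrite E2 in E.
  assert (B : Re (Cconj D * v c) <= Cmod D * M).
  { eapply Rle_trans. apply Rle_abs. eapply Rle_trans. apply re_le_Cmod.
    rewrite Cmod_mult, Cmod_conj. apply Rmult_le_compat_l. lra. auto. }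
  assert (B2 : Re (Cconj D * v c) * (b - a) <= Cmod D * M * (b - a)).
  { apply Rmult_le_compat_r; lra. }
  apply Rmult_le_reg_l with (Cmod D); auto.
  fold D. rewrite E. eapply Rle_trans. exact B2. right; ring.
Qed.

Lemma mean_value_inequality (F F1 : C -> C) (z w : C) (M : R) :
  (forall s, 0 <= s <= 1 ->
     wirt F (z + RtoC s * (w - z)) (F1 (z + RtoC s * (w - z))%C) 0) ->
  (forall s, 0 <= s <= 1 -> Cmod (F1 (z + RtoC s * (w - z))%C) <= M) ->
  Cmod (F w - F z) <= M * Cmod (w - z).
Proof.
intros HF HM.
assert (K := curve_mean_value (fun s => F (z + RtoC s * (w - z))%C)
  (fun s => F1 (z + RtoC s * (w - z)) * (w - z))%C 0 1 (M * Cmod (w - z)) ltac:(lra)).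
cbv beta in K.
replace (z + RtoC 1 * (w - z))%C with w in K by ring.
replace (z + RtoC 0 * (w - z))%C with z in K by ring.
rewrite Rminus_0_r, Rmult_1_r in K. apply K.
- intros t Ht. rewrite <- (Cplus_0_r (F1 _ * _)).
  replace (0 : C) with (0 * Cconj (w - z))%C by ring.
  apply (wirt_curve F (fun s => z + RtoC s * (w - z))%C). now apply HF.
  apply curve_deriv_line.
- intros t Ht. rewrite Cmod_mult. apply Rmult_le_compat_r. apply Cmod_ge_0. auto.
Qed.

Lemma Cmod_segment (z w : C) (s : R) : 0 <= s <= 1 ->
  Cmod (z + RtoC s * (w - z) - z) <= Cmod (w - z).
Proof.
intros Hs. replace (z + RtoC s * (w - z) - z)%C with (RtoC s * (w - z))%C by ring.
rewrite Cmod_mult, Cmod_R, Rabs_right by lra.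
assert (K := Cmod_ge_0 (w - z)). rewrite <- (Rmult_1_l (Cmod (w - z))) at 2.
apply Rmult_le_compat_r; lra.
Qed.

Lemma Cmod_ball_convex (c z w : C) (r s : R) : 0 <= s <= 1 ->
  Cmod (z - c) < r -> Cmod (w - c) < r -> Cmod (z + RtoC s * (w - z) - c) < r.
Proof.
intros Hs Hz Hw.
replace (z + RtoC s * (w - z) - c)%C
  with (RtoC (1 - s) * (z - c) + RtoC s * (w - c))%C by (rewrite RtoC_minus; ring).
eapply Rle_lt_trans. apply Cmod_triangle.
rewrite !Cmod_mult, !Cmod_R, !Rabs_right by lra.
destruct (Req_dec s 0) as [->|N]. lra.
assert ((1 - s) * Cmod (z - c) <= (1 - s) * r) by (apply Rmult_le_compat_l; lra).
assert (s * Cmod (w - c) < s * r) by (apply Rmult_lt_compat_l; lra). lra.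
Qed.

Lemma Cmod_sub_triangle (a b c : C) : Cmod (a - c) <= Cmod (a - b) + Cmod (b - c).
Proof. replace (a - c)%C with (a - b + (b - c))%C by ring. apply Cmod_triangle. Qed.

Lemma Cmod_sub_sym (a b : C) : Cmod (a - b) = Cmod (b - a).
Proof. replace (a - b)%C with (- (b - a))%C by ring. apply Cmod_opp. Qed.

(** A function whose square is continuous and which is a complex derivative is
    itself continuous: away from zeros the square determines it up to sign, and
    the sign cannot jump because of Darboux. *)
Lemma derivative_continuous_of_square (f f1 : C -> C) (z0 : C) :
  (forall z, wirt f z (f1 z) 0) ->
  continuous (fun z => f1 z * f1 z)%C z0 -> continuous f1 z0.
Proof.
intros Hf Hphi. apply continuous_Cmod_iff. intros e He.
rewrite continuous_Cmod_iff in Hphi.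
destruct (Ceq_dec (f1 z0) 0) as [E|N].
- rewrite E in *. assert (He2 : 0 < e * e) by now apply Rmult_lt_0_compat.
  generalize (Hphi _ He2). apply filter_imp. intros w Hw.
  replace (f1 w * f1 w - 0 * 0)%C with (f1 w * f1 w)%C in Hw by Cring.
  replace (f1 w - 0)%C with (f1 w) by Cring.
  rewrite Cmod_mult in Hw. assert (P := Cmod_ge_0 (f1 w)). nra.
- set (d := f1 z0) in *. assert (Nd := proj1 (Cmod_gt_0 d) N).
  set (eta := Rmin 1 (e / Cmod d)).
  assert (eta1 : eta <= 1) by apply Rmin_l.
  assert (eta2 : eta * Cmod d <= e).
  { apply Rle_div_r. exact Nd. apply Rmin_r. }
  assert (eta0 : 0 < eta).
  { apply Rmin_glb_lt. lra. now apply Rdiv_lt_0_compat. }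
  assert (P0 : 0 < eta * (Cmod d * Cmod d)).
  { apply Rmult_lt_0_compat; auto. now apply Rmult_lt_0_compat. }
  destruct (proj1 (locally_Cmod _ _) (Hphi _ P0)) as [r [Hr K]].
  apply locally_Cmod. exists r. split; auto. intros w Hw.
  set (x := fun s => (f1 (z0 + RtoC s * (w - z0)) / d)%C).
  assert (Hx : forall s, 0 <= s <= 1 -> Cmod (x s * x s - 1) < eta).
  { intros s Hs.
    assert (B : Cmod (z0 + RtoC s * (w - z0) - z0) < r)
      by (eapply Rle_lt_trans; [now apply Cmod_segment | exact Hw]).
    specialize (K _ B). unfold x; cbv beta.
    set (y := f1 (z0 + RtoC s * (w - z0))%C) in *.
    replace (y / d * (y / d) - 1)%C with ((y * y - d * d) / (d * d))%C by (now field).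
    rewrite Cmod_div by now apply Cmult_neq_0. rewrite (Cmod_mult d d).
    apply Rlt_div_l. now apply Rmult_lt_0_compat. exact K. }
  assert (Nx : forall s, 0 <= s <= 1 -> Re (x s) <> 0).
  { intros s Hs E. specialize (Hx s Hs).
    assert (A := re_le_Cmod (x s * x s - 1)). apply Rabs_le_between in A.
    destruct (x s) as [p q]. unfold Re in *; simpl in *. rewrite E in *. nra. }
  assert (x1 : 0 < Re (x 1)).
  { destruct (Ceq_dec w z0) as [->|Nw].
    { unfold x. replace (z0 + RtoC 1 * (z0 - z0))%C with z0 by ring. fold d.
      replace (d / d)%C with (1 : C) by (now field). simpl; lra. }
    assert (Nw' : (w - z0 <> 0)%C).
    { intros Z. apply Nw. replace w with (w - z0 + z0)%C by ring. rewrite Z. ring. }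
    apply (darboux_sign
      (fun s => Re (/ (d * (w - z0)) * f (z0 + RtoC s * (w - z0)))%C)
      (fun s => Re (x s))).
    - intros s Hs.
      assert (D := wirt_curve f (fun s => z0 + RtoC s * (w - z0))%C s _ _ _
        (Hf _) (curve_deriv_line z0 (w - z0) s)).
      apply (curve_deriv_scal (/ (d * (w - z0)))) in D. destruct D as [D _].
      match type of D with is_derive _ _ (Re ?X) => replace X with (x s) in D end.
      exact D. unfold x. field. split; auto.
    - exact Nx.
    - unfold x. replace (z0 + RtoC 0 * (w - z0))%C with z0 by ring. fold d.
      replace (d / d)%C with (1 : C) by (now field). simpl; lra. }
  specialize (Hx 1 ltac:(lra)).
  assert (E1 : f1 w = (x 1 * d)%C).
  { unfold x. replace (z0 + RtoC 1 * (w - z0))%C with w by ring. now field. }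
  fold d. rewrite E1. replace (x 1 * d - d)%C with ((x 1 - 1) * d)%C by ring.
  rewrite Cmod_mult. apply Rlt_le_trans with (eta * Cmod d); auto.
  apply Rmult_lt_compat_r; auto.
  eapply Rle_lt_trans; [|exact Hx].
  replace (x 1 * x 1 - 1)%C with ((x 1 - 1) * (x 1 + 1))%C by ring.
  rewrite Cmod_mult. rewrite <- (Rmult_1_r (Cmod (x 1 - 1))) at 1.
  apply Rmult_le_compat_l. apply Cmod_ge_0.
  eapply Rle_trans; [|apply re_le_Cmod]. eapply Rle_trans; [|apply Rle_abs].
  replace (Re (x 1 + 1)) with (Re (x 1) + 1) by reflexivity. lra.
Qed.

(** The inverse function theorem for a [C^1] holomorphic function. *)
Lemma local_branch (f f1 : C -> C) (z0 : C) :
  (forall z, wirt f z (f1 z) 0) -> continuous f1 z0 -> f1 z0 <> 0%C ->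
  exists rho eps : R, exists k : C -> C, 0 < rho /\ 0 < eps /\
    (forall u, Cmod (u - f z0) < eps ->
       Cmod (k u - z0) < rho /\ f (k u) = u /\ continuous k u) /\
    (forall z w, Cmod (z - z0) < rho -> Cmod (w - z0) < rho -> f z = f w -> z = w).
Proof.
intros Hf Cf N. set (d := f1 z0) in *.
assert (Nd := proj1 (Cmod_gt_0 d) N).
assert (Cc : forall z, continuous f z) by (intros z; apply (wirt_continuous _ _ _ _ (Hf z))).
destruct (proj1 (locally_Cmod _ _) (proj1 (continuous_Cmod_iff f1 z0) Cf (Cmod d / 2)
  ltac:(lra))) as [rho [Hrho K]]. fold d in K.
assert (Exp : forall z w, Cmod (z - z0) < rho -> Cmod (w - z0) < rho ->
  Cmod d / 2 * Cmod (w - z) <= Cmod (f w - f z)).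
{ intros z w Hz Hw.
  assert (A := mean_value_inequality (fun u => f u - d * u)%C (fun u => f1 u - d)%C
    z w (Cmod d / 2)). cbv beta in A.
  assert (B : Cmod (f w - d * w - (f z - d * z)) <= Cmod d / 2 * Cmod (w - z)).
  { apply A.
    - intros s Hs. eapply wirt_eq. apply wirt_minus. apply Hf.
      apply (wirt_scal d), wirt_id. ring. ring.
    - intros s Hs. apply Rlt_le, K. now apply Cmod_ball_convex. }
  assert (T2 := Cmod_triangle (f w - f z) (- (f w - f z - d * (w - z)))).
  rewrite Cmod_opp in T2.
  replace (f w - f z + - (f w - f z - d * (w - z)))%C with (d * (w - z))%C in T2 by ring.
  replace (f w - d * w - (f z - d * z))%C with (f w - f z - d * (w - z))%C in B by ring.
  rewrite Cmod_mult in T2. lra. }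
assert (Inj : forall z w, Cmod (z - z0) < rho -> Cmod (w - z0) < rho -> f z = f w -> z = w).
{ intros z w Hz Hw E. specialize (Exp z w Hz Hw). rewrite E in Exp.
  replace (f w - f w)%C with (0 : C) in Exp by ring. rewrite Cmod_0 in Exp.
  assert (P := Cmod_ge_0 (w - z)).
  assert (Z : Cmod (w - z) = 0) by nra. apply Cmod_eq_0 in Z.
  replace w with (w - z + z)%C by ring. rewrite Z. ring. }
set (eta := rho / 3). set (eps := Cmod d * eta / 8).
assert (Heta : 0 < eta) by (unfold eta; lra).
assert (Pde : 0 < Cmod d * eta) by now apply Rmult_lt_0_compat.
assert (Heps : 0 < eps) by (unfold eps; lra).
assert (N1 : forall z, Cmod (z - z0) < rho -> f1 z <> 0%C).
{ intros z Hz E. specialize (K z Hz). rewrite E in K.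
  replace (0 - d)%C with (- d)%C in K by ring. rewrite Cmod_opp in K. lra. }
assert (Sur : forall u, Cmod (u - f z0) < eps -> exists z, Cmod (z - z0) < rho /\ f z = u).
{ intros u Hu.
  set (F := fun z => - Cmod (f z - u)).
  destruct (box_max F (Re z0 - eta) (Re z0 + eta) (Im z0 - eta) (Im z0 + eta))
    as [z1 [Hz1 Hm]]. lra. lra.
  { intros z _. apply (continuous_opp (V := R_NormedModule) (fun z => Cmod (f z - u))).
    apply continuous_Cmod. apply continuous_Cminus; [apply Cc | apply continuous_const]. }
  assert (Bz : Cmod (z1 - z0) < rho).
  { eapply Rle_lt_trans. apply Cmod_le_parts. destruct Hz1 as [R1 R2].
    assert (Rabs (Re (z1 - z0)) <= eta)
      by (apply Rabs_le; unfold Re in *; simpl in *; lra).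
    assert (Rabs (Im (z1 - z0)) <= eta)
      by (apply Rabs_le; unfold Im in *; simpl in *; lra).
    unfold eta in *; lra. }
  assert (Hc : F z0 <= F z1) by (apply Hm; split; lra).
  unfold F in Hc. rewrite (Cmod_sub_sym u) in Hu.
  assert (Close : Cmod (z1 - z0) < eta).
  { assert (A := Exp z0 z1 ltac:(replace (z0 - z0)%C with (0 : C) by ring;
       rewrite Cmod_0; lra) Bz).
    assert (T := Cmod_sub_triangle (f z1) u (f z0)).
    rewrite (Cmod_sub_sym u (f z0)) in T.
    apply Rmult_lt_reg_l with (Cmod d / 2). lra. unfold eps in *. lra. }
  exists z1. split; auto. apply NNPP. intros NE.
  assert (ND : (f z1 - u <> 0)%C).
  { intros Z. apply NE. replace (f z1) with (f z1 - u + u)%C by ring. rewrite Z. ring. }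
  set (D := (f z1 - u)%C) in *.
  (* moving [z1] against [D / f1 z1] decreases the distance to [u] *)
  set (e := (- D / f1 z1)%C).
  assert (DD := wirt_curve (fun z => f z - u)%C (fun s => z1 + RtoC s * e)%C 0 (f1 z1) 0 e).
  cbv beta in DD. replace (z1 + RtoC 0 * e)%C with z1 in DD by ring.
  assert (DD' := DD ltac:(eapply wirt_eq; [apply wirt_minus; [apply Hf | apply wirt_const]
     | ring | ring]) (curve_deriv_line _ _ _)). clear DD.
  cbv beta in DD'.
  replace (f1 z1 * e + 0 * Cconj e)%C with (- D)%C in DD'
    by (rewrite Cmult_0_l, Cplus_0_r; unfold e; field; now apply N1).
  destruct DD' as [X1 X2].
  set (a := fun s : R => Re (f (z1 + RtoC s * e) - u)%C) in *.
  set (b := fun s : R => Im (f (z1 + RtoC s * e) - u)%C) in *.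
  assert (a0 : a 0 = Re D) by (unfold a, D; now replace (z1 + RtoC 0 * e)%C with z1 by ring).
  assert (b0 : b 0 = Im D) by (unfold b, D; now replace (z1 + RtoC 0 * e)%C with z1 by ring).
  assert (DU : is_derive (fun s => - (a s * a s + b s * b s)) 0
     (2 * Cmod D ^ 2)).
  { rewrite Cmod2_alt. rewrite <- a0, <- b0.
    assert (Y1 : is_derive a 0 (- a 0)) by (rewrite a0; exact X1).
    assert (Y2 : is_derive b 0 (- b 0)) by (rewrite b0; exact X2).
    replace (2 * (a 0 ^ 2 + b 0 ^ 2)) with
      (- ((- a 0 * a 0 + a 0 * - a 0) + (- b 0 * b 0 + b 0 * - b 0))) by ring.
    apply (is_derive_opp (V := R_NormedModule)).
    apply (is_derive_plus (V := R_NormedModule) (fun s => a s * a s)).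
    apply (is_derive_mult a a); auto. intros; apply Rmult_comm.
    apply (is_derive_mult b b); auto. intros; apply Rmult_comm. }
  assert (DP : 0 < Cmod D) by now apply Cmod_gt_0.
  destruct (right_increase _ _ _ DU) as [t0 [Ht0 Inc]]. simpl; nra.
  assert (Cont : continuous (fun s => z1 + RtoC s * e)%C 0)
    by apply (curve_deriv_continuous _ _ _ (curve_deriv_line z1 e 0)).
  rewrite continuous_Cmod_iff in Cont.
  destruct (Cont (eta - Cmod (z1 - z0)) ltac:(lra)) as [t1 Ht1].
  assert (m1 := Rmin_l t0 t1). assert (m2 := Rmin_r t0 t1).
  assert (Ht1p := cond_pos t1).
  assert (m3 : 0 < Rmin t0 t1) by now apply Rmin_glb_lt.
  set (s := Rmin t0 t1 / 2).
  assert (Bs : ball 0 t1 s).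
  { unfold ball; simpl. unfold AbsRing_ball, abs, minus, plus, opp; simpl.
    unfold s. rewrite Rabs_right; lra. }
  specialize (Inc s ltac:(unfold s; lra)). specialize (Ht1 s Bs).
  replace (z1 + RtoC 0 * e)%C with z1 in Ht1 by ring.
  set (z2 := (z1 + RtoC s * e)%C) in *.
  assert (T := Cmod_sub_triangle z2 z1 z0).
  assert (Bz2 : box (Re z0 - eta) (Re z0 + eta) (Im z0 - eta) (Im z0 + eta) z2).
  { assert (A1 := re_le_Cmod (z2 - z0)). assert (A2 := im_le_Cmod (z2 - z0)).
    apply Rabs_le_between in A1. apply Rabs_le_between in A2.

    replace (Re (z2 - z0)) with (Re z2 - Re z0) in A1 by reflexivity.
    replace (Im (z2 - z0)) with (Im z2 - Im z0) in A2 by reflexivity.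
    unfold box. lra. }
  specialize (Hm z2 Bz2). unfold F in Hm. fold D in Hm.
  rewrite a0, b0 in Inc. unfold a, b in Inc. fold z2 in Inc.
  assert (Q1 := Cmod2_alt D). assert (Q2 := Cmod2_alt (f z2 - u)).
  assert (Q3 := Cmod_ge_0 (f z2 - u)). simpl in Q1, Q2. simpl in Inc. simpl in Hm. nra. }
set (k := fun u => match excluded_middle_informative
   (exists z, Cmod (z - z0) < rho /\ f z = u) with
   | left H => proj1_sig (constructive_indefinite_description _ H)
   | right _ => z0 end).
assert (Hk : forall u, Cmod (u - f z0) < eps -> Cmod (k u - z0) < rho /\ f (k u) = u).
{ intros u Hu. unfold k. destruct excluded_middle_informative as [H|H].
  exact (proj2_sig (constructive_indefinite_description _ H)).
  elim H; auto. }
exists rho, eps, k. split; [exact Hrho|split; [exact Heps|split; [|exact Inj]]].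
intros u Hu. destruct (Hk u Hu) as [A1 A2]. split; [exact A1|split;[exact A2|]].
apply continuous_Cmod_iff. intros e He.
apply locally_Cmod. exists (Rmin (eps - Cmod (u - f z0)) (Cmod d / 2 * e)).
assert (He' : 0 < Cmod d / 2 * e) by (apply Rmult_lt_0_compat; lra).
split. apply Rmin_glb_lt; lra.
intros w Hw.
assert (m1 := Rmin_l (eps - Cmod (u - f z0)) (Cmod d / 2 * e)).
assert (m2 := Rmin_r (eps - Cmod (u - f z0)) (Cmod d / 2 * e)).
assert (T := Cmod_sub_triangle w u (f z0)).
destruct (Hk w ltac:(lra)) as [B1 B2].
specialize (Exp (k u) (k w) A1 B1). rewrite A2, B2 in Exp.
apply Rmult_lt_reg_l with (Cmod d / 2); lra.
Qed.

(** * Liouville's theorem *)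

Lemma curve_deriv_mult (g h : R -> C) (t : R) (v w : C) :
  curve_deriv g t v -> curve_deriv h t w ->
  curve_deriv (fun s => g s * h s)%C t (v * h t + g t * w).
Proof.
intros Hg Hh. assert (Cg := curve_deriv_continuous _ _ _ Hg).
assert (Ch := curve_deriv_continuous _ _ _ Hh).
apply curve_deriv_caratheodory in Hg. destruct Hg as [V [CV [<- EV]]].
apply curve_deriv_caratheodory in Hh. destruct Hh as [W [CW [<- EW]]].
apply curve_deriv_caratheodory.
exists (fun s => V s * h s + g t * W s)%C. split; [|split; [reflexivity|]].
- apply continuous_Cplus; apply continuous_Cmult; auto; apply continuous_const.
- intros s. rewrite (EV s).
  transitivity (g t * h s + V s * h s * RtoC (s - t))%C. ring.
  rewrite (EW s) at 1. ring.
Qed.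

(** [exp (i t)]. *)
Definition cis (t : R) : C := (cos t, sin t).

Lemma curve_deriv_cis (t : R) : curve_deriv cis t (Ci * cis t).
Proof.
split; unfold cis, Re, Im; simpl; auto_derive; auto; ring.
Qed.

Lemma cis_conj (t : R) : (cis t * Cconj (cis t) = 1)%C.
Proof.
unfold cis, Cconj, Cmult, RtoC; simpl. assert (P := sin2_cos2 t). unfold Rsqr in P.
f_equal; lra.
Qed.

Lemma Cmod_cis (t : R) : Cmod (cis t) = 1.
Proof.
assert (E : Cmod (cis t) ^ 2 = 1).
{ rewrite Cmod2_alt. unfold cis; simpl. assert (P := sin2_cos2 t).
  unfold Rsqr in P. lra. }
assert (P := Cmod_ge_0 (cis t)). nra.
Qed.

Section Liouville.

Variables (F F1 : C -> C) (M : R).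
Hypothesis HF : forall z, wirt F z (F1 z) 0.
Hypothesis CF1 : forall z, continuous F1 z.
Hypothesis HM : forall z, Cmod (F z) <= M.
Variable z0 : C.

(* [U] is integrated over circles; [V] is its radial derivative. *)
Let pt (r t : R) : C := (z0 + RtoC r * cis t)%C.
Let U (r t : R) : R := Re (F (pt r t) * Cconj (cis t))%C.
Let V (r t : R) : R := Re (F1 (pt r t)).
Let J (r : R) : R := RInt (U r) 0 (2 * PI).

Lemma pt_continuous (r t : R) :
  continuous (fun u : R * R => pt (fst u) (snd u)) (r, t).
Proof.
unfold pt. apply continuous_Cplus. apply continuous_const.
apply continuous_Cmult. apply continuous_RtoC, continuous_fst.
apply (continuous_comp (fun u : R * R => snd u) cis). apply continuous_snd.
apply (curve_deriv_continuous _ _ _ (curve_deriv_cis t)).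
Qed.

Lemma pt_continuous_r (r t : R) : continuous (pt r) t.
Proof.
apply (continuous_comp_2 (fun _ => r) (fun s => s) pt). apply continuous_const.
apply continuous_id. apply pt_continuous.
Qed.

Lemma U_derive (r t : R) : is_derive (fun s => U s t) r (V r t).
Proof.
assert (D := wirt_curve F (fun s => z0 + RtoC s * cis t)%C r _ _ _
  (HF _) (curve_deriv_line z0 (cis t) r)).
apply (curve_deriv_scal (Cconj (cis t))) in D. destruct D as [D _].
cbv beta in D. fold (pt r t) in D.
replace (Cconj (cis t) * (F1 (pt r t) * cis t + 0 * Cconj (cis t)))%C
  with (F1 (pt r t) * (cis t * Cconj (cis t)))%C in D by ring.
rewrite cis_conj, Cmult_1_r in D.
eapply is_derive_ext; [|exact D]. intros s. unfold U. f_equal.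
apply Cmult_comm.
Qed.

Lemma U_continuous (r t : R) : continuous (U r) t.
Proof.
apply (continuous_comp (fun s => F (pt r s) * Cconj (cis s))%C Re);
  [|apply continuous_fst].
apply continuous_Cmult. apply (continuous_comp (pt r) F). apply pt_continuous_r.
apply (wirt_continuous _ _ _ _ (HF _)).
apply continuous_Cconj. apply (curve_deriv_continuous _ _ _ (curve_deriv_cis t)).
Qed.

Lemma V_continuous (r t : R) : continuous (V r) t.
Proof.
apply (continuous_comp (fun s => F1 (pt r s)) Re); [|apply continuous_fst].
apply (continuous_comp (pt r) F1). apply pt_continuous_r. apply CF1.
Qed.

Lemma U_integrable (r : R) : ex_RInt (U r) 0 (2 * PI).
Proof. apply (ex_RInt_continuous (V := R_CompleteNormedModule)). intros; apply U_continuous. Qed.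

Lemma V_integrable (r : R) : ex_RInt (V r) 0 (2 * PI).
Proof. apply (ex_RInt_continuous (V := R_CompleteNormedModule)). intros; apply V_continuous. Qed.

(** [r V - U] is the angular derivative of a periodic function. *)
Lemma J_angular (r : R) : J r = r * RInt (V r) 0 (2 * PI).
Proof.
assert (D : forall t, is_derive (fun s => Im (F (pt r s) * Cconj (cis s))%C) t
   (r * V r t - U r t)).
{ intros t.
  assert (D1 : curve_deriv (pt r) t (RtoC r * (Ci * cis t))%C).
  { unfold pt.
    replace (RtoC r * (Ci * cis t))%C
      with (1 * (RtoC r * (Ci * cis t)) + 0 * Cconj (RtoC r * (Ci * cis t)))%C by ring.
    apply (wirt_curve (fun w => z0 + w)%C (fun s => RtoC r * cis s)%C).
    eapply wirt_eq. apply wirt_plus. apply wirt_const. apply wirt_id. ring. ring.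
    apply curve_deriv_scal, curve_deriv_cis. }
  assert (D2 := wirt_curve F (pt r) t _ _ _ (HF _) D1).
  assert (D3 : curve_deriv (fun s => Cconj (cis s)) t (Cconj (Ci * cis t))).
  { replace (Cconj (Ci * cis t)) with
      (Cconj 0 * (Ci * cis t) + Cconj 1 * Cconj (Ci * cis t))%C.
    apply (wirt_curve (fun w => Cconj w) cis). apply wirt_conj, wirt_id.
    apply curve_deriv_cis.
    replace (Cconj 0) with (0 : C). replace (Cconj 1) with (1 : C). ring.
    now rewrite Cconj_RtoC.
    now rewrite Cconj_RtoC. }
  destruct (curve_deriv_mult _ _ _ _ _ D2 D3) as [_ D4].
  match type of D4 with is_derive _ _ ?X => replace (r * V r t - U r t) with X end.
  exact D4. unfold V, U. cbv beta. rewrite (Cmult_conj Ci (cis t)).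
  rewrite Cmult_0_l.
  replace (Cconj Ci) with (- Ci)%C
    by (unfold Ci, Cconj, Copp; simpl; f_equal; ring).
  replace ((F1 (pt r t) * (RtoC r * (Ci * cis t)) +
     0) * Cconj (cis t) +
     F (pt r t) * (- Ci * Cconj (cis t)))%C
  with (Ci * (RtoC r * (F1 (pt r t) * (cis t * Cconj (cis t))) - F (pt r t) * Cconj (cis t)))%C
    by ring.
  rewrite cis_conj, Cmult_1_r.
  generalize (F1 (pt r t)) (F (pt r t) * Cconj (cis t))%C. intros [a b] [c d].
  unfold Re, Im; simpl. ring. }
assert (I := is_RInt_derive (V := R_CompleteNormedModule) _ _ 0 (2 * PI)
  (fun x _ => D x)
  (fun x _ => continuous_minus (V := R_NormedModule) _ _ x
     (continuous_scal_r (V := R_NormedModule) r _ x (V_continuous r x)) (U_continuous r x))).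
apply is_RInt_unique in I.
replace (minus _ _) with 0 in I.
rewrite (RInt_minus (V := R_CompleteNormedModule) (fun t => scal r (V r t)) (U r)) in I.
- rewrite (RInt_scal (V := R_CompleteNormedModule) (V r)) in I.
  unfold minus, plus, opp, scal in I; simpl in I. unfold mult in I; simpl in I.
  unfold J. lra. apply V_integrable.
- apply (ex_RInt_scal (V := R_NormedModule)), V_integrable.
- apply U_integrable.
- assert (Ec : cis (2 * PI) = cis 0)
    by (unfold cis; now rewrite cos_0, sin_0, cos_2PI, sin_2PI).
  assert (Ep : pt r (2 * PI) = pt r 0) by (unfold pt; now rewrite Ec).
  rewrite Ec, Ep, minus_eq_zero. reflexivity.
Qed.

Lemma J_derive (r : R) : is_derive J r (RInt (V r) 0 (2 * PI)).
Proof.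
assert (E : forall s t, Derive (fun z => U z t) s = V s t)
  by (intros s t; apply is_derive_unique, U_derive).
rewrite <- (RInt_ext (V := R_CompleteNormedModule) (fun t => Derive (fun z => U z t) r))
  by (intros t _; apply E).
apply (is_derive_RInt_param U).
- apply filter_forall. intros s t _. exists (V s t). apply U_derive.
- intros t _. apply continuity_2d_pt_filterlim.
  rewrite E.
  apply (filterlim_ext (fun u : R * R => V (fst u) (snd u))).
  { intros u. symmetry. apply E. }
  apply (continuous_comp (fun u : R * R => F1 (pt (fst u) (snd u))) Re (r, t));
    [|apply continuous_fst].
  apply (continuous_comp (fun u : R * R => pt (fst u) (snd u)) F1).
  apply pt_continuous. apply CF1.
- apply filter_forall. intros s. apply U_integrable.
Qed.

Lemma J_bound (r : R) : Rabs (J r) <= 2 * PI * M.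
Proof.
assert (P := PI_RGT_0). replace (2 * PI * M) with ((2 * PI - 0) * M) by ring.
apply abs_RInt_le_const. lra. apply U_integrable.
intros t _. eapply Rle_trans. apply re_le_Cmod.
rewrite Cmod_mult, Cmod_conj, Cmod_cis, Rmult_1_r. apply HM.
Qed.

Lemma J_ratio (r s : R) : 0 < r -> r < s -> J r / r = J s / s.
Proof.
intros Hr Hs.
destruct (MVT_gen (fun x => J x / x) r s (fun _ => 0)) as [c [_ E]].
- intros x Hx. rewrite Rmin_left in Hx by lra.
  assert (D := is_derive_div J (fun x => x) x _ _ (J_derive x)
    (is_derive_id x) ltac:(lra)).
  match type of D with is_derive _ _ ?X => replace 0 with X end. exact D.
  rewrite (J_angular x). unfold one; simpl. field. lra.
- intros x Hx. rewrite Rmin_left in Hx by lra.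
  apply continuity_pt_filterlim. apply (ex_derive_continuous (V := R_NormedModule)
    (fun x => J x / x)).
  exact (ex_intro _ _ (is_derive_div J (fun x => x) x _ _ (J_derive x)
    (is_derive_id x) (Rgt_not_eq x 0 (Rlt_le_trans _ _ _ Hr (proj1 Hx))))).
- lra.
Qed.

(** With [J r] the integral over the circle of radius [r] about [z0] of
    [Re (F e^(-i t)) dt], [J r / r] is constant for [r > 0], equal to
    [2 PI Re (F1 z0)] in the limit [r -> 0] and to [0] in the limit [r -> oo]. *)
Lemma liouville_re : Re (F1 z0) = 0.
Proof.
assert (P := PI_RGT_0).
assert (J0 : forall r, 0 < r -> J r = 0).
{ intros r Hr. apply NNPP. intros N.
  assert (Ja : 0 < Rabs (J r)) by now apply Rabs_pos_lt.
  set (s := r + r * (2 * PI * M) / Rabs (J r) + 1).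
  assert (M0 : 0 <= 2 * PI * M).
  { apply Rmult_le_pos. lra. eapply Rle_trans; [apply Cmod_ge_0|apply (HM z0)]. }
  assert (S0 : 0 <= r * (2 * PI * M) / Rabs (J r)).
  { apply Rdiv_le_0_compat; auto. apply Rmult_le_pos; lra. }
  assert (E := J_ratio r s Hr ltac:(unfold s; lra)).
  assert (B := J_bound s).
  assert (Es : J s = J r / r * s) by (rewrite E; field; unfold s; lra).
  rewrite Es in B. unfold Rdiv in B. rewrite !Rabs_mult in B.
  rewrite (Rabs_right (/ r)) in B by (apply Rle_ge, Rlt_le, Rinv_0_lt_compat; lra).
  rewrite (Rabs_right s) in B by (unfold s; lra).
  assert (B2 : Rabs (J r) * s <= r * (2 * PI * M)).
  { apply Rmult_le_compat_l with (r := r) in B; [|lra].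
    replace (r * (Rabs (J r) * / r * s)) with (Rabs (J r) * s) in B by (field; lra).
    exact B. }
  unfold s in B2.
  replace (Rabs (J r) * (r + r * (2 * PI * M) / Rabs (J r) + 1))
    with (Rabs (J r) * (r + 1) + r * (2 * PI * M)) in B2 by (field; lra).
  assert (0 < Rabs (J r) * (r + 1)) by (apply Rmult_lt_0_compat; lra). lra. }
assert (D := J_derive 0).
assert (E : RInt (V 0) 0 (2 * PI) = 2 * PI * Re (F1 z0)).
{ rewrite (RInt_ext (V := R_CompleteNormedModule) _ (fun _ => Re (F1 z0))).
  rewrite RInt_const. unfold scal; simpl; unfold mult; simpl. ring.
  intros t _. unfold V, pt. now replace (z0 + RtoC 0 * cis t)%C with z0 by ring. }
rewrite E in D.
assert (J00 : J 0 = 0) by (rewrite J_angular; ring).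
destruct (Rtotal_order (2 * PI * Re (F1 z0)) 0) as [L|[L|L]].
- assert (D' := is_derive_opp (V := R_NormedModule) _ _ _ D).
  destruct (right_increase _ _ _ D' ltac:(unfold opp; simpl; lra)) as [d [Hd A]].
  specialize (A (d / 2) ltac:(lra)). unfold opp in A; simpl in A.
  rewrite J00, (J0 (d / 2)) in A by lra. lra.
- apply Rmult_integral in L. lra.
- destruct (right_increase _ _ _ D L) as [d [Hd A]].
  specialize (A (d / 2) ltac:(lra)). rewrite J00, (J0 (d / 2)) in A by lra. lra.
Qed.

End Liouville.

Lemma liouville (F F1 : C -> C) (M : R) :
  (forall z, wirt F z (F1 z) 0) -> (forall z, continuous F1 z) ->
  (forall z, Cmod (F z) <= M) -> forall z, F1 z = 0%C.
Proof.
intros HF CF1 HM z. apply injective_projections.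
- exact (liouville_re F F1 M HF CF1 HM z).
- assert (H := liouville_re (fun z => - Ci * F z)%C (fun z => - Ci * F1 z)%C M).
  assert (E : Re (- Ci * F1 z) = 0).
  { apply H.
    - intros w. eapply wirt_eq. apply (wirt_scal (- Ci)), HF. reflexivity. ring.
    - intros w. apply continuous_Cmult; auto. apply continuous_const.
    - intros w. rewrite Cmod_mult, Cmod_opp, Cmod_Ci, Rmult_1_l. apply HM. }
  destruct (F1 z) as [a b]. unfold Re in E; simpl in E. simpl. lra.
Qed.

(** * A Keller-Osserman estimate *)

Lemma local_max_direction (Phi G : C -> C) (z0 a b e : C) :
  locally z0 (fun w => wirt Phi w (G w) (Cconj (G w))) ->
  wirt G z0 a b ->
  locally z0 (fun w => Re (Phi w) <= Re (Phi z0)) ->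
  Re (e * (a * e + b * Cconj e))%C <= 0.
Proof.
intros H1 H2 H3.
set (l := fun s : R => (z0 + RtoC s * e)%C).
assert (l0 : l 0 = z0) by (unfold l; ring).
assert (Cl : continuous l 0)
  by apply (curve_deriv_continuous _ _ _ (curve_deriv_line z0 e 0)).
rewrite <- l0 in H1, H3. apply Cl in H1. apply Cl in H3.
destruct (filter_and _ _ H1 H3) as [d Hd].
assert (K : forall s, 0 - d < s < 0 + d ->
  wirt Phi (l s) (G (l s)) (Cconj (G (l s))) /\ Re (Phi (l s)) <= Re (Phi (l 0))).
{ intros s Hs. apply Hd.
  unfold ball; simpl. unfold AbsRing_ball, abs, minus, plus, opp; simpl.
  apply Rabs_def1; lra. }
assert (Q : 2 * Re (e * (a * e + b * Cconj e))%C <= 0).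
{ apply (local_max_second_derive (fun s => Re (Phi (l s)))
    (fun s => 2 * Re (e * G (l s))%C) 0 _ d (cond_pos d)).
  - intros s Hs. destruct (wirt_curve Phi l s _ _ e (proj1 (K s Hs))
      (curve_deriv_line z0 e s)) as [D _].
    match type of D with is_derive _ _ ?X =>
      replace (2 * Re (e * G (l s))%C) with X end. exact D.
    unfold Re; simpl. ring.
  - rewrite <- l0 in H2.
    assert (D := wirt_curve G l 0 _ _ e H2 (curve_deriv_line z0 e 0)).
    apply (curve_deriv_scal e) in D. destruct D as [D _].
    apply (is_derive_scal (fun s => Re (e * G (l s))%C) 0 2). exact D.
  - intros s Hs. apply K, Hs. }
lra.
Qed.

(** The second-derivative test for the Laplacian [4 b]. *)
Lemma local_max_laplacian (Phi G : C -> C) (z0 a b : C) :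
  locally z0 (fun w => wirt Phi w (G w) (Cconj (G w))) ->
  wirt G z0 a b ->
  locally z0 (fun w => Re (Phi w) <= Re (Phi z0)) ->
  Re b <= 0.
Proof.
intros H1 H2 H3.
assert (A := local_max_direction Phi G z0 a b 1 H1 H2 H3).
assert (B := local_max_direction Phi G z0 a b Ci H1 H2 H3).
unfold Ci, Re in *; simpl in *. lra.
Qed.

Section Barrier.

Variables (f f1 : C -> C) (c : C) (rho : R).
Hypothesis Hf : forall z, wirt f z (f1 z) 0.

(** [rho^2 - |f - c|^2], positive over the disc of centre [c] and radius [rho]. *)
Definition gap (z : C) : C := (RtoC (rho ^ 2) - (f z - c) * Cconj (f z - c))%C.

Lemma gap_wirt (z : C) :
  wirt gap z (- (f1 z * Cconj (f z - c))) (- Cconj (f1 z * Cconj (f z - c))).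
Proof.
assert (A : wirt (fun w => f w - c)%C z (f1 z) 0).
{ eapply wirt_eq. apply wirt_minus. apply Hf. apply wirt_const. ring. ring. }
eapply wirt_eq. apply wirt_minus. apply wirt_const.
apply wirt_mult. exact A. apply wirt_conj, A.
- cbv beta. replace (Cconj 0) with (0 : C)
    by (now rewrite Cconj_RtoC). ring.
- cbv beta. rewrite Cmult_conj, Cconj_conj. ring.
Qed.

(** [gap^(-4)] and its [z]-derivative. *)
Definition barrier (z : C) : C := (/ (gap z * gap z * (gap z * gap z)))%C.
Definition barrier_dz (z : C) : C :=
  (4 * (f1 z * Cconj (f z - c)) / (gap z * (gap z * gap z * (gap z * gap z))))%C.

Lemma gap_real (z : C) : Cconj (gap z) = gap z.
Proof.
unfold gap. rewrite Cminus_conj, Cmult_conj, Cconj_conj, Cconj_RtoC. ring.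
Qed.

Lemma barrier_wirt (z : C) : gap z <> 0%C -> wirt barrier z (barrier_dz z) (Cconj (barrier_dz z)).
Proof.
intros N. assert (H := gap_wirt z).
assert (H2 := wirt_mult _ _ _ _ _ _ _ H H).
assert (H4 := wirt_mult _ _ _ _ _ _ _ H2 H2).
assert (N4 : (gap z * gap z * (gap z * gap z) <> 0)%C) by (repeat apply Cmult_neq_0; auto).
eapply wirt_eq. apply (wirt_inv _ _ _ _ H4 N4).
- unfold barrier_dz. set (t := gap z) in *. Cfield. auto.
- unfold barrier_dz. rewrite Cdiv_conj by (repeat apply Cmult_neq_0; auto).
  rewrite !(Cmult_conj (gap z)), !Cmult_conj, !gap_real.
  replace (Cconj 4) with (4 : C) by (now rewrite Cconj_RtoC).
  set (t := gap z) in *. Cfield. auto.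
Qed.

Lemma barrier_laplacian (z f2 : C) : gap z <> 0%C -> wirt f1 z f2 0 ->
  exists a b, wirt barrier_dz z a b /\
    b = (4 * (f1 z * Cconj (f1 z)) *
         (gap z + 5 * ((f z - c) * Cconj (f z - c))) /
         (gap z * gap z * (gap z * gap z) * (gap z * gap z)))%C.
Proof.
intros N Hf1. assert (H := gap_wirt z).
assert (H2 := wirt_mult _ _ _ _ _ _ _ H H).
assert (H5 := wirt_mult _ _ _ _ _ _ _ H (wirt_mult _ _ _ _ _ _ _ H2 H2)).
assert (A : wirt (fun w => f w - c)%C z (f1 z) 0).
{ eapply wirt_eq. apply wirt_minus. apply Hf. apply wirt_const. ring. ring. }
assert (B := wirt_scal 4 _ _ _ _ (wirt_mult _ _ _ _ _ _ _ Hf1 (wirt_conj _ _ _ _ A))).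
assert (N5 : (gap z * (gap z * gap z * (gap z * gap z)) <> 0)%C) by (repeat apply Cmult_neq_0; auto).
eexists. eexists. split. apply (wirt_div _ _ _ _ _ _ _ B H5 N5).
cbv beta. rewrite Cmult_conj, Cconj_conj.
set (t := gap z) in *. Cfield. auto.
Qed.

End Barrier.

(** If [Y >= 0] satisfies [Y_{z zbar} >= |f'|^2 Y^(3/2)] and [f] has an inverse
    branch [g] on a closed disc of radius [rho], then [Y <= 400 / rho^4] at the
    centre: at a maximum of [Y s^4], with [s = rho^2 - |f - c|^2], the Laplacian
    of [Y] is at most that of a multiple of [s^(-4)], which blows up on the
    boundary circle. *)
Lemma keller_osserman (f f1 f2 g Y YZ : C -> C) (c : C) (rho : R) :
  0 < rho ->
  (forall z, wirt f z (f1 z) 0) ->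
  (forall z, f1 z <> 0%C -> wirt f1 z (f2 z) 0) ->
  (forall z, f1 z <> 0%C -> 0 <= Re (Y z)) ->
  (forall z, f1 z <> 0%C -> wirt Y z (YZ z) (Cconj (YZ z))) ->
  (forall z, f1 z <> 0%C -> exists a b, wirt YZ z a b /\
     Cmod (f1 z) ^ 2 * (Re (Y z) * sqrt (Re (Y z))) <= Re b) ->
  (forall u, Cmod (u - c) <= rho ->
     f (g u) = u /\ continuous g u /\ f1 (g u) <> 0%C) ->
  Re (Y (g c)) * rho ^ 4 <= 400.
Proof.
intros Hrho Hf Hf1 Y0 HY HYZ Hg.
set (m := fun u : C => Rmax 0 (rho ^ 2 - Cmod (u - c) ^ 2)).
set (F := fun u => Re (Y (g u)) * m u ^ 4).
assert (Cc : forall u : C, continuous (fun v : C => Cmod (v - c)) u).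
{ intros u. apply continuous_Cmod, continuous_Cminus.
  apply continuous_id. apply continuous_const. }
assert (Cm : forall u, continuous (fun v => m v ^ 4) u).
{ intros u.
  apply (continuous_comp (fun v : C => Cmod (v - c)) (fun x => Rmax 0 (rho ^ 2 - x ^ 2) ^ 4)).
  apply Cc.
  apply (continuous_comp (fun x => Rmax 0 (rho ^ 2 - x ^ 2)) (fun y => y ^ 4)).
  2: apply (ex_derive_continuous (V := R_NormedModule) (fun y => y ^ 4)); auto_derive; auto.
  apply (continuous_comp (fun x => rho ^ 2 - x ^ 2) (fun y => Rmax 0 y)).
  apply (ex_derive_continuous (V := R_NormedModule) (fun x => rho ^ 2 - x ^ 2)); auto_derive; auto.
  apply (continuous_ext (fun y => (y + Rabs y) / 2)).
  intros y. unfold Rmax. destruct (Rle_dec 0 y); [rewrite Rabs_right | rewrite Rabs_left]; lra.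
  apply (continuous_mult (K := R_AbsRing) (fun y => y + Rabs y)).
  apply (continuous_plus (V := R_NormedModule)). apply continuous_id.
  apply continuous_Rabs. apply continuous_const. }
assert (CF : forall u, continuous F u).
{ intros u. destruct (Rle_lt_dec (Cmod (u - c)) rho) as [L|L].
  - destruct (Hg u L) as [G1 [G2 G3]].
    apply (continuous_mult (K := R_AbsRing) (fun u => Re (Y (g u)))); [|apply Cm].
    apply (continuous_comp g (fun z => Re (Y z))); auto.
    apply (continuous_C_parts Y). exact (wirt_continuous _ _ _ _ (HY _ G3)).
  - apply continuous_ext_loc with (fun _ => 0); [|apply continuous_const].
    assert (O : locally u (fun v : C => rho < Cmod (v - c))).
    { apply (Cc u (fun x => rho < x)). now apply open_gt. }
    revert O. apply filter_imp. intros v Hv. unfold F, m.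
    rewrite Rmax_left by nra.
    match goal with |- @eq _ ?a ?b => change (@eq R a b) end. ring. }
destruct (box_max F (Re c - rho) (Re c + rho) (Im c - rho) (Im c + rho))
  as [u0 [_ Hmax]]; [lra | lra | auto |].
assert (HB : forall u, Cmod (u - c) <= rho -> F u <= F u0).
{ intros u Hu. apply Hmax.
  assert (A1 := re_le_Cmod (u - c)). assert (A2 := im_le_Cmod (u - c)).
  apply Rabs_le_between in A1. apply Rabs_le_between in A2.
  replace (Re (u - c)) with (Re u - Re c) in A1 by reflexivity.
  replace (Im (u - c)) with (Im u - Im c) in A2 by reflexivity.
  unfold box. lra. }
set (N := F u0) in *.
assert (Z0 : Cmod (c - c) = 0) by (replace (c - c)%C with (0 : C) by ring; apply Cmod_0).
assert (HN : N <= 400 * rho ^ 4).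
{ destruct (Rle_lt_dec N 0) as [L|L].
  { assert (0 < rho ^ 4) by now apply pow_lt. lra. }
  assert (In : Cmod (u0 - c) < rho).
  { apply Rnot_le_lt. intros L2.
    assert (N = 0); [|lra]. unfold N, F, m. rewrite Rmax_left by nra. ring. }
  destruct (Hg u0 ltac:(lra)) as [G1 [G2 G3]].
  set (z0 := g u0) in *.
  set (s := gap f c rho).
  assert (sE : forall z, s z = RtoC (rho ^ 2 - Cmod (f z - c) ^ 2)).
  { intros z. unfold s, gap. rewrite <- Cmod2_conj. now rewrite RtoC_minus. }
  set (s0 := rho ^ 2 - Cmod (u0 - c) ^ 2).
  assert (Ps0 : 0 < s0) by (unfold s0; assert (Q := Cmod_ge_0 (u0 - c)); nra).
  assert (sz0 : s z0 = RtoC s0) by (rewrite sE, G1; reflexivity).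
  assert (Nsz0 : s z0 <> 0%C).
  { rewrite sz0. intros E. apply (f_equal Re) in E. simpl in E. lra. }
  assert (Cs : continuous s z0) by apply (wirt_continuous _ _ _ _ (gap_wirt f f1 c rho Hf z0)).
  assert (Cf : continuous f z0) by apply (wirt_continuous _ _ _ _ (Hf z0)).
  assert (Cf1 : continuous f1 z0) by apply (wirt_continuous _ _ _ _ (Hf1 z0 G3)).
  set (S := barrier f c rho).
  set (SZ := barrier_dz f f1 c rho).
  assert (Near : locally z0 (fun z => f1 z <> 0%C /\ s z <> 0%C)).
  { apply filter_and; apply continuous_Cneq; auto. }
  destruct (barrier_laplacian f f1 c rho Hf z0 (f2 z0) Nsz0 (Hf1 z0 G3)) as [a' [b' [HSZ Eb']]].
  fold s in Eb'. fold SZ in HSZ.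
  destruct (HYZ z0 G3) as [a [b [HYZ0 Hb]]].
  assert (Lap : Re (b - RtoC N * b') <= 0).
  { apply (local_max_laplacian (fun z => Y z - RtoC N * S z)%C
       (fun z => YZ z - RtoC N * SZ z)%C z0 (a - RtoC N * a')).
    - revert Near. apply filter_imp. intros z [Nz1 Nz2].
      assert (HS := barrier_wirt f f1 c rho Hf z Nz2).
      fold S SZ in HS.
      eapply wirt_eq. apply wirt_minus. apply HY, Nz1. apply wirt_scal, HS.
      reflexivity. rewrite Cminus_conj, Cmult_conj. f_equal. f_equal.
      f_equal. now rewrite Cconj_RtoC.
    - apply wirt_minus. exact HYZ0. now apply wirt_scal.
    - (* near [z0], [g] inverts [f] because [f] is injective there *)
      assert (Eq0 : Re (Y z0 - RtoC N * S z0) = 0).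
      { unfold S, barrier. fold s. rewrite sz0, <- !RtoC_mult, <- RtoC_inv, <- RtoC_mult.
        replace (Re (Y z0 - RtoC (N * / (s0 * s0 * (s0 * s0)))))
          with (Re (Y z0) - N * / (s0 * s0 * (s0 * s0))) by reflexivity.
        unfold N, F, m. fold s0 z0. rewrite Rmax_right by lra. field. lra.
        repeat apply Rmult_integral_contrapositive_currified; lra. }
      destruct (local_branch f f1 z0 Hf Cf1 G3) as [r [_ [_ [Hr [_ [_ Inj]]]]]].
      assert (L1 : locally z0 (fun z => Cmod (z - z0) < r)).
      { apply locally_Cmod. exists r; auto. }
      assert (L2 : locally z0 (fun z => Cmod (f z - c) < rho)).
      { apply (continuous_comp f (fun u : C => Cmod (u - c)) z0 Cf (Cc _)
          (fun x => x < rho)). apply open_lt. now rewrite G1. }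
      assert (L3 : locally z0 (fun z => Cmod (g (f z) - z0) < r)).
      { apply (continuous_Cmod_iff g u0) with (e := r) in G2; auto.
        rewrite <- G1 in G2. apply Cf in G2. unfold filtermap in G2.
        revert G2. apply filter_imp. intros z. now rewrite G1. }
      generalize (filter_and _ _ L1 (filter_and _ _ L2 L3)).
      apply filter_imp. intros z [K1 [K2 K3]].
      rewrite Eq0.
      assert (Ez : g (f z) = z).
      { apply Inj; auto. apply Hg. lra. }
      assert (Bz := HB (f z) ltac:(lra)). unfold F in Bz. rewrite Ez in Bz.
      unfold m in Bz.
      set (sz := rho ^ 2 - Cmod (f z - c) ^ 2) in *.
      assert (Psz : 0 < sz) by (unfold sz; assert (Q := Cmod_ge_0 (f z - c)); nra).
      rewrite Rmax_right in Bz by lra.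
      unfold S, barrier. fold s. rewrite (sE z). fold sz.
      rewrite <- !RtoC_mult, <- RtoC_inv, <- RtoC_mult.
      replace (Re (Y z - RtoC (N * / (sz * sz * (sz * sz)))))
        with (Re (Y z) - N * / (sz * sz * (sz * sz))) by reflexivity.
      apply Rle_minus. apply Rle_div_r.
      repeat apply Rmult_lt_0_compat; auto.
      replace (sz * sz * (sz * sz)) with (sz ^ 4) by ring. exact Bz.
      repeat apply Rmult_integral_contrapositive_currified; lra. }
  (* comparison of the two Laplacians at the maximum *)
  set (A := Cmod (f1 z0) ^ 2) in *.
  assert (PA : 0 < A) by (apply pow_lt; now apply Cmod_gt_0).
  set (R2 := Cmod (u0 - c) ^ 2).
  assert (HR2 : 0 <= R2) by (apply pow2_ge_0).
  assert (Eb : b' = RtoC (4 * A * (s0 + 5 * R2) / (s0 ^ 6))).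
  { rewrite Eb'. rewrite <- !Cmod2_conj, sz0, G1. fold A. fold R2.
    rewrite <- !RtoC_mult, <- RtoC_plus, <- RtoC_mult, <- RtoC_div.
    f_equal. field. lra.
    repeat apply Rmult_integral_contrapositive_currified; lra. }
  rewrite Eb in Lap.
  replace (Re (b - RtoC N * RtoC (4 * A * (s0 + 5 * R2) / s0 ^ 6)))
    with (Re b - N * (4 * A * (s0 + 5 * R2) / s0 ^ 6)) in Lap
    by (unfold Re; simpl; ring).
  assert (EY : Re (Y z0) = N / s0 ^ 4).
  { unfold N, F, m. fold s0 z0. rewrite Rmax_right by lra. field. lra. }
  assert (Esq : sqrt (Re (Y z0)) = sqrt N / s0 ^ 2).
  { rewrite EY. apply sqrt_lem_1.
    apply Rdiv_le_0_compat; [lra | now apply pow_lt].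
    apply Rdiv_le_0_compat; [apply sqrt_pos | now apply pow_lt].
    replace (sqrt N / s0 ^ 2 * (sqrt N / s0 ^ 2)) with (sqrt N * sqrt N / s0 ^ 4) by (field; lra).
    rewrite sqrt_def; lra. }
  rewrite Esq, EY in Hb.
  assert (P6 : 0 < s0 ^ 6) by now apply pow_lt.
  assert (Main : A * N * sqrt N <= N * (4 * A * (s0 + 5 * R2))).
  { apply Rmult_le_reg_r with (/ s0 ^ 6). now apply Rinv_0_lt_compat.
    replace (A * N * sqrt N * / s0 ^ 6) with (A * (N / s0 ^ 4 * (sqrt N / s0 ^ 2))) by (field; lra).
    replace (N * (4 * A * (s0 + 5 * R2)) * / s0 ^ 6)
      with (N * (4 * A * (s0 + 5 * R2) / s0 ^ 6)) by (field; lra). lra. }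
  assert (B20 : 4 * (s0 + 5 * R2) <= 20 * rho ^ 2) by (unfold s0 in *; fold R2 in Ps0 |- *; lra).
  assert (Sq : sqrt N <= 20 * rho ^ 2).
  { apply Rmult_le_reg_l with (A * N). now apply Rmult_lt_0_compat.
    apply Rle_trans with (A * N * (4 * (s0 + 5 * R2))). lra.
    apply Rmult_le_compat_l; auto. apply Rlt_le, Rmult_lt_0_compat; auto. }
  rewrite <- (sqrt_def N) by lra. assert (Q := sqrt_pos N).
  replace (400 * rho ^ 4) with ((20 * rho ^ 2) * (20 * rho ^ 2)) by ring.
  now apply Rmult_le_compat. }
assert (B := HB c ltac:(lra)). unfold F in B. unfold m in B. rewrite Z0 in B.
rewrite Rmax_right in B by nra.
assert (P4 : 0 < rho ^ 4) by now apply pow_lt.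
apply Rmult_le_reg_r with (rho ^ 4); auto.
replace (Re (Y (g c)) * rho ^ 4 * rho ^ 4) with (Re (Y (g c)) * (rho ^ 2 - 0 ^ 2) ^ 4) by ring.
lra.
Qed.

(** * The Beltrami quotient of a harmonic map *)

Lemma wirt_unique (F : C -> C) (z p q : C) : wirt F z p q ->
  wirtinger F z = p /\ wirtinger_bar F z = q.
Proof.
intros H. destruct z as [x y].
assert (D1 := wirt_curve F (fun t => (t, y)) x p q 1 H).
assert (D2 := wirt_curve F (fun t => (x, t)) y p q Ci H).
destruct D1 as [A1 A2].
{ split; unfold Re, Im; simpl; auto_derive; auto. }
destruct D2 as [B1 B2].
{ split; unfold Re, Im; simpl; auto_derive; auto. }
apply is_derive_unique in A1, A2, B1, B2.
unfold wirtinger, wirtinger_bar, dx, dy. simpl Re. simpl Im.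
unfold Re, Im in *. simpl in A1, A2, B1, B2 |- *. rewrite A1, A2, B1, B2.
destruct p as [p1 p2], q as [q1 q2].
split; apply injective_projections; simpl; field.
Qed.

Lemma wirtinger_log_sigma (u : C) : Cmod u < 1 ->
  wirtinger log_sigma u = (Cconj u / (1 - u * Cconj u))%C.
Proof.
intros Hu. destruct u as [x y].
assert (Q : 0 < 1 - (x * x + y * y)).
{ assert (A := Cmod2_alt (x, y)). assert (B := Cmod_ge_0 (x, y)).
  unfold Re, Im in A; simpl in A. nra. }
assert (E : forall s t, Re (log_sigma (s, t)) = ln (2 / (1 - (s * s + t * t)))).
{ intros s t. unfold log_sigma, Defs.sigma. rewrite Cmod2_alt. unfold Re, Im; simpl.
  f_equal. f_equal. ring. }
assert (I0 : forall s t, Im (log_sigma (s, t)) = 0) by reflexivity.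
assert (Dx : Derive (fun s => Re (log_sigma (s, y))) x = 2 * x / (1 - (x * x + y * y))).
{ rewrite (Derive_ext _ _ x (fun s => E s y)). apply is_derive_unique.
  auto_derive. repeat split; try lra. apply Rdiv_lt_0_compat; lra.
  field. lra. }
assert (Dy : Derive (fun t => Re (log_sigma (x, t))) y = 2 * y / (1 - (x * x + y * y))).
{ rewrite (Derive_ext _ _ y (fun t => E x t)). apply is_derive_unique.
  auto_derive. repeat split; try lra. apply Rdiv_lt_0_compat; lra.
  field. lra. }
unfold wirtinger, dx, dy. simpl (Re (x, y)). simpl (Im (x, y)). rewrite Dx, Dy.
rewrite (Derive_ext _ _ x (fun s => I0 s y)), (Derive_ext _ _ y (fun t => I0 x t)).
rewrite !Derive_const.
replace (1 - (x, y) * Cconj (x, y))%C with (RtoC (1 - (x * x + y * y)))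
  by (apply injective_projections; simpl; ring).
unfold Cdiv at 2. rewrite <- RtoC_inv by lra.
apply injective_projections; simpl; field; lra.
Qed.

Section Harmonic.

(* [f1 ^ 2] is the coefficient of the Hopf differential. *)
Variables (h f1 : C -> C).
Hypothesis h_smooth : smooth h.
Hypothesis h_disc : forall z, Cmod (h z) < 1.
Hypothesis h_harm : forall z,
  (wirtinger_bar (wirtinger h) z
   + 2 * wirtinger log_sigma (h z) * wirtinger h z * wirtinger_bar h z = 0)%C.
Hypothesis h_orient : forall z, 0 < jacobian h z.
Hypothesis h_hopf : forall z, hopf h z = (f1 z * f1 z)%C.

Notation p := (wirtinger h).
Notation q := (wirtinger_bar h).
Notation p1 := (wirtinger (wirtinger h)).
Notation q1 := (wirtinger_bar (wirtinger_bar h)).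

(** [1 - |h|^2]; the conformal factor is [2 / (1 - |h|^2)]. *)
Definition conf_den (z : C) : C := (1 - h z * Cconj (h z))%C.
(** [(log sigma)_u] at [h z]. *)
Definition kap (z : C) : C := (Cconj (h z) / conf_den z)%C.
(** Wirtinger derivatives of [kap]. *)
Definition kap_z (z : C) : C :=
  ((Cconj (q z) + p z * (Cconj (h z) * Cconj (h z))) / (conf_den z * conf_den z))%C.
Definition kap_zb (z : C) : C :=
  ((Cconj (p z) + q z * (Cconj (h z) * Cconj (h z))) / (conf_den z * conf_den z))%C.

Lemma conf_den_real (z : C) : conf_den z = RtoC (1 - Cmod (h z) ^ 2).
Proof. unfold conf_den. rewrite <- Cmod2_conj. now rewrite RtoC_minus. Qed.

Lemma conf_den_pos (z : C) : 0 < 1 - Cmod (h z) ^ 2.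
Proof. assert (A := h_disc z). assert (B := Cmod_ge_0 (h z)). nra. Qed.

Lemma conf_den_neq0 (z : C) : conf_den z <> 0%C.
Proof.
rewrite conf_den_real. intros E. apply (f_equal Re) in E. simpl in E.
assert (A := conf_den_pos z). simpl in A. lra.
Qed.

Lemma wirt_h (z : C) : wirt h z (p z) (q z).
Proof. now apply smooth_wirt. Qed.

Lemma kap_wirt (z : C) : wirt kap z (kap_z z) (kap_zb z).
Proof.
assert (H := wirt_h z). assert (Hc := wirt_conj _ _ _ _ H).
assert (N := conf_den_neq0 z).
eapply wirt_eq. apply wirt_div. exact Hc.
apply wirt_minus. apply (wirt_const 1). apply (wirt_mult _ _ _ _ _ _ _ H Hc).
exact N.
- unfold kap_z. unfold conf_den in *. Cfield. exact N.
- unfold kap_zb. unfold conf_den in *. Cfield. exact N.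
Qed.

(** The harmonic map equation, [h_{z zbar} = - 2 (log sigma)_u h_z h_zbar]. *)
Definition h_zzb (z : C) : C := (- (2) * (kap z * (p z * q z)))%C.

Lemma p_zbar (z : C) : wirtinger_bar p z = h_zzb z.
Proof.
assert (H := h_harm z). rewrite wirtinger_log_sigma in H by apply h_disc.
fold (conf_den z) in H. fold (kap z) in H. unfold h_zzb.
match type of H with (?a + ?b = _)%C =>
  replace a with (a + b - b)%C by ring; rewrite H; ring end.
Qed.

Lemma q_z (z : C) : wirtinger q z = h_zzb z.
Proof. rewrite wirtinger_comm by exact h_smooth. apply p_zbar. Qed.

Lemma p_wirt (z : C) : wirt p z (p1 z) (h_zzb z).
Proof. rewrite <- p_zbar. now apply smooth_wirt, smooth_wirtinger. Qed.

Lemma q_wirt (z : C) : wirt q z (h_zzb z) (q1 z).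
Proof. rewrite <- q_z. now apply smooth_wirt, smooth_wirtinger_bar. Qed.

(** Wirtinger derivatives of [h_zzb]. *)
Definition h_zzb_z (z : C) : C :=
  (- (2) * (kap_z z * (p z * q z) + kap z * (p1 z * q z + p z * h_zzb z)))%C.
Definition h_zzb_zb (z : C) : C :=
  (- (2) * (kap_zb z * (p z * q z) + kap z * (h_zzb z * q z + p z * q1 z)))%C.

Lemma h_zzb_wirt (z : C) : wirt h_zzb z (h_zzb_z z) (h_zzb_zb z).
Proof.
eapply wirt_eq. apply wirt_scal. apply wirt_mult. apply kap_wirt.
apply wirt_mult. apply p_wirt. apply q_wirt.
- unfold h_zzb_z. reflexivity.
- unfold h_zzb_zb. reflexivity.
Qed.

(** Third derivatives of [h]: mixed partials commute. *)
Lemma p1_wirt (z : C) : wirt p1 z (wirtinger p1 z) (h_zzb_z z).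
Proof.
replace (h_zzb_z z) with (wirtinger_bar p1 z).
now apply smooth_wirt, smooth_wirtinger, smooth_wirtinger.
rewrite <- wirtinger_comm by now apply smooth_wirtinger.
replace (wirtinger_bar p) with h_zzb
  by (apply functional_extensionality; intros w; symmetry; apply p_zbar).
apply (wirt_unique _ _ _ _ (h_zzb_wirt z)).
Qed.

Lemma q1_wirt (z : C) : wirt q1 z (h_zzb_zb z) (wirtinger_bar q1 z).
Proof.
replace (h_zzb_zb z) with (wirtinger q1 z).
now apply smooth_wirt, smooth_wirtinger_bar, smooth_wirtinger_bar.
rewrite wirtinger_comm by now apply smooth_wirtinger_bar.
replace (wirtinger q) with h_zzb
  by (apply functional_extensionality; intros w; symmetry; apply q_z).
apply (wirt_unique _ _ _ _ (h_zzb_wirt z)).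
Qed.

(** The factor in [tau_zbar = 2 cc tau], where [tau = h_z / conj (h_zbar)]
    below. *)
Definition cc (z : C) : C :=
  (Cconj (kap z) * Cconj (p z) - kap z * q z)%C.
Definition cc_z (z : C) : C :=
  (Cconj (kap_zb z) * Cconj (p z) + Cconj (kap z) * Cconj (h_zzb z)
   - (kap_z z * q z + kap z * h_zzb z))%C.

Lemma cc_wirt (z : C) : exists r, wirt cc z (cc_z z) r.
Proof.
assert (H := wirt_minus _ _ _ _ _ _ _
  (wirt_mult _ _ _ _ _ _ _ (wirt_conj _ _ _ _ (kap_wirt z)) (wirt_conj _ _ _ _ (p_wirt z)))
  (wirt_mult _ _ _ _ _ _ _ (kap_wirt z) (q_wirt z))).
eexists. exact H.
Qed.

(** [Re cc_z = (log sigma)_{u ubar} (|h_z|^2 - |h_zbar|^2)]: here the curvature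
    [-1] enters. *)
Lemma cc_z_re (z : C) :
  (cc_z z + Cconj (cc_z z) =
   2 * (p z * Cconj (p z) - q z * Cconj (q z)) / (conf_den z * conf_den z))%C.
Proof.
assert (N := conf_den_neq0 z).
assert (N2 : (conf_den z * conf_den z <> 0)%C) by now apply Cmult_neq_0.
assert (Dr : Cconj (conf_den z) = conf_den z) by (rewrite conf_den_real; apply Cconj_RtoC).
assert (E : (cc_z z + Cconj (cc_z z) =
   (Cconj (kap_zb z) * Cconj (p z) + kap_zb z * p z)
   - (kap_z z * q z + Cconj (kap_z z) * Cconj (q z)))%C).
{ unfold cc_z.
  rewrite Cminus_conj, !Cplus_conj, !Cmult_conj, !Cconj_conj. ring. }
rewrite E. unfold kap_z, kap_zb.
rewrite !Cdiv_conj by exact N2.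
rewrite !Cplus_conj, !Cmult_conj, !Cconj_conj, Dr. field. exact N.
Qed.

Definition tau (z : C) : C := (p z / Cconj (q z))%C.
Definition tau_z (z : C) : C :=
  ((p1 z * Cconj (q z) - p z * Cconj (q1 z)) / (Cconj (q z) * Cconj (q z)))%C.

Lemma Cconj_neq0 (z : C) : z <> 0%C -> Cconj z <> 0%C.
Proof.
intros N E. apply N. rewrite <- (Cconj_conj z), E. apply Cconj_RtoC.
Qed.

Lemma tau_wirt (z : C) : q z <> 0%C -> wirt tau z (tau_z z) (2 * cc z * tau z).
Proof.
intros N. apply Cconj_neq0 in N.
eapply wirt_eq. apply wirt_div. apply p_wirt. apply wirt_conj, q_wirt. exact N.
- reflexivity.
- unfold cc, tau, h_zzb. rewrite !Cmult_conj, Copp_conj, Cconj_RtoC.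
  Cfield. exact N.
Qed.

Lemma tau_z_wirt (z : C) : q z <> 0%C ->
  exists r, wirt tau_z z r (2 * (cc_z z * tau z + cc z * tau_z z)).
Proof.
intros N. apply Cconj_neq0 in N.
assert (N2 : (Cconj (q z) * Cconj (q z) <> 0)%C) by now apply Cmult_neq_0.
assert (HQ := wirt_conj _ _ _ _ (q_wirt z)).
assert (HQ1 := wirt_conj _ _ _ _ (q1_wirt z)).
assert (H := wirt_div _ _ _ _ _ _ _
  (wirt_minus _ _ _ _ _ _ _ (wirt_mult _ _ _ _ _ _ _ (p1_wirt z) HQ)
     (wirt_mult _ _ _ _ _ _ _ (p_wirt z) HQ1))
  (wirt_mult _ _ _ _ _ _ _ HQ HQ) N2).
eexists. eapply wirt_eq. exact H. reflexivity.
unfold cc, cc_z, tau, tau_z, h_zzb_z, h_zzb_zb, h_zzb.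
repeat rewrite ?Cmult_conj, ?Copp_conj, ?Cplus_conj, ?Cconj_RtoC, ?Cconj_conj.
Cfield. exact N.
Qed.

(** [Y = |h_z|^2 / |h_zbar|^2 - 1]. *)
Definition excess (z : C) : C := (tau z * Cconj (tau z) - 1)%C.
(** The [z]-derivative of [excess]. *)
Definition excess_z (z : C) : C :=
  (tau_z z * Cconj (tau z) + tau z * Cconj (2 * cc z * tau z))%C.

Lemma excess_wirt (z : C) : q z <> 0%C ->
  wirt excess z (excess_z z) (Cconj (excess_z z)).
Proof.
intros N. assert (H := tau_wirt z N).
eapply wirt_eq. apply wirt_minus. apply wirt_mult. exact H.
apply wirt_conj, H. apply wirt_const.
- unfold excess_z. ring.
- unfold excess_z. rewrite Cplus_conj, !(Cmult_conj (tau_z z)), (Cmult_conj (tau z)), !Cconj_conj.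
  ring.
Qed.

(** [Y_{z zbar}] is a nonnegative multiple of the Jacobian plus a squared modulus. *)
Lemma excess_laplacian (z : C) : q z <> 0%C -> exists a b, wirt excess_z z a b /\
  (b = tau z * Cconj (tau z) * (4 * (p z * Cconj (p z) - q z * Cconj (q z))
         / (conf_den z * conf_den z))
      + (tau_z z + 2 * Cconj (cc z) * tau z) * Cconj (tau_z z + 2 * Cconj (cc z) * tau z))%C.
Proof.
intros N. destruct (tau_z_wirt z N) as [r Hz]. destruct (cc_wirt z) as [r' Hc].
assert (H := tau_wirt z N).
assert (HH := wirt_plus _ _ _ _ _ _ _
  (wirt_mult _ _ _ _ _ _ _ Hz (wirt_conj _ _ _ _ H))
  (wirt_mult _ _ _ _ _ _ _ H (wirt_conj _ _ _ _
     (wirt_mult _ _ _ _ _ _ _ (wirt_scal 2 _ _ _ _ Hc) H)))).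
eexists. eexists. split. exact HH. cbv beta.
replace (4 * (p z * Cconj (p z) - q z * Cconj (q z)) / (conf_den z * conf_den z))%C
  with (2 * (cc_z z + Cconj (cc_z z)))%C
  by (rewrite cc_z_re; field; apply conf_den_neq0).
repeat rewrite ?Cmult_conj, ?Cplus_conj, ?Cconj_RtoC, ?Cconj_conj. ring.
Qed.

Lemma jacobian_wirtinger (z : C) : jacobian h z = Cmod (p z) ^ 2 - Cmod (q z) ^ 2.
Proof.
rewrite !Cmod2_alt. unfold jacobian, wirtinger, wirtinger_bar.
generalize (dx h z) (dy h z). intros [a b] [c d]. unfold Re, Im; simpl. field.
Qed.

Lemma hopf_conj (z : C) : (f1 z * f1 z = RtoC (Defs.sigma (h z) ^ 2) * (p z * Cconj (q z)))%C.
Proof.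
rewrite <- h_hopf. unfold hopf.
rewrite (proj1 (wirt_unique _ _ _ _ (wirt_conj _ _ _ _ (wirt_h z)))). ring.
Qed.

Lemma sigma_pos (z : C) : 0 < Defs.sigma (h z).
Proof. apply Rdiv_lt_0_compat. lra. apply conf_den_pos. Qed.

Lemma p_gt_q (z : C) : Cmod (q z) < Cmod (p z).
Proof.
assert (J := h_orient z). rewrite jacobian_wirtinger in J.
assert (A := Cmod_ge_0 (p z)). assert (B := Cmod_ge_0 (q z)). nra.
Qed.

Lemma hopf_mod (z : C) :
  Cmod (f1 z) ^ 2 = Defs.sigma (h z) ^ 2 * (Cmod (p z) * Cmod (q z)).
Proof.
assert (E := f_equal Cmod (hopf_conj z)).
rewrite !Cmod_mult, Cmod_conj, Cmod_R, Rabs_right in E. rewrite <- E. ring.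
apply Rle_ge, pow2_ge_0.
Qed.

Lemma q_neq0 (z : C) : f1 z <> 0%C -> q z <> 0%C.
Proof.
intros N E. assert (H := hopf_mod z). rewrite E, Cmod_0 in H.
apply Cmod_gt_0 in N. assert (0 < Cmod (f1 z) ^ 2) by now apply pow_lt.
rewrite !Rmult_0_r in H. lra.
Qed.

Lemma excess_re (z : C) : q z <> 0%C ->
  Re (excess z) = (Cmod (p z) / Cmod (q z)) ^ 2 - 1.
Proof.
intros N. unfold excess. rewrite <- Cmod2_conj.
unfold tau. rewrite Cmod_div by now apply Cconj_neq0.
rewrite Cmod_conj. reflexivity.
Qed.

Lemma excess_ge0 (z : C) : f1 z <> 0%C -> 0 <= Re (excess z).
Proof.
intros N. apply q_neq0 in N. rewrite excess_re by exact N.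
assert (A := p_gt_q z). apply Cmod_gt_0 in N.
assert (1 <= Cmod (p z) / Cmod (q z)) by (apply Rle_div_r; lra). nra.
Qed.

(** The Bochner inequality [Y_{z zbar} >= |f'|^2 Y^(3/2)]. *)
Lemma excess_subsolution (z : C) : f1 z <> 0%C ->
  exists a b, wirt excess_z z a b /\
    Cmod (f1 z) ^ 2 * (Re (excess z) * sqrt (Re (excess z))) <= Re b.
Proof.
intros N. assert (Y0 := excess_ge0 z N). assert (Nq := q_neq0 z N).
destruct (excess_laplacian z Nq) as [a [b [Hw Eb]]].
exists a, b. split; [exact Hw|].
rewrite <- !Cmod2_conj in Eb. rewrite conf_den_real in Eb.
rewrite <- RtoC_mult, <- RtoC_minus, <- RtoC_mult in Eb.
rewrite <- RtoC_div in Eb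
  by (assert (A := conf_den_pos z); apply Rmult_integral_contrapositive_currified; lra).
rewrite <- RtoC_mult, <- RtoC_plus in Eb.
match type of Eb with b = RtoC ?x => replace (Re b) with x by now rewrite Eb end.
set (X := Cmod (p z) / Cmod (q z)).
assert (Pq : 0 < Cmod (q z)) by now apply Cmod_gt_0.
assert (Ppq := p_gt_q z).
assert (X1 : 1 <= X) by (apply Rle_div_r; lra).
assert (EY : Re (excess z) = X ^ 2 - 1) by now apply excess_re.
assert (ET : Cmod (tau z) ^ 2 = X ^ 2).
{ unfold tau. rewrite Cmod_div by now apply Cconj_neq0. now rewrite Cmod_conj. }
assert (Ep : Cmod (p z) = X * Cmod (q z)) by (unfold X; field; lra).
rewrite ET, hopf_mod, EY, Ep.
set (D := 1 - Cmod (h z) ^ 2) in *.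
assert (PD : 0 < D) by apply conf_den_pos.
assert (Es : Defs.sigma (h z) = 2 / D) by reflexivity. rewrite Es.
assert (Sq : sqrt (X ^ 2 - 1) <= X).
{ rewrite <- (sqrt_pow2 X) at 2 by lra. apply sqrt_le_1_alt. lra. }
assert (Sq0 := sqrt_pos (X ^ 2 - 1)).
set (S := sqrt (X ^ 2 - 1)) in *.
match goal with |- _ <= _ + ?R => assert (PR : 0 <= R) by apply pow2_ge_0 end.
apply Rle_trans with (X ^ 2 * (4 * ((X * Cmod (q z)) ^ 2 - Cmod (q z) ^ 2) / (D * D)));
  [|lra].
replace (X ^ 2 * (4 * ((X * Cmod (q z)) ^ 2 - Cmod (q z) ^ 2) / (D * D)))
  with ((2 / D) ^ 2 * (X * Cmod (q z) * Cmod (q z)) * (X ^ 2 - 1) * X) by (field; lra).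
rewrite <- !Rmult_assoc.
apply Rmult_le_compat_l; [|exact Sq].
assert (A1 : 0 <= (2 / D) ^ 2) by apply pow2_ge_0.
assert (A2 : 0 <= X ^ 2 - 1) by nra.
apply Rmult_le_pos; [|exact A2].
apply Rmult_le_pos; [|lra]. apply Rmult_le_pos; [|lra].
apply Rmult_le_pos; lra.
Qed.

(** Along a curve [g] with [f(g(t)) = a + i t], the hyperbolic speed of [h o g]
    is at most the excess. *)
Lemma hyperbolic_speed (z v : C) : (f1 z * v = Ci)%C ->
  Defs.sigma (h z) * Cmod (p z * v + q z * Cconj v) <= Re (excess z).
Proof.
intros Ev.
assert (N : f1 z <> 0%C).
{ intros E. rewrite E, Cmult_0_l in Ev. apply (f_equal Im) in Ev. simpl in Ev. lra. }
assert (Nq := q_neq0 z N). rewrite excess_re by exact Nq.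
assert (Pq : 0 < Cmod (q z)) by now apply Cmod_gt_0.
assert (Ppq := p_gt_q z). set (X := Cmod (p z) / Cmod (q z)).
assert (X1 : 1 <= X) by (apply Rle_div_r; lra).
assert (Ep : Cmod (p z) = X * Cmod (q z)) by (unfold X; field; lra).
assert (Ps := sigma_pos z). set (s := Defs.sigma (h z)) in *.
assert (Nv : Cmod (f1 z) * Cmod v = 1) by (rewrite <- Cmod_mult, Ev; apply Cmod_Ci).
(* [|p v + q conj v|^2 = (|p|^2 + |q|^2) |v|^2 + 2 Re (p conj q v^2)], and
   [s^2 p conj q v^2 = (f' v)^2 = -1] *)
assert (E1 : (RtoC (s ^ 2) * (p z * Cconj (q z) * (v * v)) = - (1))%C).
{ transitivity ((RtoC (s ^ 2) * (p z * Cconj (q z))) * (v * v))%C. ring.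
  assert (H := hopf_conj z). fold s in H. rewrite <- H.
  replace (f1 z * f1 z * (v * v))%C with ((f1 z * v) * (f1 z * v))%C by ring.
  rewrite Ev. apply injective_projections; simpl; ring. }
assert (E2 : s ^ 2 * Re (p z * Cconj (q z) * (v * v))%C = - 1).
{ revert E1. generalize (p z * Cconj (q z) * (v * v))%C. intros [a b] E1.
  apply (f_equal Re) in E1. unfold Re in *; simpl in *. lra. }
assert (E3 : Cmod (p z * v + q z * Cconj v) ^ 2 =
   (Cmod (p z) ^ 2 + Cmod (q z) ^ 2) * Cmod v ^ 2
   + 2 * Re (p z * Cconj (q z) * (v * v))%C).
{ rewrite !Cmod2_alt. generalize (p z) (q z). intros [a b] [c d]. destruct v as [e f].
  unfold Re, Im; simpl. ring. }
assert (E4 : s ^ 2 * (X * Cmod (q z) * Cmod (q z)) * Cmod v ^ 2 = 1).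
{ assert (H := hopf_mod z). fold s in H. rewrite Ep in H. rewrite <- H.
  rewrite <- Rpow_mult_distr, Nv. ring. }
assert (E5 : X * (s * Cmod (p z * v + q z * Cconj v)) ^ 2 = (X - 1) ^ 2).
{ rewrite Rpow_mult_distr, E3, Ep.
  replace (X * (s ^ 2 * (((X * Cmod (q z)) ^ 2 + Cmod (q z) ^ 2) * Cmod v ^ 2 +
      2 * Re (p z * Cconj (q z) * (v * v)))))
  with ((X ^ 2 + 1) * (s ^ 2 * (X * Cmod (q z) * Cmod (q z)) * Cmod v ^ 2)
      + 2 * X * (s ^ 2 * Re (p z * Cconj (q z) * (v * v)))) by ring.
  rewrite E4, E2. ring. }
set (W := s * Cmod (p z * v + q z * Cconj v)) in *.
assert (PW : 0 <= W) by (apply Rmult_le_pos; [lra | apply Cmod_ge_0]).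
assert (W ^ 2 <= (X - 1) ^ 2) by nra.
assert (W <= X - 1) by nra. nra.
Qed.

End Harmonic.

(** * Inverse branches over convex sets without singular values *)

Definition convex (W : C -> Prop) : Prop :=
  forall u v s, 0 <= s <= 1 -> W u -> W v -> W (u + RtoC s * (v - u))%C.

(** The [e]-neighbourhood of the segment from [b] to [w]. *)
Definition tube (b w : C) (e : R) (u : C) : Prop :=
  exists s, 0 <= s <= 1 /\ Cmod (u - (b + RtoC s * (w - b))) < e.

Lemma convex_tube (b w : C) (e : R) : convex (tube b w e).
Proof.
intros u v s Hs [t1 [T1 H1]] [t2 [T2 H2]].
exists (t1 + s * (t2 - t1)). split. split; nra.
assert (K := Cmod_ball_convex 0 (u - (b + RtoC t1 * (w - b)))
  (v - (b + RtoC t2 * (w - b))) e s Hs).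
assert (E : forall x : C, (x - 0 = x)%C) by (intros; ring). rewrite !E in K.
specialize (K H1 H2).
eapply Rle_lt_trans; [|exact K]. right. f_equal.
rewrite RtoC_plus, RtoC_mult, RtoC_minus. ring.
Qed.

Lemma tube_open (b w : C) (e : R) (u : C) : tube b w e u -> locally u (tube b w e).
Proof.
intros [s [Hs H]]. apply locally_Cmod.
exists (e - Cmod (u - (b + RtoC s * (w - b)))). split. lra.
intros v Hv. exists s. split; auto.
assert (T := Cmod_sub_triangle v u (b + RtoC s * (w - b))). lra.
Qed.

Lemma tube_start (b w : C) (e : R) : 0 < e -> tube b w e b.
Proof.
intros He. exists 0. split. lra.
replace (b - (b + RtoC 0 * (w - b)))%C with (0 : C) by ring. now rewrite Cmod_0.
Qed.

Lemma tube_end (b w : C) (e : R) : 0 < e -> tube b w e w.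
Proof.
intros He. exists 1. split. lra.
replace (w - (b + RtoC 1 * (w - b)))%C with (0 : C) by ring. now rewrite Cmod_0.
Qed.

Lemma tube_le (b w : C) (e e' : R) (u : C) : e <= e' -> tube b w e u -> tube b w e' u.
Proof. intros He [s [Hs H]]. exists s. split; auto. lra. Qed.

(** A point of a tube has a tube of its own inside it. *)
Lemma tube_sub (b w : C) (e : R) (w' : C) : tube b w e w' ->
  exists e', 0 < e' /\ forall u, tube b w' e' u -> tube b w e u.
Proof.
intros [s [Hs H]]. set (c := (b + RtoC s * (w - b))%C) in *.
exists (e - Cmod (w' - c)). split. lra.
intros u [r [Hr Hu]]. exists (r * s). split. split; nra.
assert (T := Cmod_sub_triangle u (b + RtoC r * (w' - b)) (b + RtoC (r * s) * (w - b))).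
replace (b + RtoC r * (w' - b) - (b + RtoC (r * s) * (w - b)))%C
  with (RtoC r * (w' - c))%C in T by (unfold c; rewrite RtoC_mult; ring).
rewrite Cmod_mult, Cmod_R, Rabs_right in T by lra.
assert (Q := Cmod_ge_0 (w' - c)).
assert (r * Cmod (w' - c) <= Cmod (w' - c)) by nra. lra.
Qed.

Lemma line_continuous (b v : C) (t : R) : continuous (fun s : R => b + RtoC s * v)%C t.
Proof. apply (curve_deriv_continuous _ _ _ (curve_deriv_line b v t)). Qed.

Section Branch.

Variables (f f1 : C -> C) (Om : C -> Prop) (z0 : C).
Hypothesis Hf : forall z, wirt f z (f1 z) 0.
Hypothesis Cf1 : forall z, continuous f1 z.
Hypothesis Om_convex : convex Om.
Hypothesis Om_open : forall u, Om u -> locally u Om.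
Hypothesis no_crit : forall z, Om (f z) -> f1 z <> 0%C.
Hypothesis no_asym : forall u, Om u -> ~ finite_asymptotic_value f u.
Hypothesis Om_z0 : Om (f z0).

Let a : C := f z0.

Lemma branch_unique (W : C -> Prop) (g1 g2 : C -> C) (b : C) :
  convex W -> (forall u, W u -> Om u) ->
  (forall u, W u -> f (g1 u) = u /\ continuous g1 u) ->
  (forall u, W u -> f (g2 u) = u /\ continuous g2 u) ->
  W b -> g1 b = g2 b -> forall u, W u -> g1 u = g2 u.
Proof.
intros HW WO H1 H2 Wb Eb u Wu.
set (l := fun s : R => (b + RtoC s * (u - b))%C).
assert (Cl : forall t, continuous l t) by (intros t; apply line_continuous).
assert (Wl : forall t, 0 <= t <= 1 -> W (l t)) by (intros t Ht; now apply HW).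
assert (K : forall t, 0 <= t <= 1 -> g1 (l t) = g2 (l t)).
{ apply real_induction. intros T HT Prev.
  assert (C1 : continuous (fun t => g1 (l t)) T)
    by (apply (continuous_comp l g1); [apply Cl | now apply H1, Wl]).
  assert (C2 : continuous (fun t => g2 (l t)) T)
    by (apply (continuous_comp l g2); [apply Cl | now apply H2, Wl]).
  assert (ET : g1 (l T) = g2 (l T)).
  { destruct (Req_dec T 0) as [->|NT].
    { unfold l. replace (b + RtoC 0 * (u - b))%C with b by ring. exact Eb. }
    apply NNPP. intros N.
    assert (L := continuous_Cneq (fun t => g1 (l t) - g2 (l t))%C T 0
      (continuous_Cminus _ _ _ C1 C2)).
    destruct L as [d Hd].
    { intros E. apply N. replace (g1 (l T)) with (g1 (l T) - g2 (l T) + g2 (l T))%C by ring.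
      rewrite E. ring. }
    assert (Dp := cond_pos d). assert (m1 := Rmin_l d T). assert (m2 := Rmin_r d T).
    assert (m3 : 0 < Rmin d T) by (apply Rmin_glb_lt; lra).
    apply (Hd (T - Rmin d T / 2)).
    - unfold ball; simpl. unfold AbsRing_ball, abs, minus, plus, opp; simpl.
      rewrite Rabs_left; lra.
    - rewrite Prev by lra. ring. }
  set (w := g1 (l T)) in *.
  assert (Nw : f1 w <> 0%C).
  { apply no_crit. unfold w. rewrite (proj1 (H1 _ (Wl T HT))). now apply WO, Wl. }
  destruct (local_branch f f1 w Hf (Cf1 w) Nw) as [r [_ [_ [Hr [_ [_ Inj]]]]]].
  assert (L1 := proj1 (continuous_Cmod_iff _ _) C1 r Hr).
  assert (L2 := proj1 (continuous_Cmod_iff _ _) C2 r Hr).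
  destruct (filter_and _ _ L1 L2) as [d Hd].
  exists d. split. apply cond_pos. intros t Ht Ht1.
  destruct (Hd t) as [A1 A2].
  { unfold ball; simpl. unfold AbsRing_ball, abs, minus, plus, opp; simpl.
    rewrite Rabs_right; lra. }
  fold w in A1. rewrite <- ET in A2.
  apply Inj; auto.
  assert (Ht' : 0 <= t <= 1) by lra.
  now rewrite (proj1 (H1 _ (Wl t Ht'))), (proj1 (H2 _ (Wl t Ht'))). }
specialize (K 1 ltac:(lra)). unfold l in K.
now replace (b + RtoC 1 * (u - b))%C with u in K by ring.
Qed.

(** [g] is an inverse branch of [f] on a tube around the segment from [a] to [w]. *)
Definition tube_branch (w : C) (e : R) (g : C -> C) : Prop :=
  0 < e /\ g a = z0 /\
  forall u, tube a w e u -> Om u /\ f (g u) = u /\ continuous g u.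

(** The branch at [f z0] continues along the segment to [w]. *)
Definition reachable (w : C) : Prop := exists e g, tube_branch w e g.

Lemma tube_branch_value (w : C) (e e' : R) (g g' : C -> C) :
  tube_branch w e g -> tube_branch w e' g' -> g w = g' w.
Proof.
intros [He [Ea H]] [He' [Ea' H']].
assert (m1 := Rmin_l e e'). assert (m2 := Rmin_r e e').
assert (m3 : 0 < Rmin e e') by now apply Rmin_glb_lt.
apply (branch_unique (tube a w (Rmin e e')) g g' a).
- apply convex_tube.
- intros u Hu. apply H. now apply tube_le with (Rmin e e').
- intros u Hu. apply H. now apply tube_le with (Rmin e e').
- intros u Hu. apply H'. now apply tube_le with (Rmin e e').
- now apply tube_start.
- now rewrite Ea, Ea'.
- now apply tube_end.
Qed.

Lemma tube_branch_sub (w w' : C) (e : R) (g : C -> C) :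
  tube_branch w e g -> tube a w e w' -> exists e', tube_branch w' e' g.
Proof.
intros [He [Ea H]] Hw'. destruct (tube_sub _ _ _ _ Hw') as [e' [He' K]].
exists e'. split; [exact He'|split; [exact Ea|]]. intros u Hu. now apply H, K.
Qed.

(** The value at [w] of the branch continued along the segment from [a], with
    the default value [0] when there is no continuation. *)
Definition branch (w : C) : C :=
  match excluded_middle_informative
    (exists v, exists e g, tube_branch w e g /\ g w = v) with
  | left H => proj1_sig (constructive_indefinite_description _ H)
  | right _ => 0%C
  end.

Lemma branch_eq (w : C) (e : R) (g : C -> C) : tube_branch w e g -> branch w = g w.
Proof.
intros H. unfold branch. destruct excluded_middle_informative as [K|K].
- destruct (constructive_indefinite_description _ K) as [v [e' [g' [H' E]]]].
  simpl. rewrite <- E. exact (tube_branch_value w e' e g' g H' H).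
- elim K. exists (g w), e, g. auto.
Qed.

Lemma branch_spec (w : C) : reachable w ->
  f (branch w) = w /\ continuous branch w.
Proof.
intros [e [g H]]. assert (He := proj1 H).
assert (T := tube_end a w e He).
destruct (proj2 (proj2 H) w T) as [_ [E Cg]]. split.
- now rewrite (branch_eq w e g H).
- apply continuous_ext_loc with g; [|exact Cg].
  generalize (tube_open _ _ _ _ T). apply filter_imp. intros u Hu.
  destruct (tube_branch_sub _ _ _ _ H Hu) as [e' H'].
  symmetry. exact (branch_eq u e' g H').
Qed.

Lemma reachable_start : reachable a.
Proof.
destruct (local_branch f f1 z0 Hf (Cf1 z0) (no_crit z0 Om_z0))
  as [r [e [k [Hr [He [Hk Inj]]]]]].
fold a in Hk.
destruct (proj1 (locally_Cmod _ _) (Om_open a Om_z0)) as [d [Hd HO]].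
exists (Rmin e d), k. split; [now apply Rmin_glb_lt|split].
- assert (Z : Cmod (a - a) = 0)
    by (replace (a - a)%C with (0 : C) by ring; apply Cmod_0).
  destruct (Hk a) as [K1 [K2 _]]. lra.
  apply Inj; auto. replace (z0 - z0)%C with (0 : C) by ring. now rewrite Cmod_0.
- intros u [s [_ Hu]]. replace (a + RtoC s * (a - a))%C with a in Hu by ring.
  assert (m1 := Rmin_l e d). assert (m2 := Rmin_r e d).
  split. apply HO; lra. split; apply Hk; lra.
Qed.

(** As the end point is not an asymptotic value, the lift of the half-open
    segment does not tend to infinity; a cluster point lies over the end point. *)
Lemma branch_cluster (w : C) (T : R) : 0 < T <= 1 -> Om w ->
  (forall t, 0 <= t < T -> reachable (a + RtoC t * (w - a))) ->
  exists v, f v = (a + RtoC T * (w - a))%C /\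
    forall d, 0 < d -> exists t, 0 < t < T /\ T - d < t /\
      Cmod (branch (a + RtoC t * (w - a))%C - v) < d.
Proof.
intros HT Ow Prev. set (l := fun t : R => (a + RtoC t * (w - a))%C) in *.
set (lam := fun t => branch (l t)).
assert (Cl : forall t, continuous l t) by (intros t; apply line_continuous).
assert (Clam : forall t, 0 <= t < T -> continuous lam t).
{ intros t Ht. apply (continuous_comp l branch). apply Cl. now apply branch_spec, Prev. }
assert (Flam : forall t, 0 <= t < T -> f (lam t) = l t).
{ intros t Ht. now apply branch_spec, Prev. }
assert (OT : Om (l T)) by (apply Om_convex; auto; lra).
assert (Cluster : exists v, forall d, 0 < d -> exists t, T - d < t < T /\ Cmod (lam t - v) < d).
{ apply NNPP. intros N. apply (no_asym (l T) OT).
  exists (fun t => lam (t * T)). split; [|split].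
  - intros t Ht.
    assert (Ct : continuous (fun t : R => lam (t * T)) t).
    { apply (continuous_comp (fun t => t * T) lam).
      apply (continuous_mult (K := R_AbsRing)). apply continuous_id. apply continuous_const.
      apply Clam. split; nra. }
    intros Q HQ. unfold filtermap, within. generalize (Ct Q HQ). unfold filtermap.
    apply filter_imp. auto.
  - intros Q [M HQ].
    assert (D : exists d, 0 < d /\ forall t, T - d < t < T -> M < Cmod (lam t)).
    { apply NNPP. intros N1. apply N. apply (cluster_point lam T M).
      intros d Hd. apply NNPP. intros N2. apply N1. exists d. split; auto.
      intros t Ht. apply Rnot_le_lt. intros L. apply N2. exists t. auto. }
    destruct D as [d [Hd K]].
    assert (Hd' : 0 < d / T) by (apply Rdiv_lt_0_compat; lra).
    exists (mkposreal _ Hd'). intros t Ht Ht1. apply HQ, K.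
    unfold ball in Ht; simpl in Ht. unfold AbsRing_ball, abs, minus, plus, opp in Ht; simpl in Ht.
    rewrite Rabs_left in Ht by lra.
    assert (X : (1 - t) * T < d).
    { apply Rlt_le_trans with (d / T * T). apply Rmult_lt_compat_r; lra.
      right; field; lra. }
    nra.
  - apply (filterlim_ext_loc (fun t => l (t * T))).
    { exists (mkposreal 1 Rlt_0_1). intros t Ht Ht1.
      unfold ball in Ht; simpl in Ht. unfold AbsRing_ball, abs, minus, plus, opp in Ht; simpl in Ht.
      rewrite Rabs_left in Ht by lra. symmetry. apply Flam. split; nra. }
    assert (Ct : continuous (fun t : R => l (t * T)) 1).
    { apply (continuous_comp (fun t => t * T) l).
      apply (continuous_mult (K := R_AbsRing)). apply continuous_id. apply continuous_const.
      apply Cl. }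
    intros Q HQ. replace (l T) with (l (1 * T)) in HQ by now rewrite Rmult_1_l.
    unfold filtermap, at_left, within. generalize (Ct Q HQ). unfold filtermap.
    apply filter_imp. auto. }
destruct Cluster as [v Hv].
assert (Hv' : forall d, 0 < d -> exists t, 0 < t < T /\ T - d < t /\ Cmod (lam t - v) < d).
{ intros d Hd. assert (m1 := Rmin_l d T). assert (m2 := Rmin_r d T).
  assert (m3 : 0 < Rmin d T) by (apply Rmin_glb_lt; lra).
  destruct (Hv (Rmin d T) m3) as [t [Ht Kt]]. exists t. repeat split; lra. }
exists v. split; [|exact Hv'].
apply NNPP. intros N.
assert (Pd : 0 < Cmod (f v - l T)).
{ apply Cmod_gt_0. intros E. apply N.
  replace (f v) with (f v - l T + l T)%C by ring. rewrite E. unfold l; ring. }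
set (e := Cmod (f v - l T) / 2).
assert (He : 0 < e) by (unfold e; lra).
destruct (proj1 (locally_Cmod _ _) (proj1 (continuous_Cmod_iff f v)
  (wirt_continuous _ _ _ _ (Hf v)) e He)) as [d1 [Hd1 K1]].
destruct (proj1 (continuous_Cmod_iff l T) (Cl T) e He) as [d2 K2].
assert (Hd2 := cond_pos d2). assert (m1 := Rmin_l d1 d2). assert (m2 := Rmin_r d1 d2).
destruct (Hv' (Rmin d1 d2)) as [t [Ht [Ht2 Kt]]]. now apply Rmin_glb_lt.
specialize (K1 (lam t) ltac:(lra)). rewrite Flam in K1 by lra.
assert (B : ball T d2 t).
{ unfold ball; simpl. unfold AbsRing_ball, abs, minus, plus, opp; simpl.
  rewrite Rabs_left; lra. }
specialize (K2 t B).
assert (Tr := Cmod_sub_triangle (f v) (l t) (l T)).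
rewrite (Cmod_sub_sym (f v) (l t)) in Tr. unfold e in *. lra.
Qed.

(** The branch extends to the end of a half-open segment. *)
Lemma reachable_closed (w : C) (T : R) : 0 < T <= 1 -> Om w ->
  (forall t, 0 <= t < T -> reachable (a + RtoC t * (w - a))) ->
  reachable (a + RtoC T * (w - a)).
Proof.
intros HT Ow Prev.
destruct (branch_cluster w T HT Ow Prev) as [v [Fv Hv]].
set (l := fun t : R => (a + RtoC t * (w - a))%C) in *.
fold (l T). fold (l T) in Fv.
assert (OT : Om (l T)) by (apply Om_convex; auto; lra).
assert (Nv : f1 v <> 0%C) by (apply no_crit; now rewrite Fv).
destruct (local_branch f f1 v Hf (Cf1 v) Nv) as [r [e1 [k [Hr [He1 [Hk Inj]]]]]].
rewrite Fv in Hk.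
destruct (proj1 (locally_Cmod _ _) (Om_open _ OT)) as [e2 [He2 HO]].
set (e0 := Rmin e1 e2).
assert (He0 : 0 < e0) by now apply Rmin_glb_lt.
assert (m1 : e0 <= e1) by apply Rmin_l. assert (m2 : e0 <= e2) by apply Rmin_r.
destruct (proj1 (continuous_Cmod_iff l T) (line_continuous _ _ T) (e0 / 2) ltac:(lra))
  as [d2 K2].
assert (Hd2 := cond_pos d2). assert (m3 := Rmin_l r d2). assert (m4 := Rmin_r r d2).
destruct (Hv (Rmin r d2)) as [t [Ht [Ht2 Kt]]]. now apply Rmin_glb_lt.
assert (B : ball T d2 t).
{ unfold ball; simpl. unfold AbsRing_ball, abs, minus, plus, opp; simpl.
  rewrite Rabs_left; lra. }
specialize (K2 t B).
destruct (Prev t ltac:(lra)) as [e [g H]].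
assert (Pt := Prev t ltac:(lra)). fold (l t) in H, Kt, Pt.
destruct (branch_spec _ Pt) as [Fb _].
rewrite (branch_eq _ _ _ H) in Kt, Fb.
assert (Ek : g (l t) = k (l t)).
{ destruct (Hk (l t)) as [A1 [A2 _]]. lra.
  apply Inj; [lra | exact A1 | now rewrite A2]. }
destruct H as [He [Ea H]].
assert (Agree : forall u, tube a (l t) e u /\ Cmod (u - l T) < e0 -> g u = k u).
{ apply branch_unique with (b := l t).
  - intros u1 u2 s Hs [X1 X2] [Y1 Y2]. split. now apply convex_tube.
    now apply Cmod_ball_convex.
  - intros u [X _]. now apply H.
  - intros u [X _]. now apply H.
  - intros u [_ X]. apply Hk. lra.
  - split. now apply tube_end. lra.
  - exact Ek. }
(* the branches [g] and [k] are glued along the overlap of the tube and the disc *)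
set (g3 := fun u => if excluded_middle_informative (tube a (l t) e u) then g u else k u).
assert (G1 : forall u, tube a (l t) e u -> g3 u = g u).
{ intros u Hu. unfold g3. destruct excluded_middle_informative; tauto. }
assert (G2 : forall u, Cmod (u - l T) < e0 -> g3 u = k u).
{ intros u Hu. unfold g3. destruct excluded_middle_informative; auto. }
exists (Rmin e (e0 / 2)), g3. split; [apply Rmin_glb_lt; lra|split].
- rewrite G1; auto. now apply tube_start.
- assert (n1 := Rmin_l e (e0 / 2)). assert (n2 := Rmin_r e (e0 / 2)).
  intros u [s [Hs Hu]].
  replace (a + RtoC s * (l T - a))%C with (l (s * T)) in Hu
    by (unfold l; rewrite RtoC_mult; ring).
  destruct (Rle_lt_dec (s * T) t) as [L|L].
  + assert (Tu : tube a (l t) e u).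
    { exists (s * T / t). split.
      - split. apply Rdiv_le_0_compat; nra. apply Rle_div_l; lra.
      - replace (a + RtoC (s * T / t) * (l t - a))%C with (l (s * T)). lra.
        unfold l. rewrite RtoC_div by lra. field. intros E.
        apply (f_equal Re) in E. simpl in E. lra. }
    destruct (H u Tu) as [X1 [X2 X3]]. split; [exact X1|]. rewrite G1 by exact Tu.
    split; [exact X2|]. apply continuous_ext_loc with g; [|exact X3].
    generalize (tube_open _ _ _ _ Tu). apply filter_imp. intros u' Hu'.
    symmetry. now apply G1.
  + assert (Bu : Cmod (u - l T) < e0).
    { assert (Tr := Cmod_sub_triangle u (l (s * T)) (l T)).
      assert (Cmod (l (s * T)%R - l T) <= Cmod (l t - l T)).
      { replace (l (s * T)%R - l T)%C with (RtoC (s * T - T) * (w - a))%C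
          by (unfold l; rewrite RtoC_minus; ring).
        replace (l t - l T)%C with (RtoC (t - T) * (w - a))%C
          by (unfold l; rewrite RtoC_minus; ring).
        rewrite !Cmod_mult, !Cmod_R. apply Rmult_le_compat_r. apply Cmod_ge_0.
        assert (s * T <= T) by nra.
        rewrite (Rabs_left (t - T)) by lra. rewrite Rabs_left1; lra. }
      lra. }
    split; [apply HO; lra|]. rewrite G2 by exact Bu.
    destruct (Hk u ltac:(lra)) as [_ [X2 X3]]. split; [exact X2|].
    apply continuous_ext_loc with k; [|exact X3].
    apply locally_Cmod. exists (e0 - Cmod (u - l T)). split. lra.
    intros u' Hu'. symmetry. apply G2.
    assert (Tr := Cmod_sub_triangle u' u (l T)). lra.
Qed.

Lemma reachable_all (w : C) : Om w -> reachable w.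
Proof.
intros Ow.
assert (K : forall t, 0 <= t <= 1 -> reachable (a + RtoC t * (w - a))).
{ apply real_induction. intros T HT Prev.
  assert (RT : reachable (a + RtoC T * (w - a))).
  { destruct (Req_dec T 0) as [->|NT].
    - replace (a + RtoC 0 * (w - a))%C with a by ring. apply reachable_start.
    - apply reachable_closed; auto. lra. }
  destruct RT as [e [g H]].
  destruct (proj1 (continuous_Cmod_iff _ _) (line_continuous a (w - a) T) e (proj1 H))
    as [d Hd].
  exists d. split. apply cond_pos. intros t Ht Ht1.
  destruct (tube_branch_sub _ (a + RtoC t * (w - a)) _ _ H) as [e' H'].
  - exists 1. split. lra.
    replace (a + RtoC 1 * (a + RtoC T * (w - a) - a))%C with (a + RtoC T * (w - a))%C by ring.
    apply Hd. unfold ball; simpl. unfold AbsRing_ball, abs, minus, plus, opp; simpl.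
    rewrite Rabs_right; lra.
  - exists e', g. exact H'. }
specialize (K 1 ltac:(lra)). now replace (a + RtoC 1 * (w - a))%C with w in K by ring.
Qed.

End Branch.

(** Over a convex open set that contains neither critical values nor asymptotic
    values, a local inverse of [f] continues to a global one. *)
Lemma inverse_branch (f f1 : C -> C) (Om : C -> Prop) (z0 : C) :
  (forall z, wirt f z (f1 z) 0) -> (forall z, continuous f1 z) ->
  convex Om -> (forall u, Om u -> locally u Om) ->
  (forall z, Om (f z) -> f1 z <> 0%C) ->
  (forall u, Om u -> ~ finite_asymptotic_value f u) ->
  Om (f z0) ->
  exists g, forall u, Om u -> f (g u) = u /\ continuous g u.
Proof.
intros Hf Cf1 Oc Oo Nc Na O0. exists (branch f Om z0). intros u Hu.
apply (branch_spec f f1 Om z0 Hf Cf1 Nc).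
now apply (reachable_all f f1 Om z0 Hf Cf1 Oc Oo Nc Na O0).
Qed.

(** * Holomorphy of the Hopf differential and of its square root *)

Lemma wirt_sqrt (F : C -> C) (z p q : C) :
  wirt (fun w => F w * F w)%C z p q -> continuous F z -> F z <> 0%C ->
  wirt F z (p / (2 * F z)) (q / (2 * F z)).
Proof.
intros [P [Q [HP [HQ [<- [<- H]]]]]] CF N.
assert (CS : continuous (fun w => F w + F z)%C z)
  by (apply continuous_Cplus; [exact CF | apply continuous_const]).
assert (E2 : (F z + F z = 2 * F z)%C) by ring.
assert (N2 : (F z + F z <> 0)%C).
{ rewrite E2. apply Cmult_neq_0; auto. intros E. apply (f_equal Re) in E.
  simpl in E. lra. }
exists (fun w => P w / (F w + F z))%C, (fun w => Q w / (F w + F z))%C.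
rewrite <- E2. repeat split; try now apply continuous_Cdiv.
generalize (filter_and _ _ H (continuous_Cneq _ _ 0%C CS N2)).
apply filter_imp. intros w [E Nw].
transitivity (F z + (F w * F w - F z * F z) / (F w + F z))%C. Cfield. exact Nw.
rewrite E. Cfield. exact Nw.
Qed.

(** The Hopf differential of a harmonic map is holomorphic. *)
Lemma hopf_holomorphic (h f1 : C -> C) (z : C) :
  smooth h -> (forall z, Cmod (h z) < 1) ->
  (forall z, (wirtinger_bar (wirtinger h) z
   + 2 * wirtinger log_sigma (h z) * wirtinger h z * wirtinger_bar h z = 0)%C) ->
  (forall z, hopf h z = (f1 z * f1 z)%C) ->
  exists l, wirt (fun w => f1 w * f1 w)%C z l 0.
Proof.
intros Hs Hd Hh Hhopf.
assert (N : forall w, conf_den h w <> 0%C) by (intros w; now apply conf_den_neq0).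
assert (NN : (conf_den h z * conf_den h z <> 0)%C) by now apply Cmult_neq_0.
assert (H := wirt_h h Hs z). assert (Hc := wirt_conj _ _ _ _ H).
assert (HD := wirt_minus _ _ _ _ _ _ _ (wirt_const 1 z) (wirt_mult _ _ _ _ _ _ _ H Hc)).
change (wirt (conf_den h) z (0 - (wirtinger h z * Cconj (h z) + h z * Cconj (wirtinger_bar h z)))
  (0 - (wirtinger_bar h z * Cconj (h z) + h z * Cconj (wirtinger h z)))) in HD.
assert (Hp := p_wirt h Hs Hd Hh z).
assert (Hq := wirt_conj _ _ _ _ (q_wirt h Hs Hd Hh z)).
assert (K := wirt_div _ _ _ _ _ _ _
  (wirt_scal 4 _ _ _ _ (wirt_mult _ _ _ _ _ _ _ Hp Hq))
  (wirt_mult _ _ _ _ _ _ _ HD HD) NN).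
eexists. eapply wirt_ext_loc; [|eapply wirt_eq; [exact K | reflexivity |]].
- apply filter_forall. intros w. cbv beta.
  rewrite (hopf_conj h f1 Hs Hhopf w).
  replace (RtoC (Defs.sigma (h w) ^ 2)) with (4 / (conf_den h w * conf_den h w))%C.
  Cfield. apply N.
  assert (P := conf_den_pos h Hd w).
  rewrite conf_den_real. rewrite <- RtoC_mult, <- RtoC_div.
  f_equal. unfold Defs.sigma. field. simpl in P |- *; lra.
  apply Rmult_integral_contrapositive_currified; lra.
- unfold h_zzb, kap.
  assert (Dr : Cconj (conf_den h z) = conf_den h z)
    by (rewrite conf_den_real; apply Cconj_RtoC).
  repeat rewrite ?Cmult_conj, ?Copp_conj, ?Cconj_RtoC.
  rewrite Cdiv_conj by apply N. rewrite Dr, Cconj_conj.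
  Cfield. apply N.
Qed.

(** When the [zbar]-coefficient vanishes, it can be absorbed in the other one. *)
Lemma wirt_holomorphic (F : C -> C) (z l : C) : wirt F z l 0 ->
  exists P : C -> C, continuous P z /\ P z = l /\
    locally z (fun w => F w = F z + P w * (w - z))%C.
Proof.
intros [P [Q [HP [HQ [Pz [Qz H]]]]]].
exists (fun w => P w + Q w * (Cconj (w - z) / (w - z)))%C.
split; [|split].
- apply continuous_Cplus; auto.
  apply continuous_Cmod_iff. intros e He. rewrite Qz.
  generalize (proj1 (continuous_Cmod_iff Q z) HQ e He). apply filter_imp.
  intros w Hw. rewrite Qz in Hw.
  replace (Q w - 0)%C with (Q w) in Hw by Cring.
  replace (Q w * (Cconj (w - z) / (w - z)) - 0 * (Cconj (z - z) / (z - z)))%C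
    with (Q w * (Cconj (w - z) / (w - z)))%C by Cring.
  destruct (Ceq_dec w z) as [->|N].
  + replace (Cconj (z - z)) with (0 : C).
    replace (Q z * (0 / (z - z)))%C with (0 : C) by (unfold Cdiv; Cring).
    now rewrite Cmod_0.
    replace (z - z)%C with (0 : C) by ring. symmetry; apply Cconj_RtoC.
  + assert (N' : (w - z <> 0)%C).
    { intros Z. apply N. replace w with (w - z + z)%C by ring. rewrite Z. Cring. }
    rewrite Cmod_mult, Cmod_div, Cmod_conj by exact N'.
    apply Cmod_gt_0 in N'. unfold Rdiv. rewrite Rinv_r, Rmult_1_r by lra. exact Hw.
- cbv beta. rewrite Qz, Pz. Cring.
- revert H. apply filter_imp. intros w E.
  destruct (Ceq_dec w z) as [->|N]. Cring.
  assert (N' : (w - z <> 0)%C).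
  { intros Z. apply N. replace w with (w - z + z)%C by ring. rewrite Z. Cring. }
  rewrite E. Cfield. exact N'.
Qed.

Lemma wirt_inverse (f f1 g : C -> C) (u : C) :
  wirt f (g u) (f1 (g u)) 0 -> f1 (g u) <> 0%C -> continuous g u ->
  locally u (fun w => f (g w) = w) -> wirt g u (/ f1 (g u)) 0.
Proof.
intros Hf N Cg Hg. destruct (wirt_holomorphic _ _ _ Hf) as [P [CP [EP H]]].
assert (CPg : continuous (fun w => P (g w)) u) by now apply (continuous_comp g P).
assert (Nu : P (g u) <> 0%C) by now rewrite EP.
exists (fun w => / P (g w))%C, (fun _ => 0%C).
repeat split.
- now apply continuous_Cinv.
- apply continuous_const.
- now rewrite EP.
- apply Cg in H. unfold filtermap in H.
  assert (Eu := locally_singleton _ _ Hg).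
  generalize (filter_and _ _ (filter_and _ _ H Hg) (continuous_Cneq _ _ 0%C CPg Nu)).
  apply filter_imp. intros w [[E1 E2] E3].
  rewrite E2, Eu in E1.
  replace (w - u)%C with (P (g w) * (g w - g u))%C.
  Cfield. exact E3. rewrite E1 at 3. Cring.
Qed.

(** * Cones in the sector *)

(** The translate of a cone around the positive imaginary axis with apex [i r]. *)
Definition cone (k r : R) (u : C) : Prop := Rabs (Re u) < k * (Im u - r).

Lemma convex_cone (k r : R) : convex (cone k r).
Proof.
intros u v s Hs Hu Hv. unfold cone in *.
replace (Re (u + RtoC s * (v - u))) with ((1 - s) * Re u + s * Re v) by (unfold Re; simpl; ring).
replace (Im (u + RtoC s * (v - u))) with ((1 - s) * Im u + s * Im v)
  by (unfold Re, Im; simpl; ring).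
apply Rabs_def2 in Hu. apply Rabs_def2 in Hv.
assert (Comb : forall x y, 0 < x -> 0 < y -> 0 < (1 - s) * x + s * y).
{ intros x y Hx Hy. destruct (Req_dec s 0) as [->|N]. lra.
  assert (0 < s * y) by (apply Rmult_lt_0_compat; lra).
  assert (0 <= (1 - s) * x) by (apply Rmult_le_pos; lra). lra. }
apply Rabs_def1.
- assert (C1 := Comb (k * (Im u - r) - Re u) (k * (Im v - r) - Re v) ltac:(lra) ltac:(lra)).
  lra.
- assert (C1 := Comb (k * (Im u - r) + Re u) (k * (Im v - r) + Re v) ltac:(lra) ltac:(lra)).
  lra.
Qed.

Lemma cone_open (k r : R) (u : C) : cone k r u -> locally u (cone k r).
Proof.
intros H. unfold cone in *.
assert (K : continuous (fun u : C => k * (Im u - r) - Rabs (Re u)) u).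
{ apply (continuous_minus (V := R_NormedModule) (fun u : C => k * (Im u - r))).
  - apply (continuous_scal_r (V := R_NormedModule) k (fun u : C => Im u - r)).
    apply (continuous_minus (V := R_NormedModule)). apply continuous_snd.
    apply continuous_const.
  - apply (continuous_comp (fun u : C => Re u) Rabs). apply continuous_fst.
    apply continuous_Rabs. }
assert (L : locally u (fun w : C => 0 < k * (Im w - r) - Rabs (Re w))).
{ apply (K (fun x => 0 < x)). apply open_gt. lra. }
revert L. apply filter_imp. intros w Hw. lra.
Qed.

(** The disc of radius [k / (1 + k) * t] about [b + i t] lies in the cone
    if [b] does. *)
Lemma cone_disc (k r t : R) (b u : C) : 0 < k -> cone k r b ->
  Cmod (u - (b + RtoC t * Ci)) <= k / (1 + k) * t -> cone k r u.
Proof.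
intros Hk Hb Hu. unfold cone in *.
assert (A1 := re_le_Cmod (u - (b + RtoC t * Ci))).
assert (A2 := im_le_Cmod (u - (b + RtoC t * Ci))).
replace (Re (u - (b + RtoC t * Ci))) with (Re u - Re b) in A1 by (unfold Re; simpl; ring).
replace (Im (u - (b + RtoC t * Ci))) with (Im u - Im b - t) in A2
  by (unfold Im; simpl; ring).
set (rho := k / (1 + k) * t) in *.
assert (E : rho * (1 + k) = k * t) by (unfold rho; field; lra).
assert (A3 := Rle_trans _ _ _ A1 Hu). assert (A4 := Rle_trans _ _ _ A2 Hu).
apply Rabs_le_between in A3. apply Rabs_le_between in A4.
apply Rabs_def2 in Hb. apply Rabs_def1; nra.
Qed.

Lemma cone_sector (delta r : R) : 0 < delta -> 0 < r ->
  exists k, 0 < k /\ forall u, cone k r u -> sector delta r u.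
Proof.
intros Hd Hr. set (d := Rmin delta 1).
assert (d1 : d <= delta) by apply Rmin_l. assert (d2 : d <= 1) by apply Rmin_r.
assert (d0 : 0 < d) by (apply Rmin_glb_lt; lra).
assert (P := PI2_1).
exists (tan d). split. apply tan_gt_0; lra.
intros u Hu. unfold cone in Hu.
assert (T0 : 0 < tan d) by (apply tan_gt_0; lra).
assert (Im0 : 0 < Im u - r).
{ assert (Q := Rabs_pos (Re u)). apply Rnot_le_lt. intros L. nra. }
set (x := Re u / Im u).
assert (Hx : Rabs x < tan d).
{ unfold x, Rdiv. rewrite Rabs_mult, Rabs_inv, (Rabs_right (Im u)) by lra.
  apply Rlt_div_l. lra. nra. }
apply Rabs_def2 in Hx.
assert (Ad : atan (tan d) = d) by (apply atan_tan; lra).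
assert (B1 : atan x < d) by (rewrite <- Ad; apply atan_increasing; lra).
assert (B2 : - d < atan x)
  by (rewrite <- Ad, <- atan_opp; apply atan_increasing; lra).
split.
- assert (Q := im_le_Cmod u). assert (Q2 := Rle_abs (Im u)). lra.
- exists (PI / 2 - atan x). split. lra.
  rewrite cos_shift, sin_shift, sin_atan, cos_atan.
  (* [|u| = Im u * sqrt (1 + x^2)] *)
  assert (S0 : 0 < sqrt (1 + Rsqr x))
    by (apply sqrt_lt_R0; assert (Q := Rle_0_sqr x); lra).
  assert (E : Cmod u = Im u * sqrt (1 + Rsqr x)).
  { unfold Cmod. change (fst u) with (Re u). change (snd u) with (Im u).
    apply sqrt_lem_1.
    - assert (Q1 := pow2_ge_0 (Re u)). assert (Q2 := pow2_ge_0 (Im u)). lra.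
    - apply Rmult_le_pos; lra.
    - replace (Im u * sqrt (1 + Rsqr x) * (Im u * sqrt (1 + Rsqr x)))
        with (Im u ^ 2 * (sqrt (1 + Rsqr x) * sqrt (1 + Rsqr x))) by ring.
      rewrite sqrt_def by (assert (Q := Rle_0_sqr x); lra).
      unfold Rsqr, x. field. lra. }
  rewrite E. apply injective_projections; simpl.
  + change (fst u) with (Re u). unfold x at 2. field. split; lra.
  + change (snd u) with (Im u). field. lra.
Qed.

(** * Non-surjectivity *)

Lemma continuous_of_smooth_on (U : C -> Prop) (g : C -> C) (w : C) :
  smooth_on U g -> U w -> continuous g w.
Proof.
intros H Hw. destruct w as [x y]. destruct (H 0%nat x y Hw) as [[H1 _] [H2 _]].
apply continuity_2d_pt_filterlim in H1, H2.
apply continuous_C_parts. split.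
- apply (continuous_ext (fun z : R * R => Re (g (fst z, snd z)))).
  intros [a b]; reflexivity. exact H1.
- apply (continuous_ext (fun z : R * R => Im (g (fst z, snd z)))).
  intros [a b]; reflexivity. exact H2.
Qed.

(** An entire function whose values avoid a non-empty open set is constant. *)
Lemma liouville_omit (f f1 : C -> C) (Om : C -> Prop) (c : C) :
  (forall z, wirt f z (f1 z) 0) -> (forall z, continuous f1 z) ->
  Om c -> (forall u, Om u -> locally u Om) -> (forall z, ~ Om (f z)) ->
  forall z, f1 z = 0%C.
Proof.
intros Hf Cf1 Oc Oo N.
destruct (proj1 (locally_Cmod _ _) (Oo c Oc)) as [d [Hd K]].
assert (Far : forall z, d <= Cmod (f z - c)).
{ intros z. apply Rnot_lt_le. intros L. apply (N z), K, L. }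
assert (Nz : forall z, (f z - c <> 0)%C).
{ intros z E. specialize (Far z). rewrite E, Cmod_0 in Far. lra. }
assert (Hfc : forall z, wirt (fun w => f w - c)%C z (f1 z) 0).
{ intros z. eapply wirt_eq. apply wirt_minus. apply Hf. apply wirt_const. ring. ring. }
assert (L := liouville (fun z => / (f z - c))%C
  (fun z => - f1 z / ((f z - c) * (f z - c)))%C (/ d)).
intros z. specialize (L ltac:(intros w; eapply wirt_eq;
  [apply (wirt_inv _ _ _ _ (Hfc w) (Nz w)) | reflexivity | Cfield; apply Nz])).
assert (E : (- f1 z / ((f z - c) * (f z - c)) = 0)%C).
{ apply L.
  - intros w. apply continuous_Cdiv. now apply continuous_Copp.
    + assert (Cw := wirt_continuous _ _ _ _ (Hfc w)). now apply continuous_Cmult.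
    + apply Cmult_neq_0; apply Nz.
  - intros w. rewrite Cmod_inv by apply Nz. apply Rinv_le_contravar; auto. }
replace (f1 z) with (- ((- f1 z / ((f z - c) * (f z - c))) * ((f z - c) * (f z - c))))%C
  by (field; apply Nz).
rewrite E. ring.
Qed.

(** A curve in the unit disc whose hyperbolic speed is at most [A / t^2] keeps
    away from the unit circle. *)
Lemma hyperbolic_curve_bounded (w V : R -> C) (A : R) : 0 <= A ->
  (forall t, 1 <= t -> Cmod (w t) < 1) ->
  (forall t, 1 <= t -> curve_deriv w t (V t)) ->
  (forall t, 1 <= t -> Defs.sigma (w t) * Cmod (V t) <= A / t ^ 2) ->
  exists m, 0 < m /\ forall t, 1 <= t -> m <= 1 - Cmod (w t) ^ 2.
Proof.
intros HA Hw HV HA2.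
set (D := fun t => 1 - Cmod (w t) ^ 2).
assert (PD : forall t, 1 <= t -> 0 < D t).
{ intros t Ht. unfold D. assert (X := Hw t Ht). assert (Y := Cmod_ge_0 (w t)). nra. }
set (dD := fun t => - (2 * (Re (w t) * Re (V t) + Im (w t) * Im (V t)))).
assert (HD : forall t, 1 <= t -> is_derive D t (dD t)).
{ intros t Ht. destruct (HV t Ht) as [X1 X2].
  apply (is_derive_ext (fun s => 1 - (Re (w s) * Re (w s) + Im (w s) * Im (w s)))).
  { intros s. unfold D. rewrite Cmod2_alt.
    match goal with |- @eq _ ?a ?b => change (@eq R a b) end. ring. }
  unfold dD.
  replace (- (2 * (Re (w t) * Re (V t) + Im (w t) * Im (V t)))) with
   (0 - ((Re (V t) * Re (w t) + Re (w t) * Re (V t))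
       + (Im (V t) * Im (w t) + Im (w t) * Im (V t)))) by ring.
  apply (is_derive_minus (V := R_NormedModule) (fun _ => 1)). apply (is_derive_const (V := R_NormedModule)).
  apply (is_derive_plus (V := R_NormedModule) (fun s => Re (w s) * Re (w s))).
  - apply (is_derive_mult (fun s => Re (w s)) (fun s => Re (w s))); auto.
    intros; apply Rmult_comm.
  - apply (is_derive_mult (fun s => Im (w s)) (fun s => Im (w s))); auto.
    intros; apply Rmult_comm. }
(* [E' >= 0] for [E = ln (1 - |w|^2) - A / t] *)
set (E := fun t => ln (D t) - A / t).
assert (HE : forall t, 1 <= t -> is_derive E t (dD t / D t + A / t ^ 2)).
{ intros t Ht. specialize (PD t Ht).
  replace (dD t / D t + A / t ^ 2) with (dD t * / D t - (- (A / t ^ 2))) by (field; lra).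
  apply (is_derive_minus (V := R_NormedModule) (fun s => ln (D s))).
  - apply (is_derive_comp ln D). now apply is_derive_ln. now apply HD.
  - auto_derive. lra. field. lra. }
assert (HE0 : forall t, 1 <= t -> 0 <= dD t / D t + A / t ^ 2).
{ intros t Ht. assert (B := HA2 t Ht). assert (P := PD t Ht).
  assert (Es : Defs.sigma (w t) = 2 / D t) by reflexivity. rewrite Es in B.
  assert (CS : Rabs (dD t) <= 2 * Cmod (V t)).
  { unfold dD. rewrite Rabs_Ropp, Rabs_mult, Rabs_right by lra.
    apply Rmult_le_compat_l. lra.
    replace (Re (w t) * Re (V t) + Im (w t) * Im (V t)) with (Re (Cconj (w t) * V t)%C)
      by (unfold Re, Im; simpl; ring).
    eapply Rle_trans. apply re_le_Cmod. rewrite Cmod_mult, Cmod_conj.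
    assert (X := Hw t Ht). assert (Y := Cmod_ge_0 (V t)). nra. }
  assert (- (2 * Cmod (V t)) / D t <= dD t / D t).
  { apply Rmult_le_compat_r. now apply Rlt_le, Rinv_0_lt_compat.
    apply Rabs_le_between in CS. lra. }
  replace (- (2 * Cmod (V t)) / D t) with (- (2 / D t * Cmod (V t))) in H by (field; lra).
  lra. }
exists (exp (ln (D 1) - A)). split. apply exp_pos.
intros t Ht. fold (D t). rewrite <- (exp_ln (D t)) by auto.
assert (Inc : E 1 <= E t).
{ destruct (MVT_gen E 1 t (fun t => dD t / D t + A / t ^ 2)) as [c [Hc X]].
  - intros x Hx. rewrite Rmin_left, Rmax_right in Hx by lra. apply HE; lra.
  - intros x Hx. rewrite Rmin_left, Rmax_right in Hx by lra.
    apply continuity_pt_filterlim. apply (ex_derive_continuous (V := R_NormedModule)).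
    eexists. apply HE; lra.
  - rewrite Rmin_left, Rmax_right in Hc by lra.
    assert (Y := HE0 c ltac:(lra)).
    assert (0 <= (dD c / D c + A / c ^ 2) * (t - 1)) by (apply Rmult_le_pos; lra). lra. }
assert (At : 0 <= A / t) by (apply Rdiv_le_0_compat; lra).
unfold E in Inc. rewrite Rdiv_1_r in Inc.
destruct (Rle_lt_or_eq_dec (ln (D 1) - A) (ln (D t)) ltac:(lra)) as [L|L].
- left. now apply exp_increasing.
- right. now rewrite L.
Qed.

Theorem theorem1p3
  (f : C -> C) (f_entire : entire f)
  (delta r : R) (delta_pos : 0 < delta) (r_pos : 0 < r)
  (no_asymptotic : forall a : C, sector delta r a -> ~ finite_asymptotic_value f a)
  (no_critical : forall z : C, sector delta r (f z) -> C_derive f z <> RtoC 0)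
  (h : C -> C)
  (h_harmonic : harmonic_diffeo h)
  (h_orientation : orientation_preserving h)
  (h_hopf : forall z : C, hopf h z = Cpow (C_derive f z) 2) :
  ~ onto_hyp_plane h.
Proof.
intros onto.
destruct h_harmonic as [[h_disc [h_smooth0 h_eq]] [_ [_ [G [Gh G_smooth]]]]].
assert (h_smooth := smooth_on_smooth h h_smooth0).
set (f1 := C_derive f).
assert (Hf : forall z, wirt f z (f1 z) 0).
{ intros z. apply wirt_of_is_derive. apply C_derive_correct. exact z. apply f_entire. }
assert (Hhopf : forall z, hopf h z = (f1 z * f1 z)%C).
{ intros z. rewrite h_hopf. simpl. fold (f1 z). ring. }
assert (Hphi : forall z, exists l, wirt (fun w => f1 w * f1 w)%C z l 0)
  by (intros z; now apply (hopf_holomorphic h)).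
assert (Cf1 : forall z, continuous f1 z).
{ intros z. apply (derivative_continuous_of_square f); auto.
  destruct (Hphi z) as [l Hl]. exact (wirt_continuous _ _ _ _ Hl). }
assert (Hf1 : forall z, f1 z <> 0%C -> wirt f1 z (wirtinger f1 z) 0).
{ intros z N. destruct (Hphi z) as [l Hl].
  assert (K := wirt_sqrt f1 z l 0 Hl (Cf1 z) N).
  rewrite (proj1 (wirt_unique _ _ _ _ K)). eapply wirt_eq. exact K. reflexivity.
  unfold Cdiv; ring. }
assert (Nq := fun z => q_neq0 h f1 h_smooth Hhopf z).
assert (Ppq := p_gt_q h h_orientation).
destruct (cone_sector delta r delta_pos r_pos) as [k [Hk Sec]].
set (Om := cone k r) in *.
assert (Oo : forall u, Om u -> locally u Om) by (intros; now apply cone_open).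
assert (Hit : exists z0, Om (f z0)).
{ apply NNPP. intros N.
  assert (Oc : Om (0, r + 1)).
  { unfold Om, cone, Re, Im; simpl. rewrite Rabs_R0. nra. }
  assert (F0 : forall z, f1 z = 0%C).
  { apply (liouville_omit f f1 Om (0, r + 1)); auto. intros z Hz. apply N. now exists z. }
  (* then the Hopf differential vanishes and [h] is holomorphic and bounded *)
  assert (Q0 : forall z, wirtinger_bar h z = 0%C).
  { intros z. assert (H := hopf_mod h f1 h_smooth Hhopf z).
    rewrite F0, Cmod_0 in H. specialize (Ppq z).
    assert (S0 := sigma_pos h h_disc z). assert (S2 : 0 < Defs.sigma (h z) ^ 2) by now apply pow_lt.
    assert (C0 := Cmod_ge_0 (wirtinger_bar h z)). apply Cmod_eq_0.
    assert (X : Cmod (wirtinger h z) * Cmod (wirtinger_bar h z) = 0) by nra.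
    apply Rmult_integral in X. lra. }
  assert (P0 : wirtinger h 0 = 0%C).
  { apply (liouville h (wirtinger h) 1).
    - intros z. rewrite <- (Q0 z). now apply smooth_wirt.
    - intros z. apply (wirt_continuous _ _ _ _ (p_wirt h h_smooth h_disc h_eq z)).
    - intros z. apply Rlt_le, h_disc. }
  specialize (Ppq 0%C). rewrite P0, Q0 in Ppq. lra. }
destruct Hit as [z0 O0].
destruct (inverse_branch f f1 Om z0 Hf Cf1 (convex_cone k r) Oo
  (fun z Hz => no_critical z (Sec _ Hz)) (fun u Hu => no_asymptotic u (Sec _ Hu)) O0)
  as [g Hg].
set (a := f z0) in *.
set (kappa := k / (1 + k)).
assert (Hkap : 0 < kappa) by (apply Rdiv_lt_0_compat; lra).
set (l := fun t : R => (a + RtoC t * Ci)%C).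
assert (Disc : forall t u, Cmod (u - l t) <= kappa * t -> Om u)
  by (intros t u; apply cone_disc; auto).
assert (Ol : forall t, 1 <= t -> Om (l t)).
{ intros t Ht. apply (Disc t). replace (l t - l t)%C with (0 : C) by ring.
  rewrite Cmod_0. apply Rmult_le_pos; lra. }
assert (Ng : forall u, Om u -> f1 (g u) <> 0%C).
{ intros u Hu. apply no_critical. rewrite (proj1 (Hg u Hu)). now apply Sec. }
set (gam := fun t => g (l t)).
assert (Fgam : forall t, 1 <= t -> f (gam t) = l t) by (intros t Ht; now apply Hg, Ol).
set (v := fun t => (/ f1 (gam t) * Ci)%C).
assert (Dgam : forall t, 1 <= t -> curve_deriv gam t (v t)).
{ intros t Ht. unfold v.
  replace (/ f1 (gam t) * Ci)%C with (/ f1 (gam t) * Ci + 0 * Cconj Ci)%C by ring.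
  apply (wirt_curve g l). 2: apply curve_deriv_line.
  apply (wirt_inverse f f1 g). apply Hf. apply Ng, Ol, Ht. apply Hg, Ol, Ht.
  generalize (Oo _ (Ol t Ht)). apply filter_imp. intros w Hw. now apply Hg. }
set (A := 400 / kappa ^ 4).
assert (PA : 0 < A) by (apply Rdiv_lt_0_compat; [lra | now apply pow_lt]).
assert (Decay : forall t, 1 <= t -> Re (excess h (gam t)) <= A / t ^ 2).
{ intros t Ht.
  assert (KO := keller_osserman f f1 (wirtinger f1) g (excess h) (excess_z h) (l t)
    (kappa * t) ltac:(apply Rmult_lt_0_compat; lra) Hf Hf1
    (fun z N => excess_ge0 h f1 h_smooth h_orientation Hhopf z N)
    (fun z N => excess_wirt h h_smooth h_disc h_eq z (Nq z N))
    (fun z N => excess_subsolution h f1 h_smooth h_disc h_eq h_orientation Hhopf z N)).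
  assert (KO' : Re (excess h (gam t)) * (kappa * t) ^ 4 <= 400).
  { apply KO. intros u Hu. assert (Ou := Disc t u Hu).
    destruct (Hg u Ou) as [X1 X2]. auto. }
  clear KO.
  assert (P4 : 0 < kappa ^ 4) by now apply pow_lt.
  assert (T2 : 1 <= t ^ 2) by nra.
  assert (Y0 := excess_ge0 h f1 h_smooth h_orientation Hhopf (gam t) (Ng _ (Ol t Ht))).
  assert (PT : 0 < kappa ^ 4 * t ^ 2) by (apply Rmult_lt_0_compat; lra).
  replace (A / t ^ 2) with (400 / (kappa ^ 4 * t ^ 2)) by (unfold A; field; split; lra).
  apply (Rle_div_r _ _ _ PT).
  eapply Rle_trans; [|exact KO'].
  replace (Re (excess h (gam t)) * (kappa * t) ^ 4)
    with (Re (excess h (gam t)) * kappa ^ 4 * t ^ 2 * t ^ 2) by ring.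
  replace (Re (excess h (gam t)) * (kappa ^ 4 * t ^ 2))
    with (Re (excess h (gam t)) * kappa ^ 4 * t ^ 2 * 1) by ring.
  apply Rmult_le_compat_l; [|exact T2].
  apply Rmult_le_pos; [|lra]. apply Rmult_le_pos; lra. }
destruct (hyperbolic_curve_bounded (fun t => h (gam t))
  (fun t => wirtinger h (gam t) * v t + wirtinger_bar h (gam t) * Cconj (v t))%C A)
  as [m [Hm Bnd]].
- lra.
- intros t _. apply h_disc.
- intros t Ht. apply (wirt_curve h gam). now apply smooth_wirt. now apply Dgam.
- intros t Ht. eapply Rle_trans; [|apply Decay, Ht].
  apply (hyperbolic_speed h f1); auto.
  unfold v. field. apply (Ng _ (Ol t Ht)).
- (* an accumulation point of [h o gam] at infinity, in the open disc *)
  set (lam := fun s => h (gam (/ (1 - s)))).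
  destruct (cluster_point lam 1 1) as [pt Hpt].
  { intros d Hd. exists (1 - Rmin d 1 / 2).
    assert (m1 := Rmin_l d 1). assert (m2 := Rmin_r d 1).
    assert (m3 : 0 < Rmin d 1) by (apply Rmin_glb_lt; lra).
    split. lra. apply Rlt_le, h_disc. }
  assert (Time : forall s, 0 < s < 1 -> 1 <= / (1 - s)).
  { intros s Hs. rewrite <- Rinv_1 at 1. apply Rinv_le_contravar; lra. }
  assert (Inside : hyp_plane pt).
  { unfold hyp_plane. apply Rnot_le_lt. intros L.
    assert (Hd : 0 < Rmin 1 (m / 2)) by (apply Rmin_glb_lt; lra).
    assert (n1 := Rmin_l 1 (m / 2)). assert (n2 := Rmin_r 1 (m / 2)).
    destruct (Hpt _ Hd) as [s [Hs K]].
    specialize (Bnd _ (Time s ltac:(lra))). fold (lam s) in Bnd.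
    assert (T := Cmod_sub_triangle pt (lam s) 0).
    replace (pt - 0)%C with pt in T by ring.
    replace (lam s - 0)%C with (lam s) in T by ring.
    rewrite Cmod_sub_sym in K. assert (Q := Cmod_ge_0 (lam s)). nra. }
  destruct (onto pt Inside) as [zs Hzs].
  assert (CG : continuous G pt)
    by (apply (continuous_of_smooth_on (image h)); auto; now exists zs).
  assert (CfG : continuous (fun w => f (G w)) pt)
    by (apply (continuous_comp G f); auto; apply (wirt_continuous _ _ _ _ (Hf _))).
  destruct (proj1 (locally_Cmod _ _) (proj1 (continuous_Cmod_iff _ _) CfG 1 Rlt_0_1))
    as [d [Hd K]].
  set (B := Cmod (f (G pt)) + Cmod a + 1).
  assert (PB : 1 <= B).
  { unfold B. assert (Q1 := Cmod_ge_0 (f (G pt))). assert (Q2 := Cmod_ge_0 a). lra. }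
  assert (PB' : 0 < / B) by (apply Rinv_0_lt_compat; lra).
  assert (PB1 : / B <= 1) by (rewrite <- Rinv_1; apply Rinv_le_contravar; lra).
  assert (n1 := Rmin_l d (/ B)). assert (n2 := Rmin_r d (/ B)).
  destruct (Hpt (Rmin d (/ B)) ltac:(now apply Rmin_glb_lt)) as [s [Hs L]].
  specialize (K (lam s) ltac:(lra)). unfold lam in K. rewrite Gh in K.
  assert (Ht := Time s ltac:(lra)). rewrite Fgam in K by exact Ht.
  set (t := / (1 - s)) in *.
  assert (tB : B < t).
  { rewrite <- (Rinv_inv B). apply Rinv_lt_contravar; [|lra].
    apply Rmult_lt_0_compat; lra. }
  assert (T1 := Cmod_sub_triangle (l t) (f (G pt)) 0).
  assert (T2 := Cmod_triangle (l t) (- a)).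
  replace (l t - 0)%C with (l t) in T1 by ring.
  replace (f (G pt) - 0)%C with (f (G pt)) in T1 by ring.
  replace (l t + - a)%C with (RtoC t * Ci)%C in T2 by (unfold l; ring).
  rewrite Cmod_mult, Cmod_Ci, Cmod_R, Rabs_right, Cmod_opp in T2 by lra.
  unfold B in tB. lra.
Qed.
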